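(* Assume that (i) the $\mathbb{P}$-essential infimum of $V$ is $0$ and the $\mathbb{P}$-essential supremum of $V$ is $1$, and (ii) for every $h\in(0,1)$ and $\ell\in\mathbb{N}$, $\mathbb{P}(V(T_y\omega)\le h \text{ for all } y\in\{0,\ldots,\ell\})>0$ and $\mathbb{P}(V(T_y\omega)\ge h \text{ for all } y\in\{0,\ldots,\ell\})>0$. Let $\delta\in[0,1]$, $\beta>0$ and $\theta\in\mathbb{R}$. Then for $\mathbb{P}$-a.e. $\omega$ the function $$u_\epsilon(t,x,\omega)=\epsilon\,u([\epsilon^{-1}t],[\epsilon^{-1}x],\omega\,|\,\delta,\beta,\theta),\qquad (t,x)\in[0,\infty)\times\mathbb{R},$$ converges as $\epsilon\to0$, uniformly on compact subsets of $[0,\infty)\times\mathbb{R}$, to $u_o(t,x)=t\,\overline H_{\delta,\beta}(\theta)+\theta x$, where the effective Hamiltonian is given as follows, with $c=\frac12\log\left(\frac{1+\delta}{1-\delta}\right)$ when $\delta\in(0,1)$: (no control) if $\delta=0$: $\overline H_{0,\beta}(\theta)=\Lambda_\beta(\theta)$; (full control) if $\delta=1$: $\overline H_{1,\beta}(\theta)=0$ if $|\theta|<\beta\mathbb{E}[V(\cdot)]$ and $\overline H_{1,\beta}(\theta)=\beta\mathbb{E}[V(\cdot)]-|\theta|$ if $|\theta|\ge\beta\mathbb{E}[V(\cdot)]$; (weak control) if $\delta\in(0,1)$ and $\beta\ge\log\cosh(c)$: $\overline H_{\delta,\beta}(\theta)=\beta-\log\cosh(c)$ if $|\theta|<c$ and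 $\overline H_{\delta,\beta}(\theta)=\Lambda_\beta(|\theta|-c)-\log\cosh(c)$ if $|\theta|\ge c$; (strong control) if $\delta\in(0,1)$ and $\beta<\log\cosh(c)$: $\overline H_{\delta,\beta}(\theta)=0$ if $|\theta|<|\bar\theta(\beta,c)|$ and $\overline H_{\delta,\beta}(\theta)=\Lambda_\beta(|\theta|-c)-\log\cosh(c)$ if $|\theta|\ge|\bar\theta(\beta,c)|$, where $\bar\theta(\beta,c)$ is the unique element of $(0,c)$ with $\Lambda_\beta(\bar\theta(\beta,c)-c)=\log\cosh(c)$.
   Context: $(\Omega,\mathcal{F},\mathbb{P})$ is a probability space equipped with an ergodic invertible measure-preserving transformation $T:\Omega\to\Omega$; $\mathbb{E}$ is expectation under $\mathbb{P}$; $T_0=I$, $T_k=T\circ T_{k-1}$ and $T_{-k}=(T_k)^{-1}$ for $k\in\mathbb{N}=\{1,2,\ldots\}$. $V:\Omega\to[0,1]$ is a nonconstant measurable function. $[\cdot]$ denotes the floor function. For $n\in\mathbb{N}$ and $\delta\in[0,1]$, $\mathcal{P}_n(\delta)$ is the set of all $\pi=(\pi_0,\ldots,\pi_{n-1})$ where each $\pi_i=\pi_i(n,\omega,y,\pm1)\in[0,1]^2$ is $\mathcal{F}$-measurable in $\omega$ and satisfies $\pi_i(n,\omega,y,-1)+\pi_i(n,\omega,y,1)=1$ and $|\pi_i(n,\omega,y,1)-\pi_i(n,\omega,y,-1)|\le\delta$ for every $i\in\{0,\ldots,n-1\}$, $\omega\in\Omega$, $y\in\mathbb{Z}$. Given $\omega\in\Omega$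 and $x\in\mathbb{Z}$, $\pi$ induces the probability measure $P_x^{\pi,\omega}$ (expectation $E_x^{\pi,\omega}$) on paths $(x_0,\ldots,x_n)\in\mathbb{Z}^{n+1}$ with $x_0=x$ and $z_{i+1}=x_{i+1}-x_i\in\{-1,1\}$ by $P_x^{\pi,\omega}(X_0=x_0,\ldots,X_n=x_n)=\prod_{i=0}^{n-1}\pi_i(n,\omega,x_i,z_{i+1})$. Define, for $n\in\mathbb{N}$, $$u(n,x,\omega\,|\,\delta,\beta,\theta)=\inf_{\pi\in\mathcal{P}_n(\delta)}\log E_x^{\pi,\omega}\left[e^{\beta\sum_{i=0}^{n-1}V(T_{X_i}\omega)+\theta X_n}\right],$$ and $u(0,x,\omega\,|\,\delta,\beta,\theta)=\theta x$. The tilted free energy is $\Lambda_\beta(\theta)=\lim_{n\to\infty}\frac1n\log E_0\left[e^{\beta\sum_{i=0}^{n-1}V(T_{X_i}\omega)+\theta X_n}\right]$, where $E_0$ is expectation for simple symmetric random walk on $\mathbb{Z}$ started at $0$; under assumptions (i)-(ii) this limit exists for $\mathbb{P}$-a.e. $\omega$ and is deterministic, for every $\beta>0$ and $\theta\in\mathbb{R}$. In the strong control case, existence and uniqueness of $\bar\theta(\beta,c)$ hold under (i)-(ii). (Interpretation: $u_\epsilon$ solves a rescaled Bellman equation, a second-order Hamilton-Jacobi stochastic partial difference equation with initial condition $\theta\epsilon[\epsilon^{-1}x]$, and $u_o$ solves $\partial_t u_o=\overline H_{\delta,\beta}(\partial_x u_o)$, $u_o(0,x)=\theta x$.) *)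

(* Defs.v *)
From HB Require Import structures.
From mathcomp Require Import all_boot all_order all_algebra.
From mathcomp Require Import all_classical all_reals all_analysis.

Set Implicit Arguments.
Unset Strict Implicit.
Unset Printing Implicit Defensive.

Import Order.TTheory GRing.Theory Num.Theory.
Import numFieldNormedType.Exports.

Local Open Scope classical_set_scope.
Local Open Scope ring_scope.

Record ergodic_automorphism (R : realType) (d : measure_display)
    (Omega : measurableType d) (P : probability Omega R)
    (T Tinv : Omega -> Omega) : Prop := ErgodicAutomorphism {
  ea_TK : cancel T Tinv ;
  ea_TinvK : cancel Tinv T ;
  ea_measurable : measurable_fun setT T ;
  ea_measurable_inv : measurable_fun setT Tinv ;
  ea_preserving : forall A : set Omega,
    measurable A -> P (T @^-1` A) = P A ;
  ea_ergodic : forall A : set Omega,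
    measurable A -> T @^-1` A = A -> P A = 0%E \/ P A = 1%E }.

Definition iterz (Omega : Type) (T Tinv : Omega -> Omega) (k : int) :
    Omega -> Omega :=
  match k with
  | Posz m => iter m T
  | Negz m => iter m.+1 Tinv
  end.

(* The steps of a nearest-neighbour path are booleans: true stands for +1 and
   false for -1. A path of length n is its starting point together with its
   n steps. *)
Definition step (b : bool) : int := if b then 1 else - 1.

Definition walk (n : nat) (x : int) (z : {ffun 'I_n -> bool}) (k : nat) : int :=
  x + \sum_(j < n | (j < k)%N) step (z j).

(* p i y b is the probability of making the step b at time i from the site y. *)
Definition path_prob (R : realType) (n : nat) (p : 'I_n -> int -> bool -> R)
    (x : int) (z : {ffun 'I_n -> bool}) : R :=
  \prod_(i < n) p i (walk x z i) (z i).

Definition path_expectation (R : realType) (n : nat)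
    (p : 'I_n -> int -> bool -> R) (x : int)
    (F : {ffun 'I_n -> bool} -> R) : R :=
  \sum_(z : {ffun 'I_n -> bool}) path_prob p x z * F z.

Definition srw (R : realType) (n : nat) : 'I_n -> int -> bool -> R :=
  fun _ _ _ => 2^-1.

Definition tilt (R : realType) (Omega : Type) (T Tinv : Omega -> Omega)
    (V : Omega -> R) (beta theta : R) (w : Omega) (n : nat) (x : int)
    (z : {ffun 'I_n -> bool}) : R :=
  expR (beta * \sum_(i < n) V (iterz T Tinv (walk x z i) w)
        + theta * (walk x z n)%:~R).

Record policy (R : realType) (d : measure_display) (Omega : measurableType d)
    (n : nat) (delta : R) (pol : 'I_n -> Omega -> int -> bool -> R) : Prop :=
  Policy {
  policy_measurable : forall i y b, measurable_fun setT (fun w => pol i w y b) ;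
  policy_itv : forall i w y b, 0 <= pol i w y b <= 1 ;
  policy_sum : forall i w y, pol i w y false + pol i w y true = 1 ;
  policy_delta : forall i w y, `|pol i w y true - pol i w y false| <= delta }.

Definition u (R : realType) (d : measure_display) (Omega : measurableType d)
    (T Tinv : Omega -> Omega) (V : Omega -> R) (delta beta theta : R)
    (n : nat) (x : int) (w : Omega) : R :=
  match n with
  | 0%N => theta * x%:~R
  | m.+1 =>
      inf [set r | exists2 pol : 'I_m.+1 -> Omega -> int -> bool -> R,
             policy delta pol &
             r = ln (path_expectation (fun i => pol i w) x
                       (tilt T Tinv V beta theta w x))]
  end.

(* For t >= 0 and eps > 0, Num.truncn (eps^-1 * t) is the floor of eps^-1 * t
   as a natural number. *)
Definition u_eps (R : realType) (d : measure_display) (Omega : measurableType d)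
    (T Tinv : Omega -> Omega) (V : Omega -> R) (delta beta theta : R)
    (w : Omega) (eps : R) (tx : R * R) : R :=
  eps * u T Tinv V delta beta theta
          (Num.truncn (eps^-1 * tx.1)) (Num.floor (eps^-1 * tx.2)) w.

(* Tilted free energy: the almost sure limit, which is a constant, of the
   normalized log-moment generating functions. Such a constant is unique. *)
Definition Lambda (R : realType) (d : measure_display)
    (Omega : measurableType d) (P : probability Omega R)
    (T Tinv : Omega -> Omega) (V : Omega -> R) (beta theta : R) : R :=
  xget 0 [set l : R | {ae P, forall w,
    (fun n : nat => n%:R^-1 * ln (path_expectation (@srw R n) 0
                        (tilt T Tinv V beta theta w 0))) @ \oo --> l}].

Definition cosh (R : realType) (x : R) : R := (expR x + expR (- x)) / 2.

Definition control_c (R : realType) (delta : R) : R :=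
  2^-1 * ln ((1 + delta) / (1 - delta)).

(* The unique t in (0, c) with Lambda (t - c) = log cosh c; meaningful under
   strong control, where it exists. *)
Definition theta_bar (R : realType) (d : measure_display)
    (Omega : measurableType d) (P : probability Omega R)
    (T Tinv : Omega -> Omega) (V : Omega -> R) (beta c : R) : R :=
  xget 0 [set t : R | 0 < t < c
                      /\ Lambda P T Tinv V beta (t - c) = ln (cosh c)].

Definition Hbar (R : realType) (d : measure_display)
    (Omega : measurableType d) (P : probability Omega R)
    (T Tinv : Omega -> Omega) (V : Omega -> R) (delta beta theta : R) : R :=
  let L := Lambda P T Tinv V beta in
  let EV := fine 'E_P[V] in
  let c := control_c delta in
  let tb := theta_bar P T Tinv V beta c in
  if delta == 0 then L theta
  else if delta == 1 then
    if `|theta| < beta * EV then 0 else beta * EV - `|theta|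
  else if ln (cosh c) <= beta then
    if `|theta| < c then beta - ln (cosh c) else L (`|theta| - c) - ln (cosh c)
  else
    if `|theta| < `|tb| then 0 else L (`|theta| - c) - ln (cosh c).

(* Main.v *)
Require Import Defs.
From HB Require Import structures.
From mathcomp Require Import all_boot all_order all_algebra.
From mathcomp Require Import all_classical all_reals all_analysis.
From mathcomp Require Import ess_sup_inf measurable_realfun ring lra zify.

(** The value function solves a discrete Bellman equation whose right-hand side
[bell] is monotone and positively homogeneous.  Hence it is squeezed, up to
factors exp(o(n)), between supersolutions and subsolutions [phi] of
[bell phi = exp H * phi], and it suffices to exhibit such functions with
logarithmic slope [theta].

Without control the equation is the linear recursion
g(x+1) + g(x-1) = 2 exp(lam - beta V(x)) g(x).  For lam > beta it has a growing
and a decaying positive solution, given by stationary continued fractions, with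
slopes +m(lam) and -m(lam) by the ergodic theorem; since m is continuous and
unbounded, Lambda(theta) = lam when m(lam) = |theta|, and Lambda(theta) = beta
when |theta| lies below every m(lam).  Tilting by exp(c x) turns the increasing
solutions of the controlled equation into solutions of the linear one, which
produces Lambda(|theta| - c) - log cosh c.

The flat pieces come from functions attached to an exceptional stretch of the
environment, which by ergodicity lies within o(n) of every point considered.
Where V is almost 0, a valley-shaped supersolution (drift towards the stretch)
gives the upper bound max(beta, log cosh c) - log cosh c.  Where V is almost 1,
a bump (staying in the stretch against any control) gives the lower bound
beta - log cosh c.  The lower bound 0 of the strong control regime needs no
special stretch: it is given by a peak made of solutions with
lam = log cosh c. *)

Set Implicit Arguments.
Unset Strict Implicit.
Import Order.TTheory GRing.Theory Num.Theory.
Import numFieldNormedType.Exports.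

Local Open Scope classical_set_scope.
Local Open Scope ring_scope.

(** * The Bellman recursion and its comparison principle *)

(** Comparison arguments are pathwise: the environment is a fixed sequence on the integers, and
    probability enters only through slopes of Birkhoff sums and the frequency of long stretches.
    Errors have the form [eps * (n + |x|) + C] with [C] independent of [n] and [x]; this is what the
    rescaling turns into locally uniform convergence, and it lets a sub- or supersolution be chosen
    afresh for each [n] and [x].

    With [delta = tanh c], always pushing to the left becomes, after conjugation by [exp (c x)], the
    free walk with weight divided by [cosh c] at each step. This bounds the value from above for
    every slope, but it is optimal only along functions [exp (c x) g] that increase. For the growing
    solution of the linear equation this is automatic; for the decaying one it requires one-step
    ratios at most [exp c], which holds as long as [lam <= log cosh c], because
    [exp c + exp (- c) = 2 cosh c]. Hence the threshold, and the edge [c - m(log cosh c)] of the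
    flat piece under strong control. Negative slopes are treated by reflecting the environment. *)

Section bellman.
Context {R : realType}.
Implicit Types (delta H theta A p q : R) (n : nat) (V f g phi : int -> R) (x y : int).

(** The minimum of [a * p + b * q] over weights with [a + b = 1] and [|a - b| <= delta]: the
    controller shifts as much weight as allowed towards the smaller value. *)
Definition mix delta p q : R := (p + q) / 2 - delta / 2 * `|p - q|.

Lemma mixC delta p q : mix delta p q = mix delta q p.
Proof. by rewrite /mix (addrC p) distrC. Qed.

Lemma mixE delta p q : p <= q ->
  mix delta p q = (1 + delta) / 2 * p + (1 - delta) / 2 * q.
Proof. by move=> pq; rewrite /mix ler0_norm ?subr_le0//; field. Qed.

Lemma mix_lel delta p q : 0 <= delta ->
  mix delta p q <= (1 + delta) / 2 * p + (1 - delta) / 2 * q.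
Proof.
move=> d0; have [pq|/ltW qp] := lerP p q; first by rewrite mixE.
rewrite mixC mixE//; nra.
Qed.

Lemma mix_ler delta p q : 0 <= delta ->
  mix delta p q <= (1 - delta) / 2 * p + (1 + delta) / 2 * q.
Proof. by move=> d0; rewrite mixC [leRHS]addrC; exact: mix_lel. Qed.

(** [mix] is the smaller of the two extreme averages, and their weights are nonnegative because
    [delta <= 1]. *)
Lemma le_mix delta p q p' q' : 0 <= delta <= 1 -> p <= p' -> q <= q' ->
  mix delta p q <= mix delta p' q'.
Proof.
move=> /andP[d0 d1] pp qq; have [pq|/ltW qp] := lerP p' q'.
  rewrite [leRHS]mixE//; apply: le_trans (mix_lel _ _ d0) _; nra.
rewrite [leRHS]mixC [leRHS]mixE//; apply: le_trans (mix_ler _ _ d0) _; nra.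
Qed.

Lemma mixZ delta A p q : 0 <= A -> mix delta (A * p) (A * q) = A * mix delta p q.
Proof. by move=> A0; rewrite /mix -mulrBr normrM (ger0_norm A0); ring. Qed.

Lemma mix0 p q : mix 0 p q = (p + q) / 2.
Proof. by rewrite /mix; ring. Qed.

Lemma mixpp delta p : mix delta p p = p.
Proof. by rewrite /mix subrr normr0; lra. Qed.

Definition bell delta V f x : R :=
  expR (V x) * mix delta (f (x + 1)) (f (x - 1)).

Definition value delta V theta n : int -> R :=
  iter n (bell delta V) (fun x => expR (theta * x%:~R)).

Lemma valueS delta V theta n x :
  value delta V theta n.+1 x = bell delta V (value delta V theta n) x.
Proof. by []. Qed.

Lemma le_bell delta V f g x : 0 <= delta <= 1 ->
  f (x + 1) <= g (x + 1) -> f (x - 1) <= g (x - 1) ->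
  bell delta V f x <= bell delta V g x.
Proof. by move=> d fg1 fg2; rewrite ler_wpM2l ?expR_ge0// le_mix. Qed.

Lemma bellZ delta V A f x : 0 <= A ->
  bell delta V (fun y => A * f y) x = A * bell delta V f x.
Proof. by move=> A0; rewrite /bell mixZ// mulrCA. Qed.

Lemma near_stepl (n : nat) x y : (`|y - (x + 1)| <= n%:Z -> `|y - x| <= n.+1%:Z).
Proof. by lia. Qed.

Lemma near_stepr (n : nat) x y : (`|y - (x - 1)| <= n%:Z -> `|y - x| <= n.+1%:Z).
Proof. by lia. Qed.

(** Influence spreads by one site per step, so the initial comparison is required only within
    distance [n] of [x]. This leaves room for a factor [A] that depends on [n] and [x]. *)
Lemma iter_bell_le_super delta V H A phi f n x : 0 <= delta <= 1 -> 0 <= A ->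
  (forall y, bell delta V phi y <= expR H * phi y) ->
  (forall y, `|y - x| <= n%:Z -> f y <= A * phi y) ->
  iter n (bell delta V) f x <= A * expR (n%:R * H) * phi x.
Proof.
move=> d A0 sup; elim: n x => [|n IH] x fphi.
  by rewrite mul0r expR0 mulr1 /= fphi// subrr normr0.
rewrite iterS.
have le1 : iter n (bell delta V) f (x + 1) <= A * expR (n%:R * H) * phi (x + 1).
  by apply: IH => y /near_stepl; exact: fphi.
have le2 : iter n (bell delta V) f (x - 1) <= A * expR (n%:R * H) * phi (x - 1).
  by apply: IH => y /near_stepr; exact: fphi.
apply: (le_trans (le_bell V d le1 le2 : _ <= bell delta V (fun y => _ * phi y) x)).
have A1 : 0 <= A * expR (n%:R * H) by rewrite mulr_ge0 ?expR_ge0.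
rewrite bellZ// -natr1 mulrDl mul1r expRD mulrA -[leRHS]mulrA.
exact: ler_wpM2l.
Qed.

Lemma iter_bell_ge_sub delta V H A phi f n x : 0 <= delta <= 1 -> 0 <= A ->
  (forall y, expR H * phi y <= bell delta V phi y) ->
  (forall y, `|y - x| <= n%:Z -> A * phi y <= f y) ->
  A * expR (n%:R * H) * phi x <= iter n (bell delta V) f x.
Proof.
move=> d A0 sub; elim: n x => [|n IH] x fphi.
  by rewrite mul0r expR0 mulr1 /= fphi// subrr normr0.
rewrite iterS.
have le1 : A * expR (n%:R * H) * phi (x + 1) <= iter n (bell delta V) f (x + 1).
  by apply: IH => y /near_stepl; exact: fphi.
have le2 : A * expR (n%:R * H) * phi (x - 1) <= iter n (bell delta V) f (x - 1).
  by apply: IH => y /near_stepr; exact: fphi.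
apply: le_trans (le_bell V d le1 le2 : bell delta V (fun y => _ * phi y) x <= _).
have A1 : 0 <= A * expR (n%:R * H) by rewrite mulr_ge0 ?expR_ge0.
rewrite bellZ// -natr1 mulrDl mul1r expRD mulrA -[leLHS]mulrA.
exact: ler_wpM2l.
Qed.

Lemma mix_gt0 delta p q : 0 <= delta <= 1 -> 0 < p -> 0 < q -> 0 < mix delta p q.
Proof.
move=> /andP[d0 d1] p0 q0; have [pq|/ltW qp] := lerP p q.
  by rewrite mixE//; nra.
by rewrite mixC mixE//; nra.
Qed.

Lemma value_gt0 delta V theta n x : 0 <= delta <= 1 -> 0 < value delta V theta n x.
Proof.
move=> d; elim: n x => [|n IH] x; first exact: expR_gt0.
by rewrite valueS mulr_gt0 ?expR_gt0// mix_gt0.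
Qed.

Definition err (eps C : R) (n : nat) x : R := eps * (n%:R + `|x%:~R|) + C.

Definition UB delta V theta H := forall eps, 0 < eps -> exists C, forall n x,
  value delta V theta n x <= expR (n%:R * H + theta * x%:~R + err eps C n x).

Definition LB delta V theta H := forall eps, 0 < eps -> exists C, forall n x,
  expR (n%:R * H + theta * x%:~R - err eps C n x) <= value delta V theta n x.

(** Three errors are incurred: the excess growth over [n] steps, the comparison with the initial
    datum around [x], and the size of [phi x]. Each receives a third of [eps]. *)
Lemma UB_super delta V theta H : 0 <= delta <= 1 ->
  (forall eps, 0 < eps -> exists C, forall n x, exists phi : int -> R,
     [/\ forall y, bell delta V phi y <= expR (H + eps) * phi y,
         forall y, `|y - x| <= n%:Z ->
           expR (theta * y%:~R) <= expR (err eps C n x) * phi y &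
         phi x <= expR (theta * x%:~R + err eps C n x)]) ->
  UB delta V theta H.
Proof.
move=> d super eps eps0; have eps3 : 0 < eps / 3 by rewrite divr_gt0.
have [C HC] := super _ eps3; exists (2 * C) => n x.
have [phi [h1 h2 h3]] := HC n x.
apply: le_trans (iter_bell_le_super d (expR_ge0 _) h1 h2) _.
rewrite -mulrA; apply: le_trans (_ : _ <= expR (err (eps / 3) C n x) *
  (expR (n%:R * (H + eps / 3)) * expR (theta * x%:~R + err (eps / 3) C n x))) _.
  by rewrite !ler_wpM2l ?expR_ge0.
rewrite -!expRD ler_expR /err.
have := normr_ge0 (x%:~R : R); have : 0 <= n%:R :> R by []; nra.
Qed.

Lemma LB_sub delta V theta H : 0 <= delta <= 1 ->
  (forall eps, 0 < eps -> exists C, forall n x, exists phi : int -> R,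
     [/\ forall y, expR (H - eps) * phi y <= bell delta V phi y,
         forall y, `|y - x| <= n%:Z ->
           expR (- err eps C n x) * phi y <= expR (theta * y%:~R) &
         expR (theta * x%:~R - err eps C n x) <= phi x]) ->
  LB delta V theta H.
Proof.
move=> d sub eps eps0; have eps3 : 0 < eps / 3 by rewrite divr_gt0.
have [C HC] := sub _ eps3; exists (2 * C) => n x.
have [phi [h1 h2 h3]] := HC n x.
apply: le_trans (iter_bell_ge_sub d (expR_ge0 _) h1 h2).
rewrite -mulrA; apply: le_trans (_ : expR (- err (eps / 3) C n x) *
  (expR (n%:R * (H - eps / 3)) * expR (theta * x%:~R - err (eps / 3) C n x)) <= _).
  rewrite -!expRD ler_expR /err.
  have := normr_ge0 (x%:~R : R); have : 0 <= n%:R :> R by []; nra.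
by rewrite !ler_wpM2l ?expR_ge0.
Qed.

Lemma UB_le delta V theta H H' : H <= H' -> UB delta V theta H -> UB delta V theta H'.
Proof.
move=> HH ub eps /ub[C hC]; exists C => n x; apply: le_trans (hC n x) _.
by rewrite ler_expR !lerD2r ler_wpM2l.
Qed.

Lemma UB_limit delta V theta H :
  (forall e, 0 < e -> UB delta V theta (H + e)) -> UB delta V theta H.
Proof.
move=> ub eps eps0; have e2 : 0 < eps / 2 by rewrite divr_gt0.
have [C hC] := ub _ e2 _ e2; exists C => n x; apply: le_trans (hC n x) _.
rewrite ler_expR /err.
have := normr_ge0 (x%:~R : R); have : 0 <= n%:R :> R by []; nra.
Qed.

Lemma UB_LB_le delta V theta H1 H2 :
  LB delta V theta H1 -> UB delta V theta H2 -> H1 <= H2.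
Proof.
move=> lb ub; apply/ler_addgt0Pr => e e0.
have e4 : 0 < e / 4 by rewrite divr_gt0.
have [C1 h1] := lb _ e4; have [C2 h2] := ub _ e4.
(* Beyond this [n] the constants cost at most [e / 2] per step, and the two terms [e / 4] cost the
   other half. *)
pose n := (Num.truncn (`|2 * (C1 + C2) / e|)).+1.
have := le_trans (h1 n 0) (h2 n 0).
rewrite ler_expR /err normr0 mulr0 !addr0 => h.
have n0 : 0 < n%:R :> R by rewrite ltr0n.
have hn : 2 * (C1 + C2) / e < n%:R.
  by apply: le_lt_trans (ler_norm _) _; rewrite truncnS_gt.
rewrite ltr_pdivrMr// in hn.
rewrite -(ler_pM2l n0); nra.
Qed.

End bellman.

(** * Dynamic programming *)

Section paths.
Context {R : realType}.
Implicit Types (delta theta : R) (U : int -> R) (x y : int).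

Definition cons_step n (b : bool) (z : {ffun 'I_n -> bool}) : {ffun 'I_n.+1 -> bool} :=
  [ffun i => oapp z b (unlift ord0 i)].

Lemma cons_step0 n b (z : {ffun 'I_n -> bool}) : cons_step b z ord0 = b.
Proof. by rewrite ffunE unlift_none. Qed.

Lemma cons_stepS n b (z : {ffun 'I_n -> bool}) i : cons_step b z (lift ord0 i) = z i.
Proof. by rewrite ffunE liftK. Qed.

Lemma walk_cons0 n x b (z : {ffun 'I_n -> bool}) : walk x (cons_step b z) 0 = x.
Proof. by rewrite /walk big_pred0 ?addr0. Qed.

Lemma walk_consS n x b (z : {ffun 'I_n -> bool}) k :
  walk x (cons_step b z) k.+1 = walk (x + step b) z k.
Proof.
rewrite /walk big_mkcond big_ord_recl /= cons_step0 -addrA; congr (_ + (_ + _)).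
rewrite [RHS]big_mkcond; apply: eq_bigr => i _.
by rewrite cons_stepS /bump /= add1n ltnS.
Qed.

Lemma sum_cons_step n (F : {ffun 'I_n.+1 -> bool} -> R) :
  \sum_z F z = \sum_(b : bool) \sum_(z : {ffun 'I_n -> bool}) F (cons_step b z).
Proof.
rewrite pair_bigA /= (reindex (fun bz => cons_step bz.1 bz.2))//=.
exists (fun f => (f ord0, [ffun i => f (lift ord0 i)])) => [[b z] _|f _] /=.
  by congr (_, _); [rewrite cons_step0|apply/ffunP => i; rewrite ffunE cons_stepS].
apply/ffunP => i; rewrite ffunE; case: unliftP => [j|] ->//=.
by rewrite ffunE.
Qed.

Definition path_weight (U : int -> R) (theta : R) n x (z : {ffun 'I_n -> bool}) : R :=
  expR (\sum_(i < n) U (walk x z i) + theta * (walk x z n)%:~R).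

Lemma tilt_path_weight (Omega : Type) (T Tinv : Omega -> Omega) V beta theta w n x :
  tilt T Tinv V beta theta w x =1
  @path_weight (fun y => beta * V (iterz T Tinv y w)) theta n x.
Proof. by move=> z; rewrite /tilt mulr_sumr. Qed.

Lemma path_weight_cons U theta n x b (z : {ffun 'I_n -> bool}) :
  path_weight U theta x (cons_step b z) =
  expR (U x) * path_weight U theta (x + step b) z.
Proof.
rewrite /path_weight -expRD big_ord_recl walk_cons0 walk_consS addrA.
under eq_bigr => i _ do rewrite lift0 walk_consS.
by [].
Qed.

Lemma path_prob_cons n (p : 'I_n.+1 -> int -> bool -> R) x b z :
  path_prob p x (cons_step b z) =
  p ord0 x b * path_prob (fun i => p (lift ord0 i)) (x + step b) z.
Proof.
rewrite /path_prob big_ord_recl walk_cons0 cons_step0; congr (_ * _).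
apply: eq_bigr => i _.
by rewrite cons_stepS /= /bump /= add1n walk_consS.
Qed.

Lemma path_expectation0 (p : 'I_0 -> int -> bool -> R) U theta x :
  path_expectation p x (path_weight U theta x) = expR (theta * x%:~R).
Proof.
rewrite /path_expectation (bigD1 [ffun=> true])//= big1 ?addr0; last first.
  by move=> z /eqP[]; apply/ffunP => -[].
rewrite /path_prob big_ord0 mul1r /path_weight big_ord0 add0r /walk big_ord0.
by rewrite addr0.
Qed.

Lemma path_expectationS n (p : 'I_n.+1 -> int -> bool -> R) U theta x :
  path_expectation p x (path_weight U theta x) =
  expR (U x) * \sum_(b : bool) p ord0 x b *
    path_expectation (fun i => p (lift ord0 i)) (x + step b)
      (path_weight U theta (x + step b)).
Proof.
rewrite /path_expectation sum_cons_step mulr_sumr; apply: eq_bigr => b _.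
rewrite 2!mulr_sumr; apply: eq_bigr => z _.
by rewrite path_prob_cons path_weight_cons; ring.
Qed.

Definition admissible (delta : R) (q : bool -> R) :=
  [/\ forall b, 0 <= q b <= 1, q false + q true = 1 &
      `|q true - q false| <= delta].

Lemma mix_le_admissible delta q (a b : R) : admissible delta q ->
  mix delta a b <= q true * a + q false * b.
Proof.
move=> [_ q1 /ler_normlP[qd1 qd2]].
have -> : q true * a + q false * b =
   (a + b) / 2 - ((q true - q false) / 2) * (b - a).
  have -> : q false = 1 - q true by lra.
  by field.
rewrite /mix lerD2l lerN2; have [ab|ab] := lerP 0 (b - a).
  by rewrite distrC ger0_norm//; nra.
by rewrite distrC ltr0_norm//; nra.
Qed.

Lemma value_le_path_expectation n delta U theta (p : 'I_n -> int -> bool -> R) x :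
  0 <= delta <= 1 -> (forall i y, admissible delta (p i y)) ->
  value delta U theta n x <= path_expectation p x (path_weight U theta x).
Proof.
move=> d; elim: n p x => [|n IH] p x adm; first by rewrite path_expectation0.
rewrite valueS path_expectationS ler_wpM2l ?expR_ge0// big_bool /=.
apply: le_trans (mix_le_admissible _ _ (adm ord0 x)) _.
have [q01 _ _] := adm ord0 x.
have /andP[q0 _] := q01 true; have /andP[q1 _] := q01 false.
by apply: lerD; rewrite ler_wpM2l//; apply: IH => i; exact: adm.
Qed.

(** The larger weight goes to the neighbour with the smaller remaining value: when the value on the
    right is at least that on the left, the exclusive or is true for the step to the left. After
    step [i] there remain [n - i.+1] steps. *)
Definition greedy delta U theta n (i : 'I_n) (y : int) (b : bool) : R :=
  let up := (value delta U theta (n - i.+1) (y - 1) <=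
             value delta U theta (n - i.+1) (y + 1))%R in
  if up (+) b then (1 + delta) / 2 else (1 - delta) / 2.

Lemma greedy_admissible delta U theta n (i : 'I_n) y : 0 <= delta <= 1 ->
  admissible delta (greedy delta U theta i y).
Proof.
move=> /andP[d0 d1]; rewrite /greedy; split => [b||].
- by case: (_ (+) _); lra.
- by case: (value _ _ _ _ _ <= value _ _ _ _ _) => /=; lra.
- case: (value _ _ _ _ _ <= value _ _ _ _ _) => /=; last by apply/ler_normlP; split; lra.
  by apply/ler_normlP; split; lra.
Qed.

Lemma path_expectation_greedy n delta U theta x :
  path_expectation (@greedy delta U theta n) x (path_weight U theta x) =
  value delta U theta n x.
Proof.
elim: n x => [|n IH] x; first by rewrite path_expectation0.
rewrite path_expectationS valueS; congr (_ * _); rewrite big_bool /=.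
have E y : path_expectation (fun i : 'I_n => greedy delta U theta (lift ord0 i)) y
   (path_weight U theta y) = value delta U theta n y.
  by rewrite -IH; congr (@path_expectation R n _ y _).
rewrite !E /greedy /= subn1 /=.
case: (lerP (value delta U theta n (x - 1))) => /= [le|/ltW le].
  by rewrite mixC mixE// addrC.
by rewrite mixE.
Qed.

Lemma srw_path_expectation n U theta x :
  path_expectation (@srw R n) x (path_weight U theta x) = value 0 U theta n x.
Proof.
elim: n x => [|n IH] x; first by rewrite path_expectation0.
rewrite path_expectationS valueS; congr (_ * _); rewrite big_bool /=.
by rewrite !IH /srw mix0; field.
Qed.

End paths.

(** * The Bellman iterates as the value of the control problem *)

Section value_u.
Context {R : realType} {d : measure_display} {Omega : measurableType d}.
Context (T Tinv : Omega -> Omega) (V : Omega -> R).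
Implicit Types (delta beta theta : R) (x y : int).

Definition environment beta w (y : int) : R := beta * V (iterz T Tinv y w).

Lemma u_value delta beta theta n x w : 0 <= delta <= 1 ->
  u T Tinv V delta beta theta n x w = ln (value delta (environment beta w) theta n x).
Proof.
move=> d01; case: n => [|n]; first by rewrite /= expRK.
rewrite /u; set S := [set r | _].
have ubS r : S r -> ln (value delta (environment beta w) theta n.+1 x) <= r.
  move=> [pol [_ h1 h2 h3]] ->.
  have adm i y : admissible delta (pol i w y) by split.
  have -> : @tilt R Omega T Tinv V beta theta w n.+1 x = path_weight (environment beta w) theta x.
    by apply: boolp.funext => z; rewrite tilt_path_weight.
  have vpos : 0 < value delta (environment beta w) theta n.+1 x by exact: value_gt0.
  have le := value_le_path_expectation (environment beta w) theta x d01 adm.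
  by rewrite ler_ln// posrE//; exact: lt_le_trans le.
apply/eqP; rewrite eq_le; apply/andP; split.
  apply: ge_inf; first by exists (ln (value delta (environment beta w) theta n.+1 x)).
  (* The infimum is taken for the given [w], so it is enough to take the policy optimal for this
     environment and constant in its sample argument; measurability is then immediate. *)
  exists (fun i _ => greedy delta (environment beta w) theta i); last first.
    rewrite -path_expectation_greedy; congr (ln (@path_expectation R n.+1 _ x _)).
    by apply/funext => z; rewrite tilt_path_weight.
  split.
  - by move=> *; exact: measurable_cst.
  - by move=> i _ y b; have [] := greedy_admissible (environment beta w) theta i y d01.
  - by move=> i _ y; have [] := greedy_admissible (environment beta w) theta i y d01.
  - by move=> i _ y; have [] := greedy_admissible (environment beta w) theta i y d01.
apply: lb_le_inf; last exact: ubS.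
(* The fair coin shows that the set under the infimum is nonempty. *)
eexists; exists (fun _ _ _ _ => 2^-1); last by [].
have /andP[d0 d1] := d01.
split.
- by move=> *; exact: measurable_cst.
- by move=> *; lra.
- by move=> *; lra.
- by move=> *; rewrite subrr normr0.
Qed.

End value_u.

(** * Correctors of the linear problem *)

Section environment.
Context {R : realType}.
Implicit Types (delta beta c H theta lam m : R) (V f g phi : int -> R) (x y : int).

Definition rate g m := forall eps, 0 < eps -> exists2 C, 0 <= C & forall x,
  expR (m * x%:~R - (eps * `|x%:~R| + C)) <= g x <=
  expR (m * x%:~R + (eps * `|x%:~R| + C)).

Lemma normr_near (n : nat) x y : `|y - x| <= n%:Z ->
  `|y%:~R| <= `|x%:~R| + n%:R :> R.
Proof.
move=> yx; rewrite -(subrK x y) intrD; apply: le_trans (ler_normD _ _) _.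
rewrite addrC lerD2l -intr_norm -[leRHS]/(n%:Z%:~R) ler_int.
exact: yx.
Qed.

Lemma rate_tilt g m c : rate g m -> rate (fun x => expR (c * x%:~R) * g x) (c + m).
Proof.
move=> gm eps /gm[C C0 hC]; exists C => // x.
have /andP[h1 h2] := hC x.
by rewrite mulrDl -!addrA !expRD !ler_pM2l ?expR_gt0// -!expRD h1 h2.
Qed.

Lemma rate_UB delta V phi theta H : 0 <= delta <= 1 -> rate phi theta ->
  (forall y, bell delta V phi y <= expR H * phi y) -> UB delta V theta H.
Proof.
move=> d rt sub; apply: UB_super => // eps eps0.
have [C C0 hC] := rt _ eps0; exists C => n x; exists phi; split => [y|y yx|].
- apply: le_trans (sub y) _; rewrite ler_wpM2r//.
    by apply: le_trans (expR_ge0 _) (andP (hC y)).1.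
  by rewrite ler_expR; lra.
- have /andP[h1 _] := hC y; rewrite -ler_pdivrMl ?expR_gt0// -expRN -expRD.
  apply: le_trans h1; rewrite ler_expR /err.
  have := normr_near yx; nra.
- have /andP[_ h2] := hC x; apply: le_trans h2 _; rewrite ler_expR /err.
  have : 0 <= n%:R :> R by []; nra.
Qed.

Lemma rate_LB delta V phi theta H : 0 <= delta <= 1 -> rate phi theta ->
  (forall y, expR H * phi y <= bell delta V phi y) -> LB delta V theta H.
Proof.
move=> d rt sub; apply: LB_sub => // eps eps0.
have [C C0 hC] := rt _ eps0; exists C => n x; exists phi; split => [y|y yx|].
- apply: le_trans (sub y); rewrite ler_wpM2r//.
    by apply: le_trans (expR_ge0 _) (andP (hC y)).1.
  by rewrite ler_expR; lra.
- have /andP[_ h2] := hC y; rewrite -ler_pdivlMl ?expR_gt0// -expRN -expRD.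
  apply: le_trans h2 _; rewrite ler_expR /err.
  have := normr_near yx; nra.
- have /andP[h1 _] := hC x; apply: le_trans h1; rewrite ler_expR /err.
  have : 0 <= n%:R :> R by []; nra.
Qed.

(** This is [delta = tanh c] written without logarithms; it covers [delta = 0] with [c = 0] and
    excludes [delta = 1]. *)
Definition control delta c :=
  (1 + delta) * cosh c = expR c /\ (1 - delta) * cosh c = expR (- c).

Lemma cosh_gt0 c : 0 < cosh c.
Proof. by rewrite /cosh divr_gt0// addr_gt0 ?expR_gt0. Qed.

Lemma cosh_ge1 c : 1 <= cosh c.
Proof.
rewrite /cosh ler_pdivlMr// mul1r expRN.
have e0 := expR_gt0 c; rewrite -subr_ge0.
have -> : expR c + (expR c)^-1 - 2 = (expR c - 1) ^+ 2 / expR c.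
  by field; rewrite gt_eqF.
by rewrite divr_ge0// ?sqr_ge0// ltW.
Qed.

Lemma cosh0 : cosh 0 = 1 :> R.
Proof. by rewrite /cosh oppr0 expR0; lra. Qed.

Lemma control0 : control 0 0.
Proof. by rewrite /control cosh0 addr0 subr0 oppr0 expR0 mul1r. Qed.

Lemma expR_sub_lncosh lam c : expR (lam - ln (cosh c)) = expR lam / cosh c.
Proof. by rewrite expRB lnK// posrE cosh_gt0. Qed.

Lemma control_le1 delta c : control delta c -> delta < 1.
Proof.
move=> [_ h]; rewrite -subr_gt0 -(pmulr_lgt0 _ (cosh_gt0 c)) h; exact: expR_gt0.
Qed.

(** Change of measure: the weight [exp (c x)] turns the two biased probabilities into equal ones, at
    the price of a factor [1 / cosh c]. *)
Lemma half_control delta c a : control delta c ->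
  (1 - delta) / 2 * expR (c * (a + 1)) = expR (c * a) / (2 * cosh c) /\
  (1 + delta) / 2 * expR (c * (a - 1)) = expR (c * a) / (2 * cosh c).
Proof.
move=> [h1 h2]; have K0 := cosh_gt0 c; have K0' : cosh c != 0 by rewrite gt_eqF.
have e1 : (1 + delta) = expR c / cosh c by rewrite -h1 mulfK.
have e2 : (1 - delta) = expR (- c) / cosh c by rewrite -h2 mulfK.
rewrite e1 e2 mulrDr mulrBr mulr1 expRD expRB expRN; split; field.
  by rewrite K0' gt_eqF ?expR_gt0.
by rewrite K0' gt_eqF ?expR_gt0.
Qed.

(** Where the tilted function increases across [x], the optimal control is the full push to the
    left, and the tilt transforms it into a fair step. *)
Lemma bell_tiltE delta c V f x : control delta c ->
  let phi y := expR (c * y%:~R) * f y in phi (x - 1) <= phi (x + 1) ->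
  bell delta V phi x = expR (c * x%:~R) / cosh c * bell 0 V f x.
Proof.
move=> dc phi le; have [h1 h2] := half_control x%:~R dc.
rewrite /bell mixC mixE// mix0 /phi !mulrA intrB intrD h1 h2; field.
by rewrite gt_eqF ?cosh_gt0.
Qed.

Lemma bell_tilt_le delta c V f x : 0 <= delta -> control delta c ->
  bell delta V (fun y => expR (c * y%:~R) * f y) x <=
  expR (c * x%:~R) / cosh c * bell 0 V f x.
Proof.
move=> d dc; have [h1 h2] := half_control x%:~R dc.
rewrite /bell mulrCA ler_wpM2l ?expR_ge0//.
apply: le_trans (mix_ler _ _ d) _; rewrite mix0 !mulrA intrB intrD h1 h2.
rewrite le_eqVlt; apply/orP; left; apply/eqP; field.
by rewrite gt_eqF ?cosh_gt0.
Qed.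

(** Pushing left at every step is an admissible strategy in any environment, so the free walk at
    slope [theta - c] supplies an upper bound. *)
Lemma UB_tilt delta c V theta H : 0 <= delta <= 1 -> control delta c ->
  UB 0 V (theta - c) H -> UB delta V theta (H - ln (cosh c)).
Proof.
move=> d dc ub eps eps0; have [C hC] := ub _ eps0; exists C => n x.
have /andP[d0 _] := d.
have key k y : value delta V theta k y <=
    expR (c * y%:~R) / cosh c ^+ k * value 0 V (theta - c) k y.
  elim: k y => [|k IH] y.
    by rewrite /= expr0 divr1 -expRD -mulrDl addrC subrK.
  pose g z := (cosh c ^+ k)^-1 * value 0 V (theta - c) k z.
  rewrite valueS.
  apply: le_trans (_ : _ <= bell delta V (fun z => expR (c * z%:~R) * g z) y) _.
    by apply: le_bell => //; rewrite mulrA.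
  apply: le_trans (bell_tilt_le _ _ _ d0 dc) _.
  have K0 : 0 <= (cosh c ^+ k)^-1 by rewrite invr_ge0 exprn_ge0// ltW// cosh_gt0.
  rewrite bellZ// valueS exprS.
  have -> : expR (c * y%:~R) / (cosh c * cosh c ^+ k) =
    expR (c * y%:~R) / cosh c * (cosh c ^+ k)^-1 by rewrite invfM mulrA.
  by rewrite mulrA.
apply: le_trans (key n x) _.
apply: le_trans (ler_wpM2l _ (hC n x)) _.
  by rewrite divr_ge0 ?expR_ge0// exprn_ge0// ltW// cosh_gt0.
have -> : cosh c ^+ n = expR (n%:R * ln (cosh c)).
  by rewrite expRM_natl lnK// posrE cosh_gt0.
by rewrite -expRN -!expRD ler_expR; lra.
Qed.

(** * Growing and decaying solutions of the linear equation *)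

Definition solves V lam g := forall x,
  g (x + 1) + g (x - 1) = 2 * expR (lam - V x) * g x.

Lemma bell0_solves V lam g x : solves V lam g -> bell 0 V g x = expR lam * g x.
Proof.
move=> sol; have -> : expR lam = expR (lam - V x) * expR (V x) by rewrite -expRD subrK.
by rewrite /bell mix0 sol; field.
Qed.

Lemma LB_solution delta c V lam m g : 0 <= delta -> control delta c ->
  solves V lam g -> rate g m -> (forall x, g x <= expR c * g (x + 1)) ->
  LB delta V (c + m) (lam - ln (cosh c)).
Proof.
move=> d dc sol rt mono; apply: (rate_LB _ (rate_tilt c rt)).
  by rewrite d ltW// (control_le1 dc).
move=> y; have inc z : expR (c * z%:~R) * g z <=
    expR (c * (z + 1)%:~R) * g (z + 1).
  by rewrite intrD mulrDr mulr1 expRD -mulrA ler_wpM2l ?expR_ge0.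
rewrite bell_tiltE//; last first.
  by have := inc (y - 1); rewrite subrK => /le_trans; apply; exact: inc.
rewrite (bell0_solves _ sol) expR_sub_lncosh le_eqVlt; apply/orP; left; apply/eqP; ring.
Qed.

(** [corr_upper] is stated for all such [K] because it is used with [K = expR c], for which the
    condition reads [expR lam <= cosh c]. The strict bound [1 < k] keeps the two solutions apart, so
    that a combination of them can take prescribed values at two neighbouring sites. *)
Record corrector V lam m (gp gm : int -> R) (k : R) : Prop := Corrector {
  corr_k : 1 < k ;
  corr_pos : forall x, 0 < gp x /\ 0 < gm x ;
  corr_solp : solves V lam gp ;
  corr_solm : solves V lam gm ;
  corr_ratep : rate gp m ;
  corr_ratem : rate gm (- m) ;
  corr_lower : forall x, k * gp x <= gp (x + 1) /\ k * gm (x + 1) <= gm x ;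
  corr_upper : forall K, 1 <= K -> 2 * expR lam <= K + K^-1 ->
    forall x, gp (x + 1) <= K * gp x /\ gm x <= K * gm (x + 1) }.

Definition corr V lam m := exists gp gm k, corrector V lam m gp gm k.

Lemma LB_grow delta c V lam m : 0 <= delta -> 0 <= c -> control delta c ->
  corr V lam m -> LB delta V (c + m) (lam - ln (cosh c)).
Proof.
move=> d c0 dc [gp [gm [k h]]].
apply: (LB_solution d dc (corr_solp h) (corr_ratep h)) => x.
have [gp0 _] := corr_pos h x; have [gp1 _] := corr_pos h (x + 1).
have [lo _] := corr_lower h x; have k1 := corr_k h.
have ec : 1 <= expR c by rewrite -expR0 ler_expR.
by nra.
Qed.

(** Although [gm] decays, [exp (c x) * gm x] still increases: the ratio bound applies with
    [K = expR c]. *)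
Lemma LB_decay delta c V lam m : 0 <= delta -> 0 <= c -> control delta c ->
  expR lam <= cosh c ->
  corr V lam m -> LB delta V (c - m) (lam - ln (cosh c)).
Proof.
move=> d c0 dc lc [gp [gm [k h]]].
apply: (LB_solution d dc (corr_solm h) (corr_ratem h)) => x.
have ec : 1 <= expR c by rewrite -expR0 ler_expR.
apply: (corr_upper h ec _ x).2.
by rewrite -expRN; move: lc; rewrite /cosh; lra.
Qed.

(** The growing solution dominates the exponential to the right of [x] and the decaying one to its
    left; the sum of both, normalized at [x], therefore covers every slope up to [m] in absolute
    value. *)
Lemma UB_corr V lam m theta : corr V lam m -> `|theta| <= m -> UB 0 V theta lam.
Proof.
move=> [gp [gm [k h]]] tm; apply: UB_super => [|eps eps0]; first by rewrite lexx ler01.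
have eps2 : 0 < eps / 2 by rewrite divr_gt0.
have [C1 C10 h1] := corr_ratep h eps2; have [C2 C20 h2] := corr_ratem h eps2.
(* The extra 1 pays for [phi x] being twice [expR (theta * x)], since [2 <= expR 1]. *)
exists (2 * C1 + 2 * C2 + 1) => n x.
exists (fun y => expR (theta * x%:~R) * ((gp x)^-1 * gp y + (gm x)^-1 * gm y)).
have [gpx gmx] := corr_pos h x.
split => [y|y yx|].
- rewrite /bell mix0 -mulrDr.
  have -> : (gp x)^-1 * gp (y + 1) + (gm x)^-1 * gm (y + 1) +
    ((gp x)^-1 * gp (y - 1) + (gm x)^-1 * gm (y - 1)) =
    (gp x)^-1 * (gp (y + 1) + gp (y - 1)) + (gm x)^-1 * (gm (y + 1) + gm (y - 1)).
    by ring.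
  rewrite (corr_solp h) (corr_solm h).
  have [gpy gmy] := corr_pos h y.
  have -> : expR (V y) * (expR (theta * x%:~R) *
     ((gp x)^-1 * (2 * expR (lam - V y) * gp y) +
      (gm x)^-1 * (2 * expR (lam - V y) * gm y)) / 2) =
     (expR (V y) * expR (lam - V y)) * (expR (theta * x%:~R) *
     ((gp x)^-1 * gp y + (gm x)^-1 * gm y)).
    by field; rewrite !gt_eqF.
  rewrite -expRD addrC subrK ler_wpM2r//.
    by rewrite mulr_ge0 ?expR_ge0// addr_ge0// mulr_ge0 ?invr_ge0// ltW.
  by rewrite ler_expR; lra.
- have [gpy gmy] := corr_pos h y.
  have n0 := normr_near yx.
  have /andP[a1 a2] := h1 x; have /andP[a3 a4] := h1 y.
  have /andP[b1 b2] := h2 x; have /andP[b3 b4] := h2 y.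
  have ineq a : (1 <= a * ((gp x)^-1 * gp y + (gm x)^-1 * gm y)) ->
     expR (theta * x%:~R) <= a * (expR (theta * x%:~R) * ((gp x)^-1 * gp y + (gm x)^-1 * gm y)).
    by move=> ha; rewrite mulrCA ler_peMr// expR_ge0.
  rewrite -[X in theta * X](subrK x%:~R) mulrDr expRD -ler_pdivlMl ?expR_gt0// -expRN.
  rewrite [leRHS]mulrA; apply: ineq; rewrite -expRD.
  rewrite -ler_pdivrMl ?expR_gt0// mulr1 -expRN.
  have nx := normr_ge0 (x%:~R : R).
  have nn : 0 <= n%:R :> R by [].
  move: tm; rewrite ler_norml => /andP[t1 t2].
  have [yx0|yx0] := lerP 0 (y%:~R - x%:~R : R).
    apply: le_trans (_ : (gp x)^-1 * gp y <= _); last first.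
      by rewrite lerDl mulr_ge0 ?invr_ge0 ?ltW.
    rewrite ler_pdivlMl//; apply: le_trans a3; apply: le_trans (ler_wpM2r (expR_ge0 _) a2) _.
    rewrite -expRD ler_expR /err; nra.
  apply: le_trans (_ : (gm x)^-1 * gm y <= _); last first.
    by rewrite lerDr mulr_ge0 ?invr_ge0 ?ltW.
  rewrite ler_pdivlMl//; apply: le_trans b3; apply: le_trans (ler_wpM2r (expR_ge0 _) b2) _.
  rewrite -expRD ler_expR /err; nra.
- rewrite !mulVf ?gt_eqF// expRD ler_wpM2l ?expR_ge0//.
  apply: le_trans (expR_ge1Dx _); rewrite /err.
  have := normr_ge0 (x%:~R : R); have : 0 <= n%:R :> R by []; nra.
Qed.

(** * Reflection of the environment *)

Definition refl V x := V (- x).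

Lemma bell_refl delta V f x : bell delta (refl V) (refl f) x = bell delta V f (- x).
Proof. by rewrite /bell /refl mixC; congr (_ * mix _ (f _) (f _)); lia. Qed.

Lemma value_refl delta V theta n x :
  value delta (refl V) (- theta) n x = value delta V theta n (- x).
Proof.
elim: n x => [|n IH] x; first by rewrite /value /= intrN mulrN mulNr.
rewrite !valueS -bell_refl; congr bell; exact/funext.
Qed.

Lemma UB_refl delta V theta H : UB delta (refl V) (- theta) H -> UB delta V theta H.
Proof.
move=> ub eps /ub[C hC]; exists C => n x.
have := hC n (- x); rewrite value_refl opprK => /le_trans; apply.
by rewrite ler_expR /err intrN normrN mulrNN.
Qed.

Lemma LB_refl delta V theta H : LB delta (refl V) (- theta) H -> LB delta V theta H.
Proof.
move=> lb eps /lb[C hC]; exists C => n x.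
have := hC n (- x); rewrite value_refl opprK; apply: le_trans.
by rewrite ler_expR /err intrN normrN mulrNN.
Qed.

Lemma rate_refl g m : rate g m -> rate (refl g) (- m).
Proof.
by move=> rt eps /rt[C C0 hC]; exists C => // x; have := hC (- x);
  rewrite intrN normrN mulrN mulNr.
Qed.

Lemma solves_refl V lam g : solves V lam g -> solves (refl V) lam (refl g).
Proof.
move=> sol x; rewrite -sol addrC; congr (g _ + g _); lia.
Qed.

Lemma corrector_refl V lam m gp gm k : corrector V lam m gp gm k ->
  corrector (refl V) lam m (refl gm) (refl gp) k.
Proof.
move=> h; split.
- exact: corr_k h.
- by move=> x; have [] := corr_pos h (- x).
- exact: solves_refl (corr_solm h).
- exact: solves_refl (corr_solp h).
- by rewrite -[m]opprK; exact: rate_refl (corr_ratem h).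
- exact: rate_refl (corr_ratep h).
- move=> x; have := corr_lower h (- (x + 1)); rewrite /refl.
  have -> : - (x + 1) + 1 = - x by lia.
  by case.
- move=> K K1 hK x; have := corr_upper h K1 hK (- (x + 1)); rewrite /refl.
  have -> : - (x + 1) + 1 = - x by lia.
  by case.
Qed.

Lemma corr_refl V lam m : corr V lam m -> corr (refl V) lam m.
Proof.
by move=> [gp [gm [k h]]]; exists (refl gm), (refl gp), k; exact: corrector_refl.
Qed.

(** * Stretches where the potential is nearly extreme *)

Definition near_everywhere (B : int -> Prop) := forall eps : R, 0 < eps ->
  exists2 C : R, 0 <= C & forall x, exists2 x0, B x0 &
    `|x0%:~R - x%:~R| <= eps * `|x%:~R| + C.

Definition high V beta := forall h (l : nat), h < beta ->
  near_everywhere (fun x0 => forall k, `|k| <= l%:Z -> h <= V (x0 + k)).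

Definition low V := forall h (l : nat), 0 < h ->
  near_everywhere (fun x0 => forall k, `|k| <= l%:Z -> V (x0 + k) <= h).

Lemma near_everywhere_refl (B B' : int -> Prop) : (forall x, B x -> B' (- x)) ->
  near_everywhere B -> near_everywhere B'.
Proof.
move=> BB near eps /near[C C0 hC]; exists C => // x.
have [x0 Bx0 hx0] := hC (- x); exists (- x0); first exact: BB.
by rewrite intrN -opprD normrN; rewrite intrN opprK normrN in hx0.
Qed.

Lemma high_refl V beta : high V beta -> high (refl V) beta.
Proof.
move=> hi h l /hi-/(_ l); apply: near_everywhere_refl => x hx k kl.
by rewrite /refl opprD opprK hx// normrN.
Qed.

Lemma low_refl V : low V -> low (refl V).
Proof.
move=> lo h l /lo-/(_ l); apply: near_everywhere_refl => x hx k kl.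
by rewrite /refl opprD opprK hx// normrN.
Qed.

End environment.

(** * Localized super- and subsolutions *)

Section localized.
Context {R : realType}.
Implicit Types (delta beta c H theta lam m : R) (V phi : int -> R) (x y : int).
Implicit Types (f g : nat -> R) (k n : nat).

(** Functions centred at [x0] are assembled from two sequences indexed by the distance to [x0]. The
    value at the centre is that of [f], whence the recurring condition that [f] and [g] agree at
    0. *)
Definition glue f g x0 x : R :=
  match x - x0 with Posz n => f n | Negz n => g n.+1 end.

Lemma gluer f g x0 n : glue f g x0 (x0 + n%:Z) = f n.
Proof. by rewrite /glue addrAC subrr add0r. Qed.

Lemma gluel f g x0 n : f 0%N = g 0%N -> glue f g x0 (x0 - n%:Z) = g n.
Proof. by move=> fg; rewrite /glue addrAC subrr add0r; case: n. Qed.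

Lemma int_center (Q : int -> Prop) x0 :
  (forall n, Q (x0 + n%:Z)) -> (forall n, Q (x0 - n.+1%:Z)) -> forall x, Q x.
Proof.
move=> Q1 Q2 x; rewrite -(subrK x0 x) addrC; case: (x - x0) => n; first exact: Q1.
by rewrite NegzE; exact: Q2.
Qed.

Lemma glue_forall (Q : int -> R -> Prop) f g x0 : f 0%N = g 0%N ->
  (forall k, Q (x0 + k%:Z) (f k)) -> (forall k, Q (x0 - k%:Z) (g k)) ->
  forall x, Q x (glue f g x0 x).
Proof.
move=> fg Q1 Q2; apply: (@int_center (fun x => Q x (glue f g x0 x)) x0) => n.
  by rewrite gluer.
by rewrite gluel.
Qed.

(** On each side the inequality is stated with the outer neighbour first; the symmetry of [Q] in the
    two neighbours accounts for the reversed orientation on the left. *)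
Lemma glue_ind (Q : int -> R -> R -> R -> Prop) f g x0 :
  (forall x w p q, Q x w p q -> Q x w q p) -> f 0%N = g 0%N ->
  Q x0 (f 0%N) (f 1%N) (g 1%N) ->
  (forall k, Q (x0 + k.+1%:Z) (f k.+1) (f k.+2) (f k)) ->
  (forall k, Q (x0 - k.+1%:Z) (g k.+1) (g k.+2) (g k)) ->
  forall x, Q x (glue f g x0 x) (glue f g x0 (x + 1)) (glue f g x0 (x - 1)).
Proof.
move=> sym fg Q0 Q1 Q2; apply: (@int_center _ x0) => -[|n].
- rewrite addr0 (gluer f g x0 1) (gluel x0 1 fg).
  by have -> : glue f g x0 x0 = f 0%N by rewrite /glue subrr.
- have -> : x0 + n.+1%:Z + 1 = x0 + n.+2%:Z by lia.
  have -> : x0 + n.+1%:Z - 1 = x0 + n%:Z by lia.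
  by rewrite !gluer.
- have -> : x0 - 1%:Z + 1 = x0 - 0%:Z by lia.
  have -> : x0 - 1%:Z - 1 = x0 - 2%:Z by lia.
  by rewrite !gluel//; exact/sym/Q2.
- have -> : x0 - n.+2%:Z + 1 = x0 - n.+1%:Z by lia.
  have -> : x0 - n.+2%:Z - 1 = x0 - n.+3%:Z by lia.
  by rewrite !gluel//; exact/sym/Q2.
Qed.

Lemma dist_addr x0 n : `|(x0 + n%:Z)%:~R - x0%:~R| = n%:R :> R.
Proof. by rewrite intrD addrAC subrr add0r normr_nat. Qed.

Lemma dist_subr x0 n : `|(x0 - n%:Z)%:~R - x0%:~R| = n%:R :> R.
Proof. by rewrite intrB addrAC subrr add0r normrN normr_nat. Qed.

Lemma near_everywhereT : @near_everywhere R setT.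
Proof.
move=> eps eps0; exists 0 => // x; exists x => //.
by rewrite subrr normr0 addr0 mulr_ge0// ltW.
Qed.

(** The supersolution is centred at a point [x0] of [B] close to [x] and may grow at rate [M] away
    from it. As [x0] lies at distance [o(|x|)] from [x], the displacement costs only a sublinear
    error, provided that [A] and [M] are fixed before [x0]. *)
Lemma UB_local delta V theta H : 0 <= delta <= 1 ->
  (forall eps, 0 < eps -> exists (B : int -> Prop) A M,
    [/\ @near_everywhere R B, 0 <= A, 0 <= M & forall x0, B x0 ->
      exists phi : int -> R,
      [/\ forall y, bell delta V phi y <= expR (H + eps) * phi y,
          forall y, expR (theta * (y%:~R - x0%:~R)) <=
            expR (A + eps * (`|x0%:~R| + `|y%:~R|)) * phi y &
          forall y, phi y <= expR (A + M * `|y%:~R - x0%:~R|)]]) ->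
  UB delta V theta H.
Proof.
move=> d loc; apply: UB_super => // eps eps0.
have eps3 : 0 < eps / 3 by rewrite divr_gt0.
have [B [A [M [near A0 M0 hB]]]] := loc _ eps3.
have th0 := normr_ge0 theta.
pose D := M + `|theta|; have D0 : 0 <= D by rewrite addr_ge0.
have De : 0 < D + eps by rewrite ltr_wpDl.
(* Moving between [x] and [x0] changes logarithms by at most [D] per site; this choice gives both
   [e2 <= 1] and [D * e2 <= eps]. *)
pose e2 := eps / (D + eps).
have e20 : 0 < e2 by rewrite divr_gt0.
have e21 : e2 <= 1 by rewrite ler_pdivrMr// mul1r lerDr.
have De2 : D * e2 <= eps.
  by rewrite /e2 mulrCA ler_piMr ?(ltW eps0)// ler_pdivrMr// mul1r lerDl ltW.
have [C1 C10 hC] := near _ e20.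
exists (A + eps * C1 + D * C1) => n x.
have [x0 Bx0 xx0] := hC x; have [phi [h1 h2 h3]] := hB _ Bx0.
have nx := normr_ge0 (x%:~R : R); have nn : 0 <= n%:R :> R by [].
have nx0 : `|x0%:~R| <= 2 * `|x%:~R| + C1 :> R.
  rewrite -(subrK (x%:~R) (x0%:~R)); apply: le_trans (ler_normD _ _) _; nra.
have eC1 : 0 <= eps * C1 by rewrite mulr_ge0// ltW.
have DC1 : 0 <= D * C1 by rewrite mulr_ge0.
exists (fun y => expR (theta * x0%:~R) * phi y); split => [y|y yx|].
- rewrite bellZ ?expR_ge0// [leRHS]mulrCA ler_wpM2l ?expR_ge0//.
  apply: le_trans (h1 y) _; rewrite ler_wpM2r//; last by rewrite ler_expR; lra.
  by have := le_trans (expR_ge0 _) (h2 y); rewrite pmulr_rge0 ?expR_gt0.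
- rewrite mulrCA -[X in theta * X](subrK (x0%:~R)) mulrDr expRD mulrC.
  rewrite ler_wpM2l ?expR_ge0//; apply: le_trans (h2 y) _.
  rewrite ler_wpM2r//.
    by have := le_trans (expR_ge0 _) (h2 y); rewrite pmulr_rge0 ?expR_gt0.
  rewrite ler_expR /err.
  have := ler_wpM2l (ltW eps3) (lerD nx0 (normr_near yx)).
  have : 0 <= eps * n%:R by rewrite mulr_ge0// ltW.
  by lra.
- apply: le_trans (ler_wpM2l (expR_ge0 _) (h3 x)) _.
  rewrite -expRD ler_expR /err (distrC x%:~R).
  have : theta * x0%:~R - theta * x%:~R <= `|theta| * `|x0%:~R - x%:~R|.
    by rewrite -mulrBr -normrM ler_norm.
  have := ler_wpM2l D0 xx0; rewrite mulrDr mulrA.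
  have := ler_wpM2r nx De2; rewrite /D.
  have : 0 <= eps * n%:R by rewrite mulr_ge0// ltW.
  by rewrite /D in DC1 *; lra.
Qed.

Lemma LB_local delta V theta H : 0 <= delta <= 1 ->
  (forall eps, 0 < eps -> exists (B : int -> Prop) A M,
    [/\ @near_everywhere R B, 0 <= A, 0 <= M & forall x0, B x0 ->
      exists phi : int -> R,
      [/\ forall y, expR (H - eps) * phi y <= bell delta V phi y,
          forall y, phi y <= expR (theta * (y%:~R - x0%:~R) +
            (A + eps * (`|x0%:~R| + `|y%:~R|))) &
          forall y, expR (- (A + M * `|y%:~R - x0%:~R|)) <= phi y]]) ->
  LB delta V theta H.
Proof.
move=> d loc; apply: LB_sub => // eps eps0.
have eps3 : 0 < eps / 3 by rewrite divr_gt0.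
have [B [A [M [near A0 M0 hB]]]] := loc _ eps3.
have th0 := normr_ge0 theta.
pose D := M + `|theta|; have D0 : 0 <= D by rewrite addr_ge0.
have De : 0 < D + eps by rewrite ltr_wpDl.
pose e2 := eps / (D + eps).
have e20 : 0 < e2 by rewrite divr_gt0.
have e21 : e2 <= 1 by rewrite ler_pdivrMr// mul1r lerDr.
have De2 : D * e2 <= eps.
  by rewrite /e2 mulrCA ler_piMr ?(ltW eps0)// ler_pdivrMr// mul1r lerDl ltW.
have [C1 C10 hC] := near _ e20.
exists (A + eps * C1 + D * C1) => n x.
have [x0 Bx0 xx0] := hC x; have [phi [h1 h2 h3]] := hB _ Bx0.
have nx := normr_ge0 (x%:~R : R); have nn : 0 <= n%:R :> R by [].
have nx0 : `|x0%:~R| <= 2 * `|x%:~R| + C1 :> R.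
  rewrite -(subrK (x%:~R) (x0%:~R)); apply: le_trans (ler_normD _ _) _; nra.
have eC1 : 0 <= eps * C1 by rewrite mulr_ge0// ltW.
have DC1 : 0 <= D * C1 by rewrite mulr_ge0.
exists (fun y => expR (theta * x0%:~R) * phi y); split => [y|y yx|].
- rewrite bellZ ?expR_ge0// mulrCA ler_wpM2l ?expR_ge0//.
  apply: le_trans (h1 y); rewrite ler_wpM2r//; last by rewrite ler_expR; lra.
  exact: le_trans (expR_ge0 _) (h3 y).
- rewrite mulrCA -[X in _ <= expR (theta * X)](subrK (x0%:~R)) mulrDr expRD [leRHS]mulrC.
  rewrite ler_wpM2l ?expR_ge0//; apply: le_trans (ler_wpM2l (expR_ge0 _) (h2 y)) _.
  rewrite -expRD ler_expR /err.
  have := ler_wpM2l (ltW eps3) (lerD nx0 (normr_near yx)).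
  have : 0 <= eps * n%:R by rewrite mulr_ge0// ltW.
  by lra.
- apply: le_trans (ler_wpM2l (expR_ge0 _) (h3 x)).
  rewrite -expRD ler_expR /err (distrC x%:~R).
  have : theta * x%:~R - theta * x0%:~R <= `|theta| * `|x0%:~R - x%:~R|.
    by rewrite -mulrBr distrC -normrM ler_norm.
  have := ler_wpM2l D0 xx0; rewrite mulrDr mulrA.
  have := ler_wpM2r nx De2; rewrite /D.
  have : 0 <= eps * n%:R by rewrite mulr_ge0// ltW.
  by rewrite /D in DC1 *; lra.
Qed.

Lemma cosh_add_sub a c : cosh (a + c) + cosh (a - c) = 2 * cosh c * cosh a.
Proof.
by rewrite /cosh !opprD opprK !expRD; field.
Qed.

Lemma cosh_nat_le c n n' : 0 <= c -> (n <= n')%N ->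
  cosh (c * n%:R) <= cosh (c * n'%:R).
Proof.
move=> c0; elim: n' => [|k IH]; first by rewrite leqn0 => /eqP ->.
rewrite leq_eqVlt ltnS => /orP[/eqP ->//|/IH /le_trans]; apply.
have e1 : 1 <= expR c by rewrite -expR0 ler_expR.
have e2 : 1 <= expR (c * k%:R) by rewrite -expR0 ler_expR mulr_ge0.
rewrite /cosh ler_pM2r// -natr1 mulrDr mulr1 !expRN expRD invfM.
set u := expR (c * _) in e2 *; set w := expR c in e1 *.
have u0 : 0 < u by lra. have w0 : 0 < w by lra.
rewrite -subr_ge0.
have -> : u * w + u^-1 * w^-1 - (u + u^-1) = (w - 1) * (u * u - w^-1) / u.
  by field; rewrite !gt_eqF.
rewrite divr_ge0 ?(ltW u0)// mulr_ge0 ?subr_ge0//.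
apply: le_trans (_ : 1 <= _); first by rewrite invf_le1.
nra.
Qed.

Lemma norm_posz (k l : nat) : (k <= l)%N -> `|k%:Z| <= l%:Z.
Proof. by lia. Qed.

Lemma norm_negz (k l : nat) : (k <= l)%N -> `|- k%:Z| <= l%:Z.
Proof. by lia. Qed.

(** One side of a valley of radius [l]: for vanishing potential and full push inwards it is
    invariant strictly inside the stretch, apart from the centre. The truncated subtraction turns it
    into the pure exponential [exp (c k) / cosh (c l)] beyond the stretch. *)
Definition trap c (l k : nat) : R :=
  expR (c * k%:R) * (cosh (c * (l - k)%N%:R) / cosh (c * l%:R)).

(** The control pushes inwards. Inside the stretch the addition formula for [cosh] leaves only the
    factor [exp v]; outside, pushing against a pure exponential gains a further factor [1 / cosh c],
    so the weaker bound on [v] is enough there. *)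
Lemma trap_step delta c l (v E : R) k : 0 <= delta -> control delta c ->
  expR v <= E * cosh c -> ((k.+1 <= l)%N -> expR v <= E) ->
  expR v * mix delta (trap c l k.+2) (trap c l k) <= E * trap c l k.+1.
Proof.
move=> d0 dc vb vl; pose C j := cosh (c * j%:R : R).
have Cgt0 j : 0 < C j by exact: cosh_gt0.
have Kgt0 := cosh_gt0 c; have K1 := cosh_ge1 c.
have K2 : 0 < 2 * cosh c by rewrite mulr_gt0.
apply: le_trans (ler_wpM2l (expR_ge0 _) (mix_ler _ _ d0)) _.
have [h1 h2] := half_control k.+1%:R dc.
rewrite /trap (mulrA ((1 - delta) / 2)) (mulrA ((1 + delta) / 2)) -[k.+2%:R]natr1 h1.
have -> : k%:R = k.+1%:R - 1 :> R by rewrite -natr1 addrK.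
rewrite h2.
have -> : expR v * (expR (c * k.+1%:R) / (2 * cosh c) * (C (l - k.+2)%N / C l) +
    expR (c * k.+1%:R) / (2 * cosh c) * (C (l - k)%N / C l)) =
  (expR (c * k.+1%:R) / C l) * (expR v * (C (l - k.+2)%N + C (l - k)%N) / (2 * cosh c)).
  by field; rewrite !gt_eqF.
have -> : E * (expR (c * k.+1%:R) * (C (l - k.+1)%N / C l)) =
  (expR (c * k.+1%:R) / C l) * (E * C (l - k.+1)%N) by ring.
rewrite ler_pM2l; last by rewrite divr_gt0 ?expR_gt0.
rewrite ler_pdivrMr//.
have [kl|lk] := leqP k.+1 l; last first.
  have -> : (l - k.+2 = 0)%N by lia.
  have -> : (l - k.+1 = 0)%N by lia.
  have -> : (l - k = 0)%N by lia.
  by have := Cgt0 0%N; nra.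
have CC : C (l - k.+2)%N + C (l - k)%N <= 2 * cosh c * C (l - k.+1)%N.
  have -> : (l - k = (l - k.+1).+1)%N by lia.
  have [j0|j0] := posnP (l - k.+1)%N.
    have -> : (l - k.+2 = 0)%N by lia.
    by rewrite j0 /C mulr0 mulr1 cosh0; lra.
  have -> : (l - k.+2 = (l - k.+1).-1)%N by lia.
  case: (l - k.+1)%N j0 => // j _ /=; rewrite /C -[j.+2%:R]natr1 mulrDr mulr1.
  have -> : c * j%:R = c * j.+1%:R - c by rewrite -natr1; ring.
  by rewrite addrC cosh_add_sub.
apply: le_trans (ler_wpM2l (expR_ge0 _) CC) _.
have -> : expR v * (2 * cosh c * C (l - k.+1)%N) = expR v * (C (l - k.+1)%N * (2 * cosh c)).
  by ring.
by rewrite -[leRHS]mulrA; apply: ler_wpM2r (vl kl); exact: mulr_ge0 (ltW _) (ltW _).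
Qed.

(** At the centre of the valley both neighbours have this value; the resulting loss vanishes as the
    stretch gets longer. *)
Lemma trap1_le c (L : nat) e : 0 < c -> 0 < e -> 1 / (c * e) < L%:R ->
  trap c L.+1 1 <= 1 + e / 2.
Proof.
move=> c0 e0 hL; have ce : 0 < c * e by rewrite mulr_gt0.
rewrite /trap mulr1 subn1 /= mulrA ler_pdivrMr ?cosh_gt0//.
rewrite -[L.+1%:R]natr1 mulrDr mulr1 /cosh !expRN [expR (_ + c)]expRD.
have : 1 <= (e / 2) * expR (c * L%:R) ^+ 2.
  rewrite -expRM_natl; apply: le_trans (_ : (e / 2) * (1 + 2 * (c * L%:R)) <= _).
    by move: hL; rewrite ltr_pdivrMr//; nra.
  by rewrite ler_pM2l ?divr_gt0// expR_ge1Dx.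
have := expR_gt0 (c * L%:R); have := expR_gt0 c.
set u := expR (c * _); set w := expR c => w0 u0 hu.
rewrite -subr_ge0.
have -> : (1 + e / 2) * ((u * w + (u * w)^-1) / 2) - w * ((u + u^-1) / 2) =
  (w * (e / 2 * u ^+ 2 - 1) / u + (1 + e / 2) * (u * w)^-1) / 2.
  by field; rewrite !gt_eqF.
rewrite divr_ge0// addr_ge0//.
  by rewrite divr_ge0 ?(ltW u0)// mulr_ge0 ?(ltW w0)// subr_ge0.
by rewrite mulr_ge0 ?invr_ge0 ?mulr_ge0 ?(ltW u0) ?(ltW w0)//; lra.
Qed.

(** The valley rises at rate [c] on both sides, so it dominates [exp (theta (y - x0))] when
    [|theta| <= c]. *)
Lemma UB_trap delta beta c V theta : 0 <= delta <= 1 -> 0 < c -> control delta c ->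
  (forall x, V x <= beta) -> low V -> `|theta| <= c ->
  UB delta V theta (Num.max beta (ln (cosh c)) - ln (cosh c)).
Proof.
move=> d c0 dc Vb lo tc; have /andP[d0 _] := d; have c0' := ltW c0.
apply: UB_local => // eps eps0.
have eps2 : 0 < eps / 2 by rewrite divr_gt0.
have [L hL] : exists L : nat, 1 / (c * eps) < L%:R.
  by exists (Num.truncn (1 / (c * eps))).+1; rewrite truncnS_gt.
have w1 : trap c L.+1 1 <= expR (eps / 2).
  exact: le_trans (trap1_le c0 eps0 hL) (expR_ge1Dx _).
move: L.+1 w1 => l w1 {hL L}.
have Cgt0 : 0 < cosh (c * l%:R) by exact: cosh_gt0.
have Kgt0 := cosh_gt0 c.
have w0 : trap c l 0 = 1.
  by rewrite /trap mulr0 expR0 mul1r subn0 divff// gt_eqF.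
set H := Num.max beta (ln (cosh c)) - ln (cosh c).
have He : expR (H + eps) * cosh c = expR (Num.max beta (ln (cosh c)) + eps).
  by rewrite /H addrAC expR_sub_lncosh divfK ?gt_eqF.
have Hb : expR beta <= expR (H + eps) * cosh c.
  rewrite He ler_expR; apply: le_trans (_ : Num.max beta (ln (cosh c)) <= _).
    by rewrite le_max lexx.
  by rewrite lerDl ltW.
have H1 : expR eps <= expR (H + eps).
  by rewrite ler_expR lerDr subr_ge0 le_max lexx orbT.
have step (v : R) k : v <= beta -> ((k.+1 <= l)%N -> v <= eps / 2) ->
    expR v * mix delta (trap c l k.+2) (trap c l k) <= expR (H + eps) * trap c l k.+1.
  move=> vb vl; apply: trap_step => //.
    by apply: le_trans Hb; rewrite ler_expR.
  by move=> /vl v2; apply: le_trans H1; rewrite ler_expR; lra.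
have wle k : trap c l k <= expR (c * k%:R).
  by rewrite ler_piMr ?expR_ge0// ler_pdivrMr// mul1r cosh_nat_le// leq_subr.
have wge k : expR (c * k%:R) <= cosh (c * l%:R) * trap c l k.
  have -> : cosh (c * l%:R) * trap c l k = expR (c * k%:R) * cosh (c * (l - k)%N%:R).
    by rewrite /trap; field; rewrite gt_eqF.
  by rewrite ler_peMr ?expR_ge0// cosh_ge1.
have wpos k : 0 <= trap c l k.
  by have := le_trans (expR_ge0 _) (wge k); rewrite pmulr_rge0.
exists (fun x0 => forall z : int, `|z| <= l%:Z -> V (x0 + z) <= eps / 2).
exists (cosh (c * l%:R)), c.
split => //; [exact: lo|exact: ltW|move=> x0 Bx0].
exists (glue (trap c l) (trap c l) x0); split.
- apply: (@glue_ind (fun x a p q => expR (V x) * mix delta p q <= expR (H + eps) * a)) => //.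
  + by move=> x a p q; rewrite mixC.
  + rewrite mixpp w0 mulr1; apply: le_trans (_ : expR (eps / 2) * expR (eps / 2) <= _).
      apply: ler_pM => //; rewrite ?expR_ge0// ler_expR -[x0]addr0; exact: Bx0.
    by rewrite -expRD; apply: le_trans H1; rewrite ler_expR; lra.
  + by move=> k; apply: step => // kl; exact/Bx0/norm_posz.
  + by move=> k; apply: step => // kl; exact/Bx0/norm_negz.
- move=> y; apply: le_trans (_ : expR (c * `|y%:~R - x0%:~R|) <= _).
    rewrite ler_expR; apply: le_trans (ler_norm _) _.
    by rewrite normrM ler_wpM2r.
  apply: (le_trans (_ : _ <= cosh (c * l%:R) * glue (trap c l) (trap c l) x0 y)).
    apply: (@glue_forall (fun y a => expR (c * `|y%:~R - x0%:~R|) <= cosh (c * l%:R) * a)) => // k.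
      by rewrite dist_addr.
    by rewrite dist_subr.
  rewrite ler_wpM2r//; first by apply: (@glue_forall (fun y a => 0 <= a)).
  apply: le_trans (expR_ge1Dx _); rewrite addrCA lerDl.
  by rewrite addr_ge0// mulr_ge0 ?(ltW eps0)// addr_ge0.
- move=> y; apply: (le_trans (_ : _ <= expR (c * `|y%:~R - x0%:~R|))); last first.
    by rewrite ler_expR lerDr ltW.
  apply: (@glue_forall (fun y a => a <= expR (c * `|y%:~R - x0%:~R|))) => // k.
    by rewrite dist_addr.
  by rewrite dist_subr.
Qed.

End localized.

(** * Bumps and peaks as subsolutions *)

Section lower_bounds.
Context {R : realType}.
Implicit Types (delta beta c H theta lam m : R) (V phi : int -> R) (x y : int).
Implicit Types (f g : nat -> R) (k n : nat).

(** For [mu < 1] this three-term recursion oscillates like a cosine. It is used with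
    [s = 1 + delta]: the second value [mu * s] then makes the equation at the centre of the bump
    exact, because [(1 + delta) * exp (- c) = 1 / cosh c]. *)
Definition hump (mu s : R) k : R :=
  (iter k (fun p => (p.2, 2 * mu * p.2 - p.1)) (1, mu * s)).1.

Lemma humpSS mu s k : hump mu s k.+2 = 2 * mu * hump mu s k.+1 - hump mu s k.
Proof. by rewrite /hump !iterS. Qed.

(** Ratios [r] of consecutive terms evolve by [r' = 2 mu - 1 / r], and [r + 1 / r >= 2] gives
    [r' <= r - (2 - 2 mu)]. They drop by a fixed amount at each step and cannot stay positive. *)
Lemma hump_zero mu s : mu < 1 -> exists N,
  hump mu s N.+1 <= 0 /\ forall k, (k <= N)%N -> 0 < hump mu s k.
Proof.
move=> mu1.
have ex : exists N, hump mu s N.+1 <= 0.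
  apply: contrapT => /forallNP pos.
  have hpos k : 0 < hump mu s k.
    by case: k => [|k]; [exact: ltr01|rewrite ltNge; exact/negP].
  have decr k : hump mu s k.+1 <= (mu * s - k%:R * (2 - 2 * mu)) * hump mu s k.
    elim: k => [|k IH]; first by rewrite mul0r subr0 /hump /= mulr1.
    rewrite humpSS -[k.+1%:R]natr1.
    have h0 := hpos k; have h1 := hpos k.+1.
    set a := hump mu s k.+1 in IH h1 *; set b := hump mu s k in IH h0 *.
    set r := mu * s - k%:R * (2 - 2 * mu) in IH.
    have -> : mu * s - (k%:R + 1) * (2 - 2 * mu) = r - (2 - 2 * mu) by rewrite /r; ring.
    have q : a / b <= r by rewrite ler_pdivrMr.
    have : 2 * a - b <= a * (a / b).
      rewrite -subr_ge0.
      have -> : a * (a / b) - (2 * a - b) = (a - b) ^+ 2 / b by field; rewrite gt_eqF.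
      by rewrite divr_ge0 ?sqr_ge0// ltW.
    have : a * (a / b) <= a * r by rewrite ler_wpM2l// ltW.
    lra.
  have mm : 0 < 2 - 2 * mu by lra.
  pose k := (Num.truncn (mu * s / (2 - 2 * mu))).+1.
  have : mu * s / (2 - 2 * mu) < k%:R by rewrite truncnS_gt.
  rewrite ltr_pdivrMr// => kk.
  have := decr k; have := hpos k; have := hpos k.+1; nra.
have [N hN minN] := ex_minnP ex; exists N; split => // -[_|k kN]; first exact: ltr01.
by rewrite ltNge; apply/negP => /minN; lia.
Qed.

(** The bound [r <= s] persists because [2 mu - 1 / s <= 2 - 1 / s <= s]. *)
Lemma hump_ratio mu s N : mu <= 1 -> 0 < s ->
  (forall k, (k <= N)%N -> 0 < hump mu s k) ->
  forall k, (k <= N)%N -> hump mu s k.+1 <= s * hump mu s k.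
Proof.
move=> mu1 s0 pos; elim => [_|k IH kN]; first by rewrite /hump /= mulr1 ler_piMl// ltW.
rewrite humpSS; have h1 := pos _ kN; have h0 := pos k (ltnW kN).
have := IH (ltnW kN); set a := hump mu s k.+1 in h1 *; set b := hump mu s k in h0 *.
move=> ab; have : a / s <= b by rewrite ler_pdivrMr// mulrC.
have : 2 * a - a / s <= s * a.
  rewrite -subr_ge0.
  have -> : s * a - (2 * a - a / s) = a * (s - 1) ^+ 2 / s by field; rewrite gt_eqF.
  by rewrite divr_ge0 ?(ltW s0)// mulr_ge0 ?sqr_ge0// ltW.
nra.
Qed.

Lemma mix_ge delta p q : 0 <= delta <= 1 -> 0 <= p -> 0 <= q ->
  (1 - delta) / 2 * q <= mix delta p q.
Proof.
move=> /andP[d0 d1] p0 q0; have [pq|/ltW qp] := lerP p q.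
  by rewrite mixE//; nra.
by rewrite mixC mixE//; nra.
Qed.

(** On a profile that decreases away from its centre the optimal control pushes outwards; the factor
    [exp (- c k)] conjugates this push to a fair step. *)
Lemma mix_half delta c p q k : control delta c ->
  expR (- c * k.+2%:R) * p <= expR (- c * k%:R) * q ->
  mix delta (expR (- c * k.+2%:R) * p) (expR (- c * k%:R) * q) =
  expR (- c * k.+1%:R) * (p + q) / (2 * cosh c).
Proof.
move=> dc le; rewrite mixE// (mulrA ((1 + delta) / 2)) (mulrA ((1 - delta) / 2)).
have [h1 h2] := half_control (- k.+1%:R) dc.
have -> : - c * k.+2%:R = c * (- k.+1%:R - 1) by rewrite -[k.+2%:R]natr1; ring.
have -> : - c * k%:R = c * (- k.+1%:R + 1) by rewrite -[k.+1%:R]natr1; ring.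
rewrite h1 h2; have -> : c * - k.+1%:R = - c * k.+1%:R by ring.
by field; rewrite gt_eqF ?cosh_gt0.
Qed.

(** The tilted hump is cut off before its first nonpositive value, which preserves the subsolution
    property. Taking the maximum with a steep exponential makes the function strictly positive, as
    the localized comparison demands. *)
Lemma LB_stay delta c beta V theta : 0 <= delta -> 0 <= c -> control delta c ->
  (forall x, 0 <= V x) -> high V beta -> LB delta V theta (beta - ln (cosh c)).
Proof.
move=> d0 c0 dc V0 hi; have d1 := control_le1 dc.
have d : 0 <= delta <= 1 by rewrite d0 ltW.
apply: LB_local => // eps eps0.
have K0 := cosh_gt0 c; have K1 := cosh_ge1 c.
set H := beta - ln (cosh c).
have e2 : 0 < eps / 2 by rewrite divr_gt0.
set mu := expR (- (eps / 2)).
have mu0 : 0 < mu by exact: expR_gt0.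
have mu1 : mu < 1 by rewrite expR_lt1 oppr_lt0.
have s0 : 0 < 1 + delta by lra.
(* Consequently ratios up to [1 + delta] still leave [exp (- c k) * hump] nonincreasing. *)
have sc : 1 + delta <= expR c by have [<- _] := dc; rewrite ler_peMr// ltW.
have [N [hN pos]] := hump_zero (1 + delta) mu1.
have ratio := hump_ratio (ltW mu1) s0 pos.
(* [exp (- (c + ln (2 cosh c)))] equals [(1 - delta) / 2], the least probability of an inward step;
   with this [M] the exponential tail satisfies its inequality through the inner neighbour alone,
   whatever [V >= 0] is. The summand [|theta|] makes the tail decay at least as fast as the
   exponential to be compared with. *)
pose M : R := `|theta| + (`|H - eps| + (c + ln (2 * cosh c))).
have lnK0 : 0 <= ln (2 * cosh c) by rewrite ln_ge0//; lra.
have M0 : 0 <= M by rewrite !addr_ge0.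
have Mth : `|theta| <= M by rewrite lerDl !addr_ge0.
have MH : expR (H - eps) * expR (- M) <= (1 - delta) / 2.
  have [_ dc2] := dc.
  have -> : (1 - delta) / 2 = expR (- (c + ln (2 * cosh c))).
    have K2 : 0 < 2 * cosh c by rewrite mulr_gt0.
    have -> : expR (- (c + ln (2 * cosh c))) = expR (- c) / (2 * cosh c).
      by rewrite opprD expRB lnK.
    by rewrite -dc2; move: (cosh c) K0 => K K0; field; rewrite gt_eqF.
  rewrite -expRD ler_expR /M; have := ler_norm (H - eps); have := normr_ge0 theta; lra.
pose h k := expR (- c * k%:R) * hump mu (1 + delta) k.
pose w k := Num.max (if (k <= N)%N then h k else 0) (expR (- M * k%:R)).
have N0 : (0 < N)%N.
  rewrite lt0n; apply/eqP => N0; move: hN; rewrite N0 /hump /= leNgt.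
  by rewrite mulr_gt0.
have w0 : w 0%N = 1 by rewrite /w /h /= !mulr0 !expR0 mul1r /hump /= maxxx.
have wtail k : expR (- M * k%:R) <= w k by rewrite le_max lexx orbT.
have wpos k : 0 <= w k by exact: le_trans (expR_ge0 _) (wtail k).
(* At [k = N + 1] the hump is nonpositive, so the truncated profile dominates it one site further
   than it follows it. *)
have wh k : (k <= N.+1)%N -> h k <= w k.
  rewrite leq_eqVlt => /orP[/eqP ->|kN]; last by rewrite /w le_max -ltnS kN lexx.
  by apply: le_trans (wpos _); rewrite /h pmulr_rle0 ?expR_gt0.
have w1 : expR (H - eps) <= expR (beta - eps / 2) * w 1%N.
  apply: le_trans (ler_wpM2l (expR_ge0 _) (wh 1%N _)); last by [].
  rewrite /h /hump /= mulr1 /H addrAC expR_sub_lncosh.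
  have -> : 1 + delta = expR c / cosh c by have [<- _] := dc; rewrite mulfK// gt_eqF.
  rewrite expRN; have -> : expR (beta - eps / 2) * ((expR c)^-1 * (mu * (expR c / cosh c))) =
    expR (beta - eps / 2) * mu / cosh c by field; rewrite !gt_eqF ?expR_gt0.
  by rewrite /mu -expRD ler_pM2r ?invr_gt0// ler_expR; lra.
have step (v : R) k : 0 <= v -> ((k.+1 <= N)%N -> beta - eps / 2 <= v) ->
    expR (H - eps) * w k.+1 <= expR v * mix delta (w k.+2) (w k).
  move=> v0 vN; have ev : 1 <= expR v by rewrite -expR0 ler_expR.
  have mixw : 0 <= mix delta (w k.+2) (w k).
    apply: le_trans (mix_ge d (wpos _) (wpos _)); rewrite mulr_ge0//; lra.
  rewrite {1}/w maxr_pMr ?expR_ge0// ge_max; apply/andP; split; last first.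
    apply: le_trans (_ : mix delta (w k.+2) (w k) <= _); last by rewrite ler_peMl.
    apply: le_trans (mix_ge d (wpos _) (wpos _)).
    apply: le_trans (ler_wpM2l _ (wtail k)); last by lra.
    have -> : expR (- M * k.+1%:R) = expR (- M) * expR (- M * k%:R).
      by rewrite -expRD -[k.+1%:R]natr1; congr expR; ring.
    by rewrite mulrA ler_wpM2r ?expR_ge0.
  case: ifPn => kN; last by rewrite mulr0 mulr_ge0 ?expR_ge0.
  have hk0 := pos k (ltnW kN); have hk1 := pos _ kN.
  have r0 := ratio k (ltnW kN); have r1 := ratio _ kN.
  have le : h k.+2 <= h k.
    rewrite /h; have -> : - c * k.+2%:R = - c * k%:R + (- c - c).
      by rewrite -[k.+2%:R]natr1 -[k.+1%:R]natr1; ring.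
    rewrite expRD -mulrA ler_wpM2l ?expR_ge0// expRD expRN.
    rewrite -mulrA ler_pdivrMl ?expR_gt0// ler_pdivrMl ?expR_gt0//.
    apply: le_trans r1 _; apply: le_trans (ler_wpM2l (ltW s0) r0) _.
    apply: ler_pM => //; [exact: ltW|by rewrite mulr_ge0 ?ltW|].
    by rewrite ler_wpM2r// ltW.
  apply: le_trans (_ : expR v * mix delta (h k.+2) (h k) <= _); last first.
    by rewrite ler_wpM2l ?expR_ge0//; exact: le_mix d (wh k.+2 kN) (wh k (leqW (ltnW kN))).
  rewrite /h mix_half// humpSS subrK.
  have -> : expR v * (expR (- c * k.+1%:R) * (2 * mu * hump mu (1 + delta) k.+1) / (2 * cosh c))
    = (expR v * mu / cosh c) * (expR (- c * k.+1%:R) * hump mu (1 + delta) k.+1).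
    by field; rewrite gt_eqF.
  rewrite ler_wpM2r ?mulr_ge0 ?expR_ge0 ?(ltW hk1)//.
  rewrite /H addrAC expR_sub_lncosh ler_pM2r ?invr_gt0// /mu -expRD ler_expR.
  have := vN kN; lra.
have hle k : (k <= N)%N -> hump mu (1 + delta) k <= expR (c * k%:R).
  elim: k => [_|k IH kN]; first by rewrite mulr0 expR0.
  apply: le_trans (ratio k (ltnW kN)) _; rewrite -natr1 mulrDr mulr1 expRD mulrC.
  by apply: ler_pM; rewrite ?(ltW s0)// ?IH ?(ltnW kN)// ltW// pos// ltnW.
have wle k : w k <= expR (`|theta| * N%:R - `|theta| * k%:R).
  rewrite /w ge_max; apply/andP; split; last first.
    rewrite ler_expR mulNr; apply: le_trans (_ : - (`|theta| * k%:R) <= _).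
      by rewrite lerN2 ler_wpM2r.
    by rewrite lerDr mulr_ge0.
  case: ifPn => kN; last exact: expR_ge0.
  apply: le_trans (_ : 1 <= _).
    rewrite /h; apply: le_trans (ler_wpM2l (expR_ge0 _) (hle k kN)) _.
    by rewrite -expRD mulNr addNr expR0.
  apply: le_trans (expR_ge1Dx _); rewrite lerDl -mulrBr mulr_ge0// subr_ge0.
  by rewrite ler_nat.
exists (fun x0 => forall z : int, `|z| <= N%:Z -> beta - eps / 2 <= V (x0 + z)).
exists (`|theta| * N%:R), M.
split; [by apply: hi; lra|by rewrite mulr_ge0|exact: M0|move=> x0 Bx0].
exists (glue w w x0); split.
- apply: (@glue_ind _ (fun x a p q => expR (H - eps) * a <= expR (V x) * mix delta p q)) => //.
  + by move=> x a p q; rewrite mixC.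
  + rewrite mixpp w0 mulr1; apply: le_trans w1 _; rewrite ler_wpM2r// ler_expR -[x0]addr0.
    exact: Bx0.
  + by move=> k; apply: step => // kl; exact/Bx0/norm_posz.
  + by move=> k; apply: step => // kl; exact/Bx0/norm_negz.
- move=> y; apply: le_trans (_ : _ <= expR (`|theta| * N%:R - `|theta| * `|y%:~R - x0%:~R|)) _.
    apply: (@glue_forall _ (fun y a => a <= expR (`|theta| * N%:R - `|theta| * `|y%:~R - x0%:~R|))) => // k.
      by rewrite dist_addr.
    by rewrite dist_subr.
  rewrite ler_expR -normrM.
  have := ler_norm (- (theta * (y%:~R - x0%:~R))); rewrite normrN.
  have : 0 <= eps * (`|x0%:~R| + `|y%:~R|) by rewrite mulr_ge0 ?(ltW eps0)// addr_ge0.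
  by lra.
- move=> y; apply: (@glue_forall _ (fun y a => expR (- (`|theta| * N%:R + M * `|y%:~R - x0%:~R|)) <= a)) => // k;
  rewrite ?dist_addr ?dist_subr; apply: le_trans (wtail k);
  by rewrite ler_expR mulNr lerN2 lerDr mulr_ge0.
Qed.

(** A combination of the growing [z] and the decaying [zm]. Induction maintains
    [y k <= y k.+1 <= expR c * y k]: the first inequality because [a >= 1], the second because
    [a <= cosh c] and [2 cosh c - exp (- c) = exp c]. *)
Lemma half_solution (a z zm : nat -> R) c kap :
  1 < kap -> (forall k, 1 <= a k <= cosh c) ->
  z 0%N = 1 -> zm 0%N = 1 ->
  (forall k, z k.+2 + z k = 2 * a k.+1 * z k.+1) ->
  (forall k, zm k.+2 + zm k = 2 * a k.+1 * zm k.+1) ->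
  (forall k, 0 < zm k) -> (forall k, 0 < z k) ->
  kap <= z 1%N <= expR c -> zm 1%N <= kap^-1 ->
  exists y : nat -> R,
  [/\ y 0%N = 1, y 1%N = expR c,
      forall k, y k.+2 + y k = 2 * a k.+1 * y k.+1,
      forall k, 1 <= y k &
      (forall k, y k.+1 <= expR c * y k) /\
      forall k, y k <= expR c / (kap - kap^-1) * z k].
Proof.
move=> k1 ha z0 zm0 hz hzm zmpos zpos /andP[z1 z1c] zm1.
have kk : kap^-1 < 1 by rewrite invf_lt1//; lra.
have dk : 0 < kap - kap^-1 by lra.
have dz : 0 < z 1%N - zm 1%N by lra.
pose al := (expR c - zm 1%N) / (z 1%N - zm 1%N).
pose ga := (z 1%N - expR c) / (z 1%N - zm 1%N).
have alga : al + ga = 1 by rewrite /al /ga; field; rewrite gt_eqF.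
(* The decaying part enters with a nonpositive coefficient, so [y] inherits its growth bound from
   [z] alone. *)
have ga0 : ga <= 0 by rewrite pmulr_lle0 ?invr_gt0// subr_le0.
pose y k := al * z k + ga * zm k.
have y0 : y 0%N = 1 by rewrite /y z0 zm0 !mulr1.
have y1 : y 1%N = expR c by rewrite /y /al /ga; field; rewrite gt_eqF.
have yrec k : y k.+2 + y k = 2 * a k.+1 * y k.+1.
  have -> : y k.+2 + y k = al * (z k.+2 + z k) + ga * (zm k.+2 + zm k) by rewrite /y; ring.
  by rewrite hz hzm /y; ring.
have ec : 1 <= expR c by lra.
have ybd k : [/\ 1 <= y k, y k <= y k.+1 & y k.+1 <= expR c * y k].
  elim: k => [|k [b1 b2 b3]]; first by rewrite y0 y1 mulr1.
  have /andP[a1 aK] := ha k.+1.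
  have yy : y k.+2 = 2 * a k.+1 * y k.+1 - y k by rewrite -yrec addrK.
  have y1p : 0 <= y k.+1 by exact: le_trans ler01 (le_trans b1 b2).
  split; first exact: le_trans b1 b2.
    have : y k.+1 <= a k.+1 * y k.+1 by rewrite ler_peMl.
    by rewrite yy; clear -b2; lra.
  have : (expR c)^-1 * y k.+1 <= y k by rewrite ler_pdivrMl ?expR_gt0.
  have : 2 * a k.+1 * y k.+1 <= 2 * cosh c * y k.+1.
    by rewrite ler_wpM2r ?ler_wpM2l.
  by rewrite yy /cosh expRN; clear; lra.
exists y; split => //; [by move=> k; have [] := ybd k|split => k].
  by have [] := ybd k.
apply: le_trans (_ : al * z k <= _).
  by rewrite /y gerDl mulr_le0_ge0// ltW.
rewrite ler_wpM2r ?(ltW (zpos k))// /al ler_pdivrMr// mulrAC ler_pdivlMr//.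
have := zmpos 1%N; have := expR_gt0 c; nra.
Qed.

(** Because [expR lam = cosh c], the coefficients [expR (lam - V)] lie between 1 and [cosh c], and
    the ratios of [gp] are at most [expR c]. *)
Lemma peak_side V lam m c gp gm kap x0 : 0 <= c ->
  (forall x, 0 <= V x <= lam) -> expR lam = cosh c ->
  corrector V lam m gp gm kap ->
  exists y : nat -> R,
  [/\ y 0%N = 1, y 1%N = expR c,
      forall n, y n.+2 + y n = 2 * expR (lam - V (x0 + n.+1%:Z)) * y n.+1,
      forall n, 1 <= y n &
      (forall n, y n.+1 <= expR c * y n) /\
      forall n, y n <= expR c / (kap - kap^-1) * (gp (x0 + n%:Z) / gp x0)].
Proof.
move=> c0 Vl lc h; have k1 := corr_k h; have k0 : 0 < kap by lra.
have [gp0 gm0] := corr_pos h x0.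
have ratio_rec (g : int -> R) n : solves V lam g ->
    g (x0 + n.+2%:Z) / g x0 + g (x0 + n%:Z) / g x0 =
    2 * expR (lam - V (x0 + n.+1%:Z)) * (g (x0 + n.+1%:Z) / g x0).
  move=> /(_ (x0 + n.+1%:Z)).
  have -> : x0 + n.+1%:Z + 1 = x0 + n.+2%:Z by lia.
  have -> : x0 + n.+1%:Z - 1 = x0 + n%:Z by lia.
  by rewrite -mulrDl mulrA => ->.
have [lop lom] := corr_lower h x0.
apply: (@half_solution (fun n => expR (lam - V (x0 + n%:Z)))
  (fun n => gp (x0 + n%:Z) / gp x0) (fun n => gm (x0 + n%:Z) / gm x0)) => //.
- move=> n; have /andP[V0 V1] := Vl (x0 + n%:Z); rewrite -lc ler_expR.
  by apply/andP; split; [apply: le_trans (expR_ge1Dx _)|]; lra.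
- by rewrite addr0 divff// gt_eqF.
- by rewrite addr0 divff// gt_eqF.
- by move=> n; exact: ratio_rec (corr_solp h).
- by move=> n; exact: ratio_rec (corr_solm h).
- by move=> n; have [_ p] := corr_pos h (x0 + n%:Z); rewrite divr_gt0.
- by move=> n; have [p _] := corr_pos h (x0 + n%:Z); rewrite divr_gt0.
- rewrite ler_pdivlMr// lop ler_pdivrMr//; apply: (corr_upper h _ _ x0).1.
    by apply: le_trans (expR_ge1Dx _); lra.
  by rewrite lc /cosh expRN; lra.
- by rewrite ler_pdivrMr// ler_pdivlMl.
Qed.

(** After multiplication by [exp (- c n)] each half solution starts with two equal values, so the
    peak loses nothing at its centre. Away from it the equation holds with equality at [H = 0], and
    the decay rate [c - m] limits the slopes reached. Any site may be the centre: the dependence on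
    [x0] fits into the allowed error [eps * |x0|]. *)
Lemma LB_peak delta c V lam m theta : 0 <= delta -> 0 <= c -> control delta c ->
  (forall x, 0 <= V x <= lam) -> expR lam = cosh c -> corr V lam m ->
  `|theta| <= c - m -> LB delta V theta 0.
Proof.
move=> d0 c0 dc Vl lc [gp [gm [kap h]]] tm; have d1 := control_le1 dc.
have d : 0 <= delta <= 1 by rewrite d0 ltW.
apply: LB_local => // eps eps0.
have K0 := cosh_gt0 c.
have [C1 C10 h1] := corr_ratep h eps0; have [C2 C20 h2] := corr_ratem h eps0.
set A := expR c / (kap - kap^-1).
have A0 : 0 < A.
  have k1 := corr_k h; rewrite divr_gt0 ?expR_gt0// subr_gt0.
  by apply: (lt_trans _ k1); rewrite invf_lt1// (lt_trans ltr01 k1).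
exists setT, (A + 2 * C1 + 2 * C2), c; split => //.
- exact: near_everywhereT.
- by clear -A0 C10 C20; lra.
move=> x0 _.
have [y [y0 y1 yrec yge [yrat yle]]] := peak_side x0 c0 Vl lc h.
have hr := corrector_refl h.
have Vlr x : 0 <= refl V x <= lam by exact: Vl.
have [z [z0 z1 zrec zge [zrat zle]]] := peak_side (- x0) c0 Vlr lc hr.
pose wt (y : nat -> R) n := expR (- c * n%:R) * y n.
have step (s : nat -> R) (v : R) n : s n.+2 + s n = 2 * expR (lam - v) * s n.+1 ->
    (forall n, s n.+1 <= expR c * s n) ->
    wt s n.+1 <= expR v * mix delta (wt s n.+2) (wt s n).
  move=> srec srat; rewrite /wt mix_half//; last first.
    have -> : - c * n.+2%:R = - c * n%:R + - (c + c).
      by rewrite -[n.+2%:R]natr1 -[n.+1%:R]natr1; ring.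
    rewrite expRD -mulrA ler_wpM2l ?expR_ge0// expRN ler_pdivrMl ?expR_gt0//.
    apply: le_trans (srat _) _.
    by rewrite expRD -mulrA ler_wpM2l ?expR_ge0.
  rewrite srec -lc.
  have -> : expR v * (expR (- c * n.+1%:R) * (2 * expR (lam - v) * s n.+1) / (2 * expR lam)) =
    (expR v * expR (lam - v) / expR lam) * (expR (- c * n.+1%:R) * s n.+1).
    by field; rewrite gt_eqF ?expR_gt0.
  by rewrite -expRD addrC subrK divff ?mul1r// gt_eqF ?expR_gt0.
have wt0 s : s 0%N = 1 -> wt s 0%N = 1 by move=> s0; rewrite /wt mulr0 expR0 mul1r.
have wt1 s : s 1%N = expR c -> wt s 1%N = 1.
  by move=> s1; rewrite /wt s1 -expRD mulr1 addNr expR0.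
have wtge s n : (forall n, 1 <= s n) -> expR (- c * n%:R) <= wt s n.
  by move=> s1; rewrite /wt ler_peMr ?expR_ge0.
have fg : wt y 0%N = wt z 0%N by rewrite !wt0.
have wt_ge0 s n : (forall n, 1 <= s n) -> 0 <= wt s n.
  by move=> s1; apply: le_trans (wtge _ _ s1); exact: expR_ge0.
have A1 : A <= expR A by apply: le_trans (expR_ge1Dx _); lra.
have tnorm n : - ((c - m) * n%:R) <= - (`|theta| * n%:R) :> R.
  by rewrite lerN2 ler_wpM2r.
exists (glue (wt y) (wt z) x0); split.
- apply: (@glue_ind _ (fun x a p q => expR (0 - eps) * a <= expR (V x) * mix delta p q)) => //.
  + by move=> x a p q; rewrite mixC.
  + rewrite !wt1// wt0// mixpp !mulr1 ler_expR; have /andP[V0 _] := Vl x0.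
    by clear -V0 eps0; lra.
  + move=> n; apply: le_trans (step y _ n (yrec n) yrat).
    by rewrite ler_piMl ?wt_ge0// expR_le1; clear -eps0; lra.
  + move=> n; have := zrec n; rewrite /refl opprD opprK => zr.
    apply: le_trans (step z _ n zr zrat).
    by rewrite ler_piMl ?wt_ge0// expR_le1; clear -eps0; lra.
- apply: (@glue_forall _ (fun x a => a <= expR (theta * (x%:~R - x0%:~R) +
    (A + 2 * C1 + 2 * C2 + eps * (`|x0%:~R| + `|x%:~R|))))) => // n.
  + have /andP[a1 _] := h1 x0; have /andP[_ a2] := h1 (x0 + n%:Z).
    have tt := ler_norm (- (theta * ((x0 + n%:Z)%:~R - x0%:~R))).
    rewrite normrN normrM dist_addr in tt.
    apply: le_trans (ler_wpM2l (expR_ge0 _) (yle n)) _.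
    have [gp0 _] := corr_pos h x0.
    have gg : gp (x0 + n%:Z) / gp x0 <= expR (m * n%:R + (eps * (`|x0%:~R| + `|(x0 + n%:Z)%:~R|) + 2 * C1)).
      rewrite ler_pdivrMr//; apply: le_trans a2 _; apply: le_trans (ler_wpM2l (expR_ge0 _) a1).
      by rewrite -expRD ler_expR intrD mulrDr; clear; lra.
    apply: le_trans (ler_wpM2l (expR_ge0 _) (ler_pM (ltW A0) _ A1 gg)) _.
      by rewrite divr_ge0 ?(ltW gp0)// ltW//; have [] := corr_pos h (x0 + n%:Z).
    rewrite -!expRD ler_expR; have := tnorm n; clear -tt C10 C20; lra.
  + have /andP[a1 _] := h2 x0; have /andP[_ a2] := h2 (x0 - n%:Z).
    have tt := ler_norm (- (theta * ((x0 - n%:Z)%:~R - x0%:~R))).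
    rewrite normrN normrM dist_subr in tt.
    have := zle n; rewrite /refl opprD !opprK => zn.
    apply: le_trans (ler_wpM2l (expR_ge0 _) zn) _.
    have [_ gm0] := corr_pos h x0.
    have gg : gm (x0 - n%:Z) / gm x0 <= expR (m * n%:R + (eps * (`|x0%:~R| + `|(x0 - n%:Z)%:~R|) + 2 * C2)).
      rewrite ler_pdivrMr//; apply: le_trans a2 _; apply: le_trans (ler_wpM2l (expR_ge0 _) a1).
      by rewrite -expRD ler_expR intrB mulrBr; clear; lra.
    apply: le_trans (ler_wpM2l (expR_ge0 _) (ler_pM (ltW A0) _ A1 gg)) _.
      by rewrite divr_ge0 ?(ltW gm0)// ltW//; have [] := corr_pos h (x0 - n%:Z).
    rewrite -!expRD ler_expR; have := tnorm n; clear -tt C10 C20; lra.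
- apply: (@glue_forall _ (fun x a => expR (- (A + 2 * C1 + 2 * C2 + c * `|x%:~R - x0%:~R|)) <= a)) => // n;
  rewrite ?dist_addr ?dist_subr.
  + by apply: le_trans (wtge _ n yge); rewrite ler_expR; clear -A0 C10 C20; lra.
  + by apply: le_trans (wtge _ n zge); rewrite ler_expR; clear -A0 C10 C20; lra.
Qed.

End lower_bounds.

(** * Full control *)

Section full_control.
Context {R : realType}.
Implicit Types (delta beta c H theta lam m s : R) (V S phi : int -> R) (x y : int).

Lemma mix1 (p q : R) : p <= q -> mix 1 p q = p.
Proof. by move=> pq; rewrite mixE//; field. Qed.

Lemma mix1_le (p q : R) : mix 1 p q <= q.
Proof. by apply: le_trans (mix_ler _ _ ler01) _; lra. Qed.

Definition slope S s := forall eps : R, 0 < eps -> exists2 C : R, 0 <= C &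
  forall x, `|S x - s * x%:~R| <= eps * `|x%:~R| + C.

Lemma delta1 : 0 <= (1 : R) <= 1.
Proof. by rewrite ler01 lexx. Qed.

Record cumulative beta V S s : Prop := Cumulative {
  cumul_V : forall x, 0 <= V x <= beta ;
  cumul_S : forall x, S (x + 1) = S x + V x ;
  cumul_slope : slope S s }.

(** [S x + V x] is [S (x + 1)]: running to the left collects the potential deterministically, and
    the linear correction adjusts the slope to [theta]. *)
Definition ballistic V S s theta x := expR (S x + V x - (s - theta) * x%:~R).

Lemma rate_ballistic beta V S s theta (h : cumulative beta V S s) : rate (ballistic V S s theta) theta.
Proof.
have V0b := cumul_V h; have SV := cumul_S h; have Ss := cumul_slope h.
move=> eps eps0; have [C C0 hC] := Ss _ eps0.
have b0 : 0 <= beta by have /andP[a b] := V0b 0; exact: le_trans a b.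
exists (C + beta) => [|x]; first by rewrite addr_ge0.
have := hC x; rewrite ler_norml => /andP[h1 h2].
have /andP[v1 v2] := V0b x.
by rewrite /ballistic !ler_expR; apply/andP; split; clear -h1 h2 v1 v2 b0; lra.
Qed.

(** For [s <= theta] and [V >= 0] the function increases over two steps, so running to the left is
    optimal. *)
Lemma bell_ballistic beta V S s theta x (h : cumulative beta V S s) : s <= theta ->
  bell 1 V (ballistic V S s theta) x = expR (s - theta) * ballistic V S s theta x.
Proof.
have V0b := cumul_V h; have SV := cumul_S h; have Ss := cumul_slope h.
move=> st; rewrite /bell mixC mix1.
  rewrite /ballistic -!expRD; congr expR.
  by have := SV (x - 1); rewrite subrK => ->; rewrite intrB; ring.
have := SV (x - 1); rewrite subrK => S1.
rewrite /ballistic ler_expR SV S1 intrB intrD.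
have /andP[v1 _] := V0b x; have /andP[v2 _] := V0b (x + 1).
by clear -st v1 v2; nra.
Qed.

Lemma UB_ballistic beta V S s theta (h : cumulative beta V S s) : s <= theta -> UB 1 V theta (s - theta).
Proof.
have V0b := cumul_V h; have SV := cumul_S h; have Ss := cumul_slope h.
move=> st; apply: (rate_UB delta1 (rate_ballistic theta h)) => y.
by rewrite (bell_ballistic _ h).
Qed.

Lemma LB_ballistic beta V S s theta (h : cumulative beta V S s) : s <= theta -> LB 1 V theta (s - theta).
Proof.
have V0b := cumul_V h; have SV := cumul_S h; have Ss := cumul_slope h.
move=> st; apply: (rate_LB delta1 (rate_ballistic theta h)) => y.
by rewrite (bell_ballistic _ h).
Qed.

Lemma slope_incr S s eps C x y : (forall x, `|S x - s * x%:~R| <= eps * `|x%:~R| + C) ->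
  `|S y - S x - s * (y%:~R - x%:~R)| <= eps * (`|x%:~R| + `|y%:~R|) + 2 * C.
Proof.
move=> h; have -> : S y - S x - s * (y%:~R - x%:~R) =
  (S y - s * y%:~R) - (S x - s * x%:~R) by ring.
apply: le_trans (ler_normB _ _) _; have := h x; have := h y; lra.
Qed.

Lemma S_step beta V S s x (h : cumulative beta V S s) : 0 <= S (x + 1) - S x <= beta.
Proof.
have V0b := cumul_V h; have SV := cumul_S h; have Ss := cumul_slope h.
by rewrite SV addrAC subrr add0r. Qed.

Lemma S_incr beta V S s x (n : nat) (h : cumulative beta V S s) : 0 <= S (x + n%:Z) - S x <= beta * n%:R.
Proof.
have V0b := cumul_V h; have SV := cumul_S h; have Ss := cumul_slope h.
elim: n => [|n IH]; first by rewrite addr0 subrr mulr0 lexx.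
have -> : x + n.+1%:Z = x + n%:Z + 1 by lia.
have := S_step (x + n%:Z) h; rewrite -[n.+1%:R]natr1 mulrDr mulr1.
move: IH => /andP[a b] /andP[c d]; apply/andP; split; clear -a b c d; lra.
Qed.

Lemma beta_ge0 beta V S s  (h : cumulative beta V S s) : 0 <= beta.
Proof.
have V0b := cumul_V h; have SV := cumul_S h; have Ss := cumul_slope h.
by have /andP[a b] := V0b 0; exact: le_trans a b. Qed.

Lemma S_decr beta V S s x (n : nat) (h : cumulative beta V S s) : 0 <= S x - S (x - n%:Z) <= beta * n%:R.
Proof.
have V0b := cumul_V h; have SV := cumul_S h; have Ss := cumul_slope h.
by have := S_incr (x - n%:Z) n h; rewrite subrK. Qed.

(** Full control now runs away from [x0] and collects exactly the potential that the two branches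
    discount; both decay at rate [s], hence lie below every exponential of slope at most [s]. *)
Lemma LB_full beta V S s theta (h : cumulative beta V S s) : `|theta| <= s -> LB 1 V theta 0.
Proof.
have V0b := cumul_V h; have SV := cumul_S h; have Ss := cumul_slope h.
move=> ts; apply: LB_local => [|eps eps0]; first exact: delta1.
have [C C0 hC] := Ss _ eps0; have b0 := beta_ge0 h.
have s0 : 0 <= s by exact: le_trans (normr_ge0 theta) ts.
exists setT, (2 * C + 3 * (eps + beta + s)), beta; split => //.
- exact: near_everywhereT.
- by rewrite addr_ge0 ?mulr_ge0// !addr_ge0// ltW.
move=> x0 _.
pose f n := expR (- (S (x0 + n%:Z) - S x0)).
(* The shift by one arises because [S (x + 1) - S x] is the potential at the left end [x]; it makes
   both branches start by discounting [V x0]. *)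
pose g n := expR (- (S (x0 + 1) - S (x0 + 1 - n%:Z))).
have fg : f 0%N = g 0%N by rewrite /f /g addr0 subr0 !subrr.
have tnorm n : - (s * n%:R) <= - (`|theta| * n%:R) :> R.
  by rewrite lerN2 ler_wpM2r.
exists (glue f g x0); split.
- apply: (@glue_ind _ (fun x a p q => expR (0 - eps) * a <= expR (V x) * mix 1 p q)) => //.
  + by move=> x a p q; rewrite mixC.
  + have -> : f 1%N = g 1%N by rewrite /f /g addrK.
    rewrite mixpp /g addrK SV /f addr0 -!expRD ler_expR.
    by clear -eps0; lra.
  + move=> n; have E : S (x0 + n.+2%:Z) = S (x0 + n.+1%:Z) + V (x0 + n.+1%:Z).
      by rewrite -SV; congr S; lia.
    have E' : S (x0 + n.+1%:Z) = S (x0 + n%:Z) + V (x0 + n%:Z).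
      by rewrite -SV; congr S; lia.
    have /andP[v1 _] := V0b (x0 + n.+1%:Z); have /andP[v2 _] := V0b (x0 + n%:Z).
    rewrite mix1; last by rewrite /f ler_expR E E'; clear -v1 v2; lra.
    by rewrite /f -!expRD ler_expR E; clear -eps0; lra.
  + move=> n; have E : S (x0 + 1 - n.+1%:Z) = S (x0 + 1 - n.+2%:Z) + V (x0 + 1 - n.+2%:Z).
      by rewrite -SV; congr S; lia.
    have E' : S (x0 + 1 - n%:Z) = S (x0 + 1 - n.+1%:Z) + V (x0 + 1 - n.+1%:Z).
      by rewrite -SV; congr S; lia.
    have E2 : x0 - n.+1%:Z = x0 + 1 - n.+2%:Z by lia.
    have /andP[v1 _] := V0b (x0 + 1 - n.+1%:Z); have /andP[v2 _] := V0b (x0 + 1 - n.+2%:Z).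
    rewrite mix1; last by rewrite /g ler_expR E' E; clear -v1 v2; lra.
    by rewrite /g -!expRD ler_expR E E2; clear -eps0; lra.
- apply: (@glue_forall _ (fun x a => a <= expR (theta * (x%:~R - x0%:~R) +
    (2 * C + 3 * (eps + beta + s) + eps * (`|x0%:~R| + `|x%:~R|))))) => // n.
  + have tt := ler_norm (- (theta * ((x0 + n%:Z)%:~R - x0%:~R))).
    rewrite normrN normrM dist_addr in tt.
    have := @slope_incr S s eps C x0 (x0 + n%:Z) hC; rewrite ler_norml => /andP[h1 h2].
    have e1 : (x0 + n%:Z)%:~R - x0%:~R = n%:R :> R by rewrite intrD addrAC subrr add0r.
    rewrite e1 in h1 h2 tt *; have := tnorm n.
    by rewrite /f ler_expR; clear -tt h1 h2 eps0 b0 s0; lra.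
  + have tt := ler_norm (- (theta * ((x0 - n%:Z)%:~R - x0%:~R))).
    rewrite normrN normrM dist_subr in tt.
    have := @slope_incr S s eps C (x0 - n%:Z) x0 hC; rewrite ler_norml => /andP[h1 h2].
    have e1 : (x0 - n%:Z)%:~R - x0%:~R = - n%:R :> R by rewrite intrB addrAC subrr add0r.
    have e2 : x0%:~R - (x0 - n%:Z)%:~R = n%:R :> R by rewrite intrB opprB addrC subrK.
    rewrite e2 in h1 h2; rewrite e1 in tt *; have := tnorm n.
    rewrite /g ler_expR.
    have -> : x0 + 1 - n%:Z = x0 - n%:Z + 1 by lia.
    have /andP[v1 v2] := V0b x0; have /andP[v3 v4] := V0b (x0 - n%:Z).
    by rewrite !SV; clear -tt h1 h2 eps0 b0 s0 v1 v2 v3 v4; lra.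
- have es : 0 <= 3 * (eps + beta + s) by rewrite mulr_ge0// !addr_ge0// ltW.
  apply: (@glue_forall _ (fun x a => expR (- (2 * C + 3 * (eps + beta + s) +
     beta * `|x%:~R - x0%:~R|)) <= a)) => // n; rewrite ?dist_addr ?dist_subr ler_expR.
  + by have /andP[_ hh] := S_incr x0 n h; clear -hh es C0; lra.
  + by have /andP[_ hh] := S_decr (x0 + 1) n h; clear -hh es C0; lra.
Qed.

(** The control runs inwards and then shuttles between [x0] and [x0 + 1], where the potential is
    small; a stretch of radius 1 is enough. *)
Lemma UB_full beta V S s theta (h : cumulative beta V S s) : low V -> `|theta| <= s -> UB 1 V theta 0.
Proof.
have V0b := cumul_V h; have SV := cumul_S h; have Ss := cumul_slope h.
move=> lo ts; apply: UB_local => [|eps eps0]; first exact: delta1.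
have [C C0 hC] := Ss _ eps0; have b0 := beta_ge0 h.
have s0 : 0 <= s by exact: le_trans (normr_ge0 theta) ts.
have e2 : 0 < eps / 2 by rewrite divr_gt0.
exists (fun x0 => forall z : int, `|z| <= 1%N%:Z -> V (x0 + z) <= eps / 2).
exists (2 * C + 3 * (eps + beta + s)), beta; split => //.
- exact: lo.
- by rewrite addr_ge0 ?mulr_ge0// !addr_ge0// ltW.
move=> x0 Bx0.
pose f n := expR (S (x0 + 1 + n%:Z) - S (x0 + 1)).
pose g n := expR (S x0 - S (x0 - n%:Z)).
have fg : f 0%N = g 0%N by rewrite /f /g addr0 subr0 !subrr.
have tnorm n : `|theta| * n%:R <= s * n%:R :> R by rewrite ler_wpM2r.
exists (glue f g x0); split.
- apply: (@glue_ind _ (fun x a p q => expR (V x) * mix 1 p q <= expR (0 + eps) * a)) => //.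
  + by move=> x a p q; rewrite mixC.
  + rewrite mixC; apply: le_trans (ler_wpM2l (expR_ge0 _) (mix1_le _ _)) _.
    rewrite /f addr0 !SV -!expRD ler_expR.
    have := Bx0 0 isT; have := Bx0 1 isT; rewrite addr0; clear; lra.
  + move=> n; apply: le_trans (ler_wpM2l (expR_ge0 _) (mix1_le _ _)) _.
    have E : S (x0 + 1 + n.+1%:Z) = S (x0 + 1 + n%:Z) + V (x0 + 1 + n%:Z).
      by rewrite -SV; congr S; lia.
    have E2 : x0 + n.+1%:Z = x0 + 1 + n%:Z by lia.
    by rewrite /f -!expRD ler_expR E E2; clear -eps0; lra.
  + move=> n; apply: le_trans (ler_wpM2l (expR_ge0 _) (mix1_le _ _)) _.
    have E : S (x0 - n%:Z) = S (x0 - n.+1%:Z) + V (x0 - n.+1%:Z).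
      by rewrite -SV; congr S; lia.
    by rewrite /g -!expRD ler_expR E; clear -eps0; lra.
- apply: (@glue_forall _ (fun x a => expR (theta * (x%:~R - x0%:~R)) <=
    expR (2 * C + 3 * (eps + beta + s) + eps * (`|x0%:~R| + `|x%:~R|)) * a)) => // n.
  + have tt := ler_norm (theta * ((x0 + n%:Z)%:~R - x0%:~R)).
    rewrite normrM dist_addr in tt.
    have := @slope_incr S s eps C x0 (x0 + n%:Z) hC; rewrite ler_norml => /andP[h1 h2].
    have e1 : (x0 + n%:Z)%:~R - x0%:~R = n%:R :> R by rewrite intrD addrAC subrr add0r.
    rewrite e1 in h1 h2 tt *; have := tnorm n.
    have -> : f n = expR (S (x0 + n%:Z) + V (x0 + n%:Z) - (S x0 + V x0)).
      by rewrite /f addrAC !SV.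
    have /andP[v1 v2] := V0b x0; have /andP[v3 v4] := V0b (x0 + n%:Z).
    by rewrite -expRD ler_expR; clear -tt h1 h2 eps0 b0 s0 v1 v2 v3 v4; lra.
  + have tt := ler_norm (theta * ((x0 - n%:Z)%:~R - x0%:~R)).
    rewrite normrM dist_subr in tt.
    have := @slope_incr S s eps C (x0 - n%:Z) x0 hC; rewrite ler_norml => /andP[h1 h2].
    have e2' : x0%:~R - (x0 - n%:Z)%:~R = n%:R :> R by rewrite intrB opprB addrC subrK.
    rewrite e2' in h1 h2; have := tnorm n.
    by rewrite /g -expRD ler_expR; clear -tt h1 h2 eps0 b0 s0; lra.
- have es : 0 <= 3 * (eps + beta + s) by rewrite mulr_ge0// !addr_ge0// ltW.
  apply: (@glue_forall _ (fun x a => a <= expR (2 * C + 3 * (eps + beta + s) +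
     beta * `|x%:~R - x0%:~R|))) => // n; rewrite ?dist_addr ?dist_subr ler_expR.
  + by have /andP[_ hh] := S_incr (x0 + 1) n h; clear -hh es C0; lra.
  + by have /andP[_ hh] := S_decr x0 n h; clear -hh es C0; lra.
Qed.

End full_control.

Lemma slope_refl {R : realType} (S : int -> R) s C0 : slope S s ->
  (forall x, `|S (x + 1) - S x| <= C0) -> slope (fun x => - S (- x + 1)) s.
Proof.
move=> Ss hS eps eps0; have [C hC0 hC] := Ss _ eps0.
have c0 : 0 <= C0 by apply: le_trans (normr_ge0 _) (hS 0).
exists (C + C0) => [|x]; first by rewrite addr_ge0.
have := hC (- x); rewrite intrN normrN => h.
have -> : - S (- x + 1) - s * x%:~R = - ((S (- x) - s * - x%:~R) + (S (- x + 1) - S (- x))).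
  by ring.
rewrite normrN; apply: le_trans (ler_normD _ _) _.
by rewrite addrA lerD.
Qed.

(** * A pointwise ergodic theorem *)

Section bounded_expectation.
Context {R : realType} {d : measure_display} {Omega : measurableType d}.
Implicit Types (f g : Omega -> R) (P : probability Omega R).

Definition bounded_meas f :=
  measurable_fun setT f /\ exists B : R, forall w, `|f w| <= B.

Definition Ex P f : R := \int[P]_w f w.

Lemma bounded_measD f g : bounded_meas f -> bounded_meas g ->
  bounded_meas (fun w => f w + g w).
Proof.
move=> [mf [B hB]] [mg [C hC]]; split; first exact: measurable_funD.
by exists (B + C) => w; apply: le_trans (ler_normD _ _) _; rewrite lerD.
Qed.

Lemma measurable_le_set f (r : R) : bounded_meas f -> measurable [set w | f w <= r].
Proof.
move=> [mf _]; rewrite -[X in measurable X]setTI.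
have -> : [set w | f w <= r] = f @^-1` [set` `]-oo, r]].
  by apply/seteqP; split => w /=; rewrite in_itv.
exact: mf.
Qed.

Lemma measurable_gt_set f (r : R) : bounded_meas f -> measurable [set w | r < f w].
Proof.
move=> [mf _]; rewrite -[X in measurable X]setTI.
have -> : [set w | r < f w] = f @^-1` [set` `]r, +oo[].
  by apply/seteqP; split => w /=; rewrite in_itv /= andbT.
exact: mf.
Qed.

Lemma bounded_measN f : bounded_meas f -> bounded_meas (fun w => - f w).
Proof.
move=> [mf [B hB]]; split; first exact: measurableT_comp.
by exists B => w; rewrite normrN.
Qed.

Lemma bounded_measZ (r : R) f : bounded_meas f -> bounded_meas (fun w => r * f w).
Proof.
move=> [mf [B hB]]; split; first exact: measurable_funM.
by exists (`|r| * B) => w; rewrite normrM ler_wpM2l.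
Qed.

Lemma bounded_meas_cst (r : R) : bounded_meas (fun=> r).
Proof. by split; [exact: measurable_cst|exists `|r|]. Qed.

Lemma bounded_meas_max f g : bounded_meas f -> bounded_meas g ->
  bounded_meas (fun w => Num.max (f w) (g w)).
Proof.
move=> [mf [B hB]] [mg [C hC]]; split; first exact: measurable_maxr.
exists (B + C) => w; rewrite /Num.max.
have := hB w; have := hC w; have := normr_ge0 (f w); have := normr_ge0 (g w).
by case: ifP => _; lra.
Qed.

Lemma bounded_meas_comp f (S : Omega -> Omega) : measurable_fun setT S ->
  bounded_meas f -> bounded_meas (f \o S).
Proof.
move=> mS [mf [B hB]]; split; first exact: measurableT_comp.
by exists B => w; exact: hB.
Qed.

Lemma bounded_integrable P f : bounded_meas f -> P.-integrable setT (EFin \o f).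
Proof.
move=> [mf [B hB]]; apply: measurable_bounded_integrable => //.
  by apply: le_lt_trans (probability_le1 P measurableT) _; exact: ltry.
by exists B; split; [exact: num_real|move=> M BM w _; exact: le_trans (hB w) (ltW BM)].
Qed.

Lemma Ex_le P f g : bounded_meas f -> bounded_meas g -> (forall w, f w <= g w) ->
  Ex P f <= Ex P g.
Proof. by move=> bf bg fg; apply: le_Rintegral => //; exact: bounded_integrable. Qed.

Lemma ExD P f g : bounded_meas f -> bounded_meas g ->
  Ex P (fun w => f w + g w) = Ex P f + Ex P g.
Proof. by move=> bf bg; rewrite /Ex RintegralD//; exact: bounded_integrable. Qed.

Lemma ExB P f g : bounded_meas f -> bounded_meas g ->
  Ex P (fun w => f w - g w) = Ex P f - Ex P g.
Proof. by move=> bf bg; rewrite /Ex RintegralB//; exact: bounded_integrable. Qed.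

Lemma Ex_cst P (r : R) : Ex P (fun=> r) = r.
Proof.
rewrite /Ex Rintegral_cst//; transitivity (r * 1); last by rewrite mulr1.
by congr (_ * _); exact: (congr1 fine (probability_setT P)).
Qed.

Lemma ExZ P (r : R) f : bounded_meas f -> Ex P (fun w => r * f w) = r * Ex P f.
Proof. by move=> bf; rewrite /Ex RintegralZl//; exact: bounded_integrable. Qed.

Lemma bounded_meas_indic (A : set Omega) : measurable A -> bounded_meas (\1_A : Omega -> R).
Proof.
move=> mA; split; first exact: measurable_indic.
by exists 1 => w; rewrite indicE; case: (_ \in _); rewrite ?normr1 ?normr0.
Qed.

Lemma Ex_indic P (A : set Omega) : measurable A -> Ex P \1_A = fine (P A).
Proof.
by move=> mA; rewrite /Ex /Rintegral integral_indic// setIT.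
Qed.

End bounded_expectation.

Section ergodic.
Context {R : realType} {d : measure_display} {Omega : measurableType d}.
Implicit Types (P : probability Omega R) (f g : Omega -> R) (T Tinv : Omega -> Omega).

Lemma ergodic_automorphism_sym P T Tinv : ergodic_automorphism P T Tinv ->
  ergodic_automorphism P Tinv T.
Proof.
move=> h; have TK := ea_TK h; have TinvK := ea_TinvK h.
have pre (A : set Omega) : T @^-1` (Tinv @^-1` A) = A.
  by apply/seteqP; split => w /=; rewrite TK.
split => //; [exact: ea_measurable_inv h|exact: ea_measurable h|..].
- move=> A mA; rewrite -(ea_preserving h) ?pre//.
  by rewrite -[X in measurable X]setTI; exact: (ea_measurable_inv h).
- by move=> A mA AA; apply: (ea_ergodic h) => //; rewrite -{1}AA pre.
Qed.

Lemma Ex_shift P T Tinv f : ergodic_automorphism P T Tinv -> bounded_meas f ->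
  Ex P (f \o T) = Ex P f.
Proof.
move=> h bf; rewrite /Ex /Rintegral; congr fine.
have mT := ea_measurable h.
have [mf _] := bf.
transitivity (\int[pushforward P T]_w (f w)%:E)%E.
  rewrite integral_pushforward//; first by exact/measurable_EFinP.
  rewrite preimage_setT.
  exact: (bounded_integrable P (bounded_meas_comp mT bf)).
by apply: eq_measure_integral => A mA _; exact: (ea_preserving h).
Qed.

Definition orbit_sum T f (n : nat) (w : Omega) : R := \sum_(k < n) f (iter k T w).

Lemma orbit_sumS T f n w : orbit_sum T f n.+1 w = f w + orbit_sum T f n (T w).
Proof.
rewrite /orbit_sum big_ord_recl /=; congr (_ + _); apply: eq_bigr => i _.
by rewrite [RHS](_ : _ = f (iter i.+1 T w))// iterSr.
Qed.

Lemma orbit_sumSr T f n w : orbit_sum T f n.+1 w = orbit_sum T f n w + f (iter n T w).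
Proof. by rewrite /orbit_sum big_ord_recr. Qed.

(** The maximum of the orbit sums of length at most [n], the empty sum included; the recursion
    compares it directly with its value at [T w]. *)
Fixpoint running_max T f (n : nat) (w : Omega) : R :=
  if n is m.+1 then Num.max 0 (f w + running_max T f m (T w)) else 0.

Lemma running_max_ge0 T f n w : 0 <= running_max T f n w.
Proof. by case: n => [|n] //=; rewrite le_max lexx. Qed.

Lemma running_max_homo T f n w : running_max T f n w <= running_max T f n.+1 w.
Proof.
elim: n w => [|n IH] w; first exact: running_max_ge0.
rewrite [leLHS]/= [leRHS]/= ge_max le_max lexx /= le_max.
by apply/orP; right; rewrite lerD2l; exact: IH.
Qed.

Lemma orbit_sum_le_max T f n w : orbit_sum T f n w <= running_max T f n w.
Proof.
elim: n w => [|n IH] w; first by rewrite /orbit_sum big_ord0.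
by rewrite orbit_sumS /= le_max lerD2l IH orbT.
Qed.

Lemma bounded_running_max P T Tinv f n : ergodic_automorphism P T Tinv ->
  bounded_meas f -> bounded_meas (running_max T f n).
Proof.
move=> h bf; elim: n => [|n IH]; first exact: bounded_meas_cst.
apply: (@bounded_meas_max _ _ _ (fun=> 0)); first exact: bounded_meas_cst.
apply: bounded_measD => //; exact: (bounded_meas_comp (ea_measurable h) IH).
Qed.

Lemma orbit_sum_bounded_meas P T Tinv g n : ergodic_automorphism P T Tinv ->
  bounded_meas g -> bounded_meas (orbit_sum T g n).
Proof.
move=> h bg; elim: n => [|n IH].
  rewrite (_ : orbit_sum T g 0 = fun=> 0); first exact: bounded_meas_cst.
  by apply/funext => w; rewrite /orbit_sum big_ord0.
rewrite (_ : orbit_sum T g n.+1 = fun w => g w + (orbit_sum T g n \o T) w).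
  apply: bounded_measD => //; exact: (bounded_meas_comp (ea_measurable h) IH).
by apply/funext => w; rewrite orbit_sumS.
Qed.

(* Garsia's inequality: [M_n - M_n \o T <= g] wherever the running maximum
   [M_n] is positive, and [M_n - M_n \o T] has mean zero. *)
Lemma maximal_ergodic P T Tinv g : ergodic_automorphism P T Tinv -> bounded_meas g ->
  P (\bigcap_n [set w | orbit_sum T g n w <= 0]) = 0%E -> 0 <= Ex P g.
Proof.
move=> h bg P0; have [mg [B hB]] := bg.
have B0 : 0 <= B := le_trans (normr_ge0 _) (hB point).
pose M := running_max T g.
have bM n : bounded_meas (M n) := bounded_running_max n h bg.
pose F n := [set w | M n w <= 0].
have mF n : measurable (F n).
  exact: measurable_le_set.
have mcap : measurable (\bigcap_n F n) by exact: bigcap_measurable.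
have Pcap : P (\bigcap_n F n) = 0%E.
  apply/eqP; rewrite eq_le measure_ge0 andbT -P0; apply: le_measure; rewrite ?inE//.
    apply: bigcap_measurable => // n _.
    exact: measurable_le_set (orbit_sum_bounded_meas n h bg).
  move=> w Fw n _; exact: le_trans (orbit_sum_le_max _ _ _ _) (Fw n I).
have ineq n : 0 <= Ex P g + B * fine (P (F n)).
  have bF := @bounded_meas_indic R _ _ _ (mF n).
  have bBF : bounded_meas (fun w => B * \1_(F n) w : R) := bounded_measZ B bF.
  have bMT := bounded_meas_comp (ea_measurable h) (bM n).
  rewrite -Ex_indic// -(ExZ P B bF) -ExD//.
  rewrite (_ : 0 = Ex P (fun w => M n w - (M n \o T) w)); last first.
    by rewrite ExB// (Ex_shift h)// subrr.
  apply: Ex_le; [|exact: bounded_measD|move=> w /=].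
    by apply: bounded_measD => //; exact: bounded_measN.
  have MT0 : 0 <= M n (T w) by exact: running_max_ge0.
  have := hB w; rewrite ler_norml => /andP[g1 g2].
  rewrite indicE; case: (boolP (w \in F n)) => [|/negP Fw] /=.
    by rewrite inE /F /= => M0; lra.
  have Mpos : 0 < M n w by rewrite ltNge; apply/negP => M0; apply: Fw; rewrite inE.
  rewrite mulr0 addr0; case: n Mpos MT0 {Fw bF bBF bMT} => [|n]; first by rewrite /M /= ltxx.
  move=> Mpos _; move: (Mpos); rewrite /M [running_max _ _ _ w]/=.
  rewrite lt_max ltxx /= => gpos; rewrite max_r ?(ltW gpos)//.
  by have := running_max_homo T g n (T w); rewrite /=; lra.
have cv : P (F n) @[n --> \oo] --> 0%E.
  rewrite -Pcap; apply: nonincreasing_cvg_mu => //.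
    by apply: le_lt_trans (probability_le1 P (mF 0%N)) _; rewrite ltry.
  apply/nonincreasing_seqP => n; rewrite subsetEset => w; rewrite /F /=.
  by apply: le_trans; exact: running_max_homo.
have fcv : fine (P (F n)) @[n --> \oo] --> (0 : R).
  by apply: fine_cvg; exact: cv.
have : (Ex P g + B * fine (P (F n))) @[n --> \oo] --> Ex P g + B * 0.
  apply: cvgD; first exact: cvg_cst.
  by apply: cvgM => //; exact: cvg_cst.
rewrite mulr0 addr0 => lim.
have <- := cvg_lim (@Rhausdorff R) lim.
apply: limr_ge; first by apply/cvg_ex; exists (Ex P g).
by near=> n; exact: ineq.
Unshelve. all: by end_near. Qed.

(** Unboundedness from above is an invariant event. If it had probability 1, almost surely some
    orbit sum would be positive, and the maximal inequality would give a nonnegative mean. Applied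
    to [f - a], this yields the upper half of the ergodic theorem. *)
Lemma orbit_sum_bounded_above P T Tinv g : ergodic_automorphism P T Tinv ->
  bounded_meas g -> Ex P g < 0 ->
  {ae P, forall w, exists K : R, forall n, orbit_sum T g n w <= K}.
Proof.
move=> h bg Eg; have [_ [B hB]] := bg.
pose A := \bigcap_(K in @setT nat) \bigcup_(n in @setT nat) [set w | K%:R < orbit_sum T g n w].
have mA : measurable A.
  apply: bigcap_measurable => // K _; apply: bigcup_measurable => n _.
  exact: measurable_gt_set (orbit_sum_bounded_meas n h bg).
(* Passing between [w] and [T w] changes orbit sums by one term, at most [b]; invariance follows by
   raising the level [K] by [b]. *)
pose b := (Num.truncn B).+1.
have Bb : B <= b%:R by rewrite ltW// truncnS_gt.
have invA : T @^-1` A = A.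
  apply/seteqP; split => w /= Aw K _.
    have [n _ /= hn] := Aw (K + b)%N I; exists n.+1 => //=.
    rewrite orbit_sumS; rewrite natrD in hn.
    by have := hB w; rewrite ler_norml => /andP[g1 g2]; lra.
  have [[|n] _ /= hn] := Aw (K + b)%N I.
    by move: hn; rewrite /orbit_sum big_ord0 ltNge ler0n.
  exists n => //=; move: hn; rewrite orbit_sumS natrD.
  by have := hB w; rewrite ler_norml => /andP[g1 g2]; lra.
have [PA|PA] := ea_ergodic h mA invA.
  exists A; split => // w /= unb K _ /=.
  have /existsNP[n hn] : ~ (forall n, orbit_sum T g n w <= K%:R).
    by move=> hK; apply: unb; exists K%:R.
  by exists n => //=; rewrite ltNge; apply/negP.
exfalso; move: Eg; rewrite ltNge => /negP; apply.
apply: (maximal_ergodic h bg); apply/eqP; rewrite eq_le measure_ge0 andbT.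
rewrite -[leRHS](_ : P (~` A) = 0)%E; last by rewrite probability_setC// PA subee.
apply: le_measure; rewrite ?inE//; [|exact: measurableC|].
  apply: bigcap_measurable => // n _.
  exact: measurable_le_set (orbit_sum_bounded_meas n h bg).
move=> w Fw Aw; have [n _ /=] := Aw 0%N I.
by rewrite ltNge => /negP; apply; exact: Fw.
Qed.

End ergodic.

(** * Two-sided Birkhoff sums and visits to an event *)

Section two_sided.
Context {R : realType} {d : measure_display} {Omega : measurableType d}.
Implicit Types (P : probability Omega R) (f g : Omega -> R) (T Tinv : Omega -> Omega).

Lemma orbit_sumB T f a n w :
  orbit_sum T (fun w => f w - a) n w = orbit_sum T f n w - a * n%:R.
Proof.
elim: n w => [|n IH] w; first by rewrite /orbit_sum !big_ord0 mulr0 subr0.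
by rewrite !orbit_sumS IH -[n.+1%:R]natr1; ring.
Qed.

Lemma orbit_sumN T f n w :
  orbit_sum T (fun w => - f w) n w = - orbit_sum T f n w.
Proof. by rewrite /orbit_sum sumrN. Qed.

Lemma ergodic_upper P T Tinv f a : ergodic_automorphism P T Tinv -> bounded_meas f ->
  Ex P f < a ->
  {ae P, forall w, exists K : R, forall n, orbit_sum T f n w <= a * n%:R + K}.
Proof.
move=> h bf fa.
have bg : bounded_meas (fun w => f w - a).
  by apply: bounded_measD => //; exact: bounded_meas_cst.
have Eg : Ex P (fun w => f w - a) < 0.
  by rewrite ExB ?Ex_cst ?subr_lt0//; exact: bounded_meas_cst.
apply: filterS (orbit_sum_bounded_above h bg Eg) => w [K hK]; exists K => n.
by have := hK n; rewrite orbit_sumB; lra.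
Qed.

Lemma ergodic_two_sided P T Tinv f (e : R) : ergodic_automorphism P T Tinv ->
  bounded_meas f -> 0 < e ->
  {ae P, forall w, exists2 K : R, 0 <= K & forall n,
    `|orbit_sum T f n w - Ex P f * n%:R| <= e * n%:R + K}.
Proof.
move=> h bf e0.
have u1 : Ex P f < Ex P f + e by rewrite ltrDl.
have u2 : Ex P (fun w => - f w) < - Ex P f + e.
  have -> : Ex P (fun w => - f w) = - Ex P f.
    rewrite -[RHS]add0r -(Ex_cst P 0) -ExB//; last exact: bounded_meas_cst.
    by congr Ex; apply/funext => w; rewrite sub0r.
  by rewrite ltrDl.
apply: filterS2 (ergodic_upper h bf u1) (ergodic_upper h (bounded_measN bf) u2).
move=> w [K1 h1] [K2 h2]; exists (`|K1| + `|K2|); first by rewrite addr_ge0.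
move=> n; have := h1 n; have := h2 n; rewrite orbit_sumN => a2 a1.
have := ler_norm K1; have := ler_norm K2.
have := normr_ge0 K1; have := normr_ge0 K2 => b1 b2 b3 b4.
by rewrite ler_norml; apply/andP; split; lra.
Qed.

(** The primitive, vanishing at 0, of the stationary sequence [f (T^x w)] on the whole line. The
    additional [Tinv] on the left makes the increment from [x] to [x + 1] the term at [x]. *)
Definition cumul T Tinv f w (x : int) : R :=
  match x with
  | Posz n => orbit_sum T f n w
  | Negz n => - orbit_sum Tinv (f \o Tinv) n.+1 w
  end.

Lemma cumul_step T Tinv f w x :
  cumul T Tinv f w (x + 1) = cumul T Tinv f w x + f (iterz T Tinv x w).
Proof.
case: x => [n|[|n]].
- have -> : n%:Z + 1 = n.+1%:Z by lia.
  by rewrite /cumul orbit_sumSr.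
- have -> : Negz 0 + 1 = 0%N%:Z by lia.
  by rewrite /cumul orbit_sumSr /orbit_sum !big_ord0 /= add0r addNr.
- have -> : Negz n.+1 + 1 = Negz n by lia.
  by rewrite /cumul [in RHS]orbit_sumSr /= opprD addrNK.
Qed.

(** Countably many errors [1 / (k + 1)] suffice, so the null set does not depend on [eps]. The past
    is governed by the same theorem for the inverse map. *)
Lemma slope_cumul P T Tinv f : ergodic_automorphism P T Tinv -> bounded_meas f ->
  {ae P, forall w, slope (cumul T Tinv f w) (Ex P f)}.
Proof.
move=> h bf; have h' := ergodic_automorphism_sym h.
have bf' : bounded_meas (f \o Tinv) := bounded_meas_comp (ea_measurable h') bf.
have key k : {ae P, forall w, exists2 C : R, 0 <= C & forall x : int,
    `|cumul T Tinv f w x - Ex P f * x%:~R| <= (k.+1%:R)^-1 * `|x%:~R| + C}.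
  have e0 : 0 < (k.+1%:R : R)^-1 by rewrite invr_gt0.
  apply: filterS2 (ergodic_two_sided h bf e0) (ergodic_two_sided h' bf' e0).
  move=> w [K1 K10 h1] [K2 K20 h2]; exists (K1 + K2); first by rewrite addr_ge0.
  move=> [n|n].
    apply: le_trans (h1 n) _; rewrite -[Posz n]/(n%:Z) -pmulrn ger0_norm//.
    by rewrite lerD2l lerDl.
  have := h2 n.+1; rewrite (Ex_shift h' bf) /cumul NegzE intrN normrN.
  rewrite -[n.+1%:~R]/(n.+1%:R : R) (ger0_norm (ler0n _ _)) mulrN opprK => h3.
  by rewrite addrC distrC; apply: le_trans h3 _; rewrite lerD2l lerDr.
apply: filterS (ae_foralln key) => w hw eps eps0.
have [C C0 hC] := hw (Num.truncn eps^-1); exists C => // x.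
apply: le_trans (hC x) _; rewrite lerD2r ler_wpM2r//.
by rewrite -[leRHS]invrK lef_pV2 ?posrE ?invr_gt0// ltW// truncnS_gt.
Qed.

(** If [B] were missed on [[x, x + K)], then [S] would be constant there, against its positive
    slope; this bounds [K] by a small multiple of [|x|] plus a constant. *)
Lemma near_everywhere_slope (S : int -> R) (p : R) (B : int -> bool) : 0 < p ->
  (forall x, S (x + 1) = S x + (B x)%:R) -> slope S p -> @near_everywhere R B.
Proof.
move=> p0 SB Sp eps eps0.
(* [e <= p / 2] absorbs the part of the error proportional to [K], and [e <= eps * p / 4] brings the
   remaining multiple of [|x|] below [eps]. *)
pose e := Num.min (p / 2) (eps * p / 4).
have e0 : 0 < e by rewrite lt_min !divr_gt0// mulr_gt0.
have e1 : e <= p / 2 by rewrite ge_min lexx.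
have e2 : e <= eps * p / 4 by rewrite ge_min lexx orbT.
have [C C0 hC] := Sp _ e0.
exists (4 * C / p + 1); first by rewrite addr_ge0 ?divr_ge0 ?mulr_ge0// ltW.
move=> x.
pose K := (Num.truncn ((4 * e * `|x%:~R| + 4 * C) / p)).+1.
have K1 : (4 * e * `|x%:~R| + 4 * C) / p < K%:R by rewrite truncnS_gt.
have nx : 0 <= `|x%:~R : R| by [].
have K2 : K%:R <= (4 * e * `|x%:~R| + 4 * C) / p + 1.
  have q0 : 0 <= 4 * e * `|x%:~R| + 4 * C.
    by rewrite addr_ge0 ?mulr_ge0// ltW.
  by rewrite /K -[X in X <= _]natr1 lerD2r truncn_le// divr_ge0// ltW.
have K3 : K%:R <= eps * `|x%:~R| + (4 * C / p + 1).
  apply: le_trans K2 _; rewrite mulrDl addrA !lerD2r mulrAC ler_wpM2r//.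
  by rewrite ler_pdivrMr//; lra.
have [k kK Bk] : exists2 k : nat, (k < K)%N & B (x + k%:Z).
  apply: contrapT => /forall2NP noB.
  have const k : (k <= K)%N -> S (x + k%:Z) = S x.
    elim: k => [_|k IH kK]; first by rewrite addr0.
    have -> : x + k.+1%:Z = x + k%:Z + 1 by lia.
    rewrite SB IH 1?ltnW//; have [//|/negP/negbTE ->] := noB k.
    by rewrite addr0.
  have := slope_incr x (x + K%:Z) hC; rewrite const//.
  have -> : (x + K%:Z)%:~R - x%:~R = K%:R :> R by rewrite intrD addrAC subrr add0r.
  rewrite subrr sub0r normrN normrM (ger0_norm (ltW p0)) (ger0_norm (ler0n _ _)).
  have : `|(x + K%:Z)%:~R : R| <= `|x%:~R| + K%:R.
    by rewrite intrD; apply: le_trans (ler_normD _ _) _; rewrite normr_nat.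
  move=> n2 n3; move: K1; rewrite ltr_pdivrMr// => K1.
  have n4 := ler_wpM2l (ltW e0) n2.
  have n5 := ler_wpM2r (ler0n R K) e1.
  by clear -n3 n4 n5 K1; lra.
exists (x + k%:Z) => //.
rewrite intrD addrAC subrr add0r normr_nat.
by apply: le_trans K3; rewrite ler_nat ltnW.
Qed.

Lemma near_visits P T Tinv (A : set Omega) : ergodic_automorphism P T Tinv ->
  measurable A -> (0 < P A)%E ->
  {ae P, forall w, @near_everywhere R (fun x => A (iterz T Tinv x w))}.
Proof.
move=> h mA PA; have bA := @bounded_meas_indic R _ _ _ mA.
apply: filterS (slope_cumul h bA) => w Sw.
have p0 : 0 < Ex P \1_A.
  rewrite Ex_indic// fine_gt0// PA /=.
  by apply: le_lt_trans (probability_le1 P mA) _; exact: ltry.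
have := near_everywhere_slope (B := fun x => iterz T Tinv x w \in A) p0 _ Sw.
have step x : cumul T Tinv \1_A w (x + 1) =
    cumul T Tinv \1_A w x + (iterz T Tinv x w \in A)%:R.
  by rewrite cumul_step indicE.
move=> /(_ step) near eps /near[C C0 hC]; exists C => // x.
by have [x0 Ax0 hx0] := hC x; exists x0 => //; rewrite -inE.
Qed.

End two_sided.

(** * Correctors from continued fractions *)

Section continued_fraction.
Context {R : realType} {X : Type}.
Implicit Types (S : X -> X) (b : X -> R).

(** Ratios of successive values of a solution of [g (x+1) + g (x-1) = b x * g x] obey
    [r = b - 1 / r'], with [r'] the neighbouring ratio. Started at 1, the iteration increases when
    [b >= 2], as its first step gives [b - 1 >= 1]. *)
Fixpoint cf S b (k : nat) (x : X) : R :=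
  if k is k'.+1 then b x - (cf S b k' (S x))^-1 else 1.

Lemma cfS S b k x : cf S b k.+1 x = b x - (cf S b k (S x))^-1.
Proof. by []. Qed.

Definition cflim S b x : R := lim (cf S b k x @[k --> \oo]).

Lemma cf_ge1 S b k x : (forall x, 2 <= b x) -> 1 <= cf S b k x.
Proof.
move=> b2; elim: k x => [|k IH] x //=.
have := b2 x; have : (cf S b k (S x))^-1 <= 1.
  by rewrite invf_le1// (lt_le_trans ltr01).
by lra.
Qed.

Lemma cf_homo S b k x : (forall x, 2 <= b x) -> cf S b k x <= cf S b k.+1 x.
Proof.
move=> b2; elim: k x => [|k IH] x; first exact: (@cf_ge1 S b 1 x).
rewrite (cfS S b k.+1 x) (cfS S b k x) lerD2l lerN2 lef_pV2 ?IH// posrE;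
  by rewrite (lt_le_trans ltr01)// cf_ge1.
Qed.

Lemma cf_le S b k x : (forall x, 2 <= b x) -> cf S b k x <= b x.
Proof.
move=> b2; case: k => [|k] /=; first by have := b2 x; lra.
have : 0 <= (cf S b k (S x))^-1 by rewrite invr_ge0 (le_trans ler01)// cf_ge1.
by lra.
Qed.

Lemma cf_cvg S b x : (forall x, 2 <= b x) -> cf S b k x @[k --> \oo] --> cflim S b x.
Proof.
move=> b2; apply: nondecreasing_is_cvgn.
  by apply/nondecreasing_seqP => k; exact: cf_homo.
by exists (b x) => _ [k _ <-]; exact: cf_le.
Qed.

Lemma cflim_ge S b x (l : R) : (forall x, 2 <= b x) -> (forall k, l <= cf S b k.+1 x) ->
  l <= cflim S b x.
Proof.
move=> b2 h; apply: limr_ge; first by apply/cvg_ex; exists (cflim S b x); exact: cf_cvg.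
by exists 1%N => // -[|k].
Qed.

Lemma cflim_le S b x (l : R) : (forall x, 2 <= b x) -> (forall k, cf S b k x <= l) ->
  cflim S b x <= l.
Proof.
move=> b2 h; apply: limr_le; first by apply/cvg_ex; exists (cflim S b x); exact: cf_cvg.
by near=> k.
Unshelve. all: by end_near. Qed.

Lemma cflim_ge1 S b x : (forall x, 2 <= b x) -> 1 <= cflim S b x.
Proof. by move=> b2; apply: cflim_ge => // k; exact: cf_ge1. Qed.

Lemma cflim_rec S b x : (forall x, 2 <= b x) ->
  cflim S b x = b x - (cflim S b (S x))^-1.
Proof.
move=> b2; have c1 : cf S b k.+1 x @[k --> \oo] --> cflim S b x.
  by have := @cf_cvg S b x b2; rewrite -(cvg_shiftS (fun k => cf S b k x)).
have c2 : cf S b k.+1 x @[k --> \oo] --> b x - (cflim S b (S x))^-1.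
  apply: cvgB; first exact: cvg_cst.
  apply: cvgV; last exact: cf_cvg.
  by rewrite gt_eqF// (lt_le_trans ltr01)// cflim_ge1.
exact: (cvg_unique _ c1 c2).
Qed.

Lemma cflim_lower S b x (l : R) : (forall x, 2 <= b x) -> l <= b x ->
  l - 1 <= cflim S b x.
Proof.
move=> b2 lb; rewrite cflim_rec//.
have : (cflim S b (S x))^-1 <= 1 by rewrite invf_le1 ?(lt_le_trans ltr01)// cflim_ge1.
by lra.
Qed.

(** The bound [p <= K] is preserved by passing from [p] to [b - 1 / p] when [b <= K + 1 / K]. *)
Lemma cflim_upper S b x (K : R) : (forall x, 2 <= b x) -> 1 <= K ->
  (forall x, b x <= K + K^-1) -> cflim S b x <= K.
Proof.
move=> b2 K1 bK; apply: cflim_le => // k; have K0 : 0 < K by lra.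
elim: k x => [|k IH] x //=.
have : K^-1 <= (cf S b k (S x))^-1.
  by rewrite lef_pV2 ?posrE// (lt_le_trans ltr01)// cf_ge1.
by have := bK x; lra.
Qed.

(** Inversion contracts by [1 / (l - 1)], since one of the two iterates is at least [l - 1] and the
    other at least 1. The bound is the solution [D] of [D = e + D / (l - 1)]. *)
Lemma cflim_dist S b b' (l e : R) x : 2 < l -> (forall x, l <= b x) ->
  (forall x, l <= b' x) -> (forall x, `|b x - b' x| <= e) ->
  `|cflim S b x - cflim S b' x| <= e / (1 - (l - 1)^-1).
Proof.
move=> l2 lb lb' bb.
have b2 y : 2 <= b y by apply: le_trans (lb y); exact: ltW.
have b2' y : 2 <= b' y by apply: le_trans (lb' y); exact: ltW.
have l0 : 0 < l - 1 by lra.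
have k1 : (l - 1)^-1 < 1 by rewrite invf_lt1//; lra.
have e0 : 0 <= e by apply: le_trans (normr_ge0 _) (bb x).
set D := e / _.
have D0 : 0 <= D by rewrite divr_ge0// subr_ge0 ltW.
have DE : D = e + D * (l - 1)^-1.
  by rewrite /D; field; rewrite !subr_eq0 !gt_eqF//; lra.
have key k y : `|cf S b k y - cf S b' k y| <= D.
  elim: k y => [|k IH] y /=; first by rewrite subrr normr0.
  rewrite DE.
  have -> : b y - (cf S b k (S y))^-1 - (b' y - (cf S b' k (S y))^-1) =
    (b y - b' y) + ((cf S b' k (S y))^-1 - (cf S b k (S y))^-1) by ring.
  apply: le_trans (ler_normD _ _) _; apply: lerD => //.
  (* The starting value 1 may lie below [l - 1], but there both iterates coincide. *)
  have := IH (S y); case: k {IH} => [|k] IHk.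
    by rewrite /= subrr normr0 mulr_ge0// invr_ge0 ltW.
  have c1 := @cf_ge1 S b k.+1 (S y) b2; have c1' := @cf_ge1 S b' k.+1 (S y) b2'.
  have cl : l - 1 <= cf S b k.+1 (S y).
    rewrite /=; have := lb (S y).
    have : (cf S b k (S (S y)))^-1 <= 1 by rewrite invf_le1 ?(lt_le_trans ltr01)// cf_ge1.
    by lra.
  move: (cf S b k.+1 (S y)) (cf S b' k.+1 (S y)) IHk c1 c1' cl => p q pq p1 q1 pl.
  have p0 : 0 < p by lra. have q0 : 0 < q by lra.
  have -> : q^-1 - p^-1 = (p - q) / (p * q) by field; rewrite !gt_eqF.
  rewrite normrM normfV (ger0_norm (x := p * q)) ?mulr_ge0 ?(ltW p0) ?(ltW q0)//.
  apply: ler_pM => //; first by rewrite invr_ge0 mulr_ge0// ltW.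
  rewrite lef_pV2 ?posrE ?mulr_gt0//; apply: le_trans pl _.
  by rewrite ler_peMr// ltW.
have cv : `|cf S b k x - cf S b' k x| @[k --> \oo] --> `|cflim S b x - cflim S b' x|.
  by apply: cvg_norm; apply: cvgB; exact: cf_cvg.
rewrite -(cvg_lim (@Rhausdorff R) cv); apply: limr_le.
  by apply/cvg_ex; eexists; exact: cv.
by near=> k.
Unshelve. all: by end_near. Qed.

End continued_fraction.

Section measurable_cf.
Context {R : realType} {d : measure_display} {Omega : measurableType d}.
Implicit Types (S : Omega -> Omega) (b : Omega -> R).

Lemma measurable_inv_pos (f : Omega -> R) : (forall w, 0 < f w) ->
  measurable_fun setT f -> measurable_fun setT (fun w => (f w)^-1).
Proof.
move=> f0 mf; rewrite (_ : (fun w => _) = fun w => expR (- ln (f w))).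
  apply: measurableT_comp; first exact: measurable_expR.
  apply: measurableT_comp => //.
  by apply: measurableT_comp mf; exact: measurable_ln.
by apply/funext => w; rewrite expRN lnK// posrE.
Qed.

Lemma measurable_cflim S b : measurable_fun setT S -> measurable_fun setT b ->
  (forall x, 2 <= b x) -> measurable_fun setT (cflim S b).
Proof.
move=> mS mb b2; apply: (@measurable_fun_cvg _ _ _ setT (cf S b)) => [k|x _]; last first.
  exact: cf_cvg.
elim: k => [|k IH]; first exact: measurable_cst.
apply: measurable_funB => //.
have mk : measurable_fun setT (cf S b k \o S) by exact: measurableT_comp.
apply: (measurable_inv_pos _ mk) => w /=.
by rewrite (lt_le_trans ltr01)// cf_ge1.
Qed.

End measurable_cf.

Section lyapunov.
Context {R : realType} {d : measure_display} {Omega : measurableType d}.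
Context (T Tinv : Omega -> Omega).

Lemma iterzS (x : int) w : cancel Tinv T ->
  iterz T Tinv (x + 1) w = T (iterz T Tinv x w).
Proof.
move=> K; case: x => [n|[|n]].
- by have -> : Posz n + 1 = n.+1 by lia.
- by rewrite /= K.
- have -> : Negz n.+1 + 1 = Negz n by lia.
  by rewrite /= K.
Qed.

Lemma iterzP (x : int) w : cancel T Tinv -> cancel Tinv T ->
  iterz T Tinv (x - 1) w = Tinv (iterz T Tinv x w).
Proof. by move=> K K'; rewrite -[in RHS](subrK 1 x) iterzS// K. Qed.

Lemma iterz_add (x : int) (n : nat) w : cancel Tinv T ->
  iterz T Tinv (x + n%:Z) w = iter n T (iterz T Tinv x w).
Proof.
move=> K; elim: n => [|n IH]; first by rewrite addr0.
by rewrite iterS -IH -iterzS//; congr iterz; lia.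
Qed.

End lyapunov.

Section rates.
Context {R : realType}.
Implicit Types (g h S : int -> R).

Lemma rate_expR S m : slope S m -> rate (fun x => expR (S x)) m.
Proof.
move=> sl eps /sl[C C0 hC]; exists C => // x; have := hC x.
by rewrite ler_norml !ler_expR => /andP[h1 h2]; apply/andP; split; lra.
Qed.

Lemma rate_inverse g h m a b : rate g m -> 0 < a -> 0 < b ->
  (forall x, 0 < h x) -> (forall x, a <= g x * h x <= b) -> rate h (- m).
Proof.
move=> rg a0 b0 h0 gh eps eps0; have [C C0 hC] := rg _ eps0.
exists (C + `|ln a| + `|ln b|) => [|x]; first by rewrite !addr_ge0.
have /andP[g1 g2] := hC x; have /andP[gh1 gh2] := gh x.
have aa : expR (- `|ln a|) <= a.
  by rewrite -[leRHS]lnK ?posrE// ler_expR lerNl -normrN ler_norm.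
have bb : b <= expR `|ln b| by rewrite -[leLHS]lnK ?posrE// ler_expR ler_norm.
have na := normr_ge0 (ln a); have nb := normr_ge0 (ln b).
apply/andP; split.
  have : expR (- `|ln a|) <= expR (m * x%:~R + (eps * `|x%:~R| + C)) * h x.
    apply: le_trans aa _; apply: le_trans gh1 _; by rewrite ler_pM2r.
  rewrite -ler_pdivrMl ?expR_gt0// -expRN -expRD; apply: le_trans.
  by rewrite ler_expR; lra.
have : expR (m * x%:~R - (eps * `|x%:~R| + C)) * h x <= expR `|ln b|.
  apply: le_trans bb; apply: le_trans gh2; by rewrite ler_pM2r.
rewrite -ler_pdivlMl ?expR_gt0// -expRN -expRD => /le_trans; apply.
by rewrite ler_expR; lra.
Qed.

Lemma int_const (D : int -> R) : (forall x, D (x + 1) = D x) -> forall x, D x = D 0.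
Proof.
move=> Dx; apply: (@int_center _ 0) => n.
  elim: n => [|n <-]; first by rewrite addr0.
  by rewrite -[RHS]Dx; congr D; lia.
elim: n => [|n <-]; rewrite -[LHS]Dx; first by congr D; lia.
by congr D; lia.
Qed.

End rates.

(** * Lyapunov exponents and their correctors *)

Section lyapunov_exponent.
Context {R : realType} {d : measure_display} {Omega : measurableType d}.
Context (P : probability Omega R) (T Tinv : Omega -> Omega) (V : Omega -> R) (beta : R).
Implicit Types (lam : R).

Definition coeff lam (w : Omega) : R := 2 * expR (lam - beta * V w).

(** The continued fraction that reads the environment to the left: evaluated at [T^x w] it is the
    ratio [gp (x + 1) / gp x] of the growing solution. *)
Definition growth lam : Omega -> R := cflim Tinv (coeff lam).

Definition lyapunov lam : R := Ex P (fun w => ln (growth lam w)).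

Context (hT : ergodic_automorphism P T Tinv) (mV : measurable_fun setT V).
Context (V01 : forall w, 0 <= V w <= 1) (beta_gt0 : 0 < beta).

Lemma bV w : 0 <= beta * V w <= beta.
Proof.
have /andP[v0 v1] := V01 w.
by rewrite mulr_ge0 ?(ltW beta_gt0)//= ler_piMr// ltW.
Qed.

Lemma coeff_le lam w : coeff lam w <= 2 * expR lam.
Proof. by rewrite ler_pM2l// ler_expR; have /andP[h _] := bV w; lra. Qed.

Lemma coeff_ge lam w : 2 * expR (lam - beta) <= coeff lam w.
Proof. by rewrite ler_pM2l// ler_expR; have /andP[_ h] := bV w; lra. Qed.

Lemma low_gt2 lam : beta < lam -> 2 < 2 * expR (lam - beta).
Proof. by move=> bl; rewrite ltr_pMr// expR_gt1 subr_gt0. Qed.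

Lemma coeff_ge2 lam : beta < lam -> forall w, 2 <= coeff lam w.
Proof.
by move=> bl w; apply: le_trans (coeff_ge lam w); rewrite ltW// low_gt2.
Qed.

Lemma measurable_coeff lam : measurable_fun setT (coeff lam).
Proof.
apply: measurable_funM => //; apply: measurableT_comp; first exact: measurable_expR.
by apply: measurable_funB => //; exact: measurable_funM.
Qed.

Lemma growth_ge1 lam w : beta < lam -> 1 <= growth lam w.
Proof. by move=> bl; apply: cflim_ge1; exact: coeff_ge2. Qed.

Lemma growth_le lam w : beta < lam -> growth lam w <= 2 * expR lam.
Proof.
move=> bl; apply: cflim_le => [|k]; first exact: coeff_ge2.
by apply: le_trans (coeff_le lam w); apply: cf_le; exact: coeff_ge2.
Qed.

Lemma bounded_ln_growth lam : beta < lam -> bounded_meas (fun w => ln (growth lam w)).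
Proof.
move=> bl; split.
  apply: measurableT_comp; first exact: measurable_ln.
  apply: measurable_cflim; [exact: ea_measurable_inv hT|exact: measurable_coeff|].
  exact: coeff_ge2.
exists (2 * expR lam) => w; have g1 := growth_ge1 w bl.
rewrite ger0_norm ?ln_ge0//; apply: le_trans (growth_le w bl).
by apply: ltW; apply: ln_sublinear; exact: lt_le_trans g1.
Qed.

(** The growing solution is determined by the past of the environment, the decaying one by its
    future. The ergodic theorem gives the slope of the former; that of the latter is deduced from
    it. *)
Lemma ae_corr lam : beta < lam -> {ae P, forall w, corr (environment T Tinv V beta w) lam (lyapunov lam)}.
Proof.
move=> bl; have b2 := coeff_ge2 bl.
have TK := ea_TK hT; have TinvK := ea_TinvK hT.
apply: filterS (slope_cumul hT (bounded_ln_growth bl)) => w Sw.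
pose q := cflim T (coeff lam).
pose k := 2 * expR (lam - beta) - 1.
have k1 : 1 < k by have := low_gt2 bl; rewrite /k; lra.
have k0 : 0 < k by lra.
have r_ge w' : k <= growth lam w' by apply: cflim_lower => //; exact: coeff_ge.
have q_ge w' : k <= q w' by apply: cflim_lower => //; exact: coeff_ge.
have r_gt0 w' : 0 < growth lam w' by exact: lt_le_trans (r_ge w').
have q_gt0 w' : 0 < q w' by exact: lt_le_trans (q_ge w').
have r_rec w' : growth lam w' = coeff lam w' - (growth lam (Tinv w'))^-1.
  exact: cflim_rec.
have q_rec w' : q w' = coeff lam w' - (q (T w'))^-1 by exact: cflim_rec.
pose gp x := expR (cumul T Tinv (fun w => ln (growth lam w)) w x).
pose gm x := expR (- cumul T Tinv (fun w => ln (q (T w))) w x).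
have gpS x : gp (x + 1) = gp x * growth lam (iterz T Tinv x w).
  by rewrite /gp cumul_step expRD lnK// posrE.
have gmS x : gm x = gm (x + 1) * q (iterz T Tinv (x + 1) w).
  have -> : q (iterz T Tinv (x + 1) w) = expR (ln (q (T (iterz T Tinv x w)))).
    by rewrite iterzS// lnK// posrE.
  by rewrite /gm cumul_step -expRD; congr expR; ring.
have gp0 x : 0 < gp x by exact: expR_gt0.
have gm0 x : 0 < gm x by exact: expR_gt0.
have solp : solves (environment T Tinv V beta w) lam gp.
  move=> x; have := gpS (x - 1); rewrite subrK iterzP// => gx.
  rewrite gpS -[environment T Tinv V beta w x]/(beta * V _) -/(coeff lam _) r_rec.
  rewrite [in LHS]gx [in RHS]gx; field.
  by rewrite gt_eqF.
have solm : solves (environment T Tinv V beta w) lam gm.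
  move=> x; have gx := gmS x; have := gmS (x - 1); rewrite subrK => ->.
  rewrite -[environment T Tinv V beta w x]/(beta * V _) -/(coeff lam _).
  have := q_rec (iterz T Tinv x w); rewrite -iterzS// => qq.
  rewrite qq [in LHS]gx [in RHS]gx; field.
  by rewrite gt_eqF.
have upper K : 1 <= K -> 2 * expR lam <= K + K^-1 ->
    forall w', growth lam w' <= K /\ q w' <= K.
  by move=> K1 hK w'; split; apply: cflim_upper => // w''; exact: le_trans (coeff_le _ _) hK.
(* The Wronskian is constant and comparable to [gp * gm]. This pins the product between positive
   constants and forces slope [- m] on [gm], without comparing the means of the two logarithmic
   ratios. *)
pose D x := gp (x + 1) * gm x - gp x * gm (x + 1).
have Dc x : D x = D 0.
  apply: int_const => {}x; rewrite /D.
  have := solp (x + 1); have := solm (x + 1); rewrite addrK.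
  move: (2 * _) => a h1 h2.
  have -> : gp (x + 1 + 1) = a * gp (x + 1) - gp x by rewrite -h2; ring.
  have -> : gm (x + 1 + 1) = a * gm (x + 1) - gm x by rewrite -h1; ring.
  ring.
have gg x : 0 <= gp x * gm x by rewrite mulr_ge0 ?expR_ge0.
have kk : 0 < k - k^-1 by rewrite subr_gt0 (lt_trans _ k1)// invf_lt1.
have L0 : 0 < 2 * expR lam by rewrite mulr_gt0// expR_gt0.
have Dlow x : (k - k^-1) * (gp x * gm x) <= D x.
  rewrite /D gpS [X in _ - _ * X](_ : _ = gm x / q (iterz T Tinv (x + 1) w)); last first.
    by rewrite [gm x]gmS mulfK// gt_eqF.
  have -> : gp x * growth lam (iterz T Tinv x w) * gm x -
      gp x * (gm x / q (iterz T Tinv (x + 1) w)) =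
    (growth lam (iterz T Tinv x w) - (q (iterz T Tinv (x + 1) w))^-1) * (gp x * gm x).
    by field; rewrite gt_eqF.
  rewrite ler_wpM2r//.
  by rewrite lerD// lerN2 lef_pV2 ?posrE.
have Dup x : D x <= 2 * expR lam * (gp x * gm x).
  rewrite /D gpS; apply: le_trans (_ : gp x * growth lam (iterz T Tinv x w) * gm x <= _).
    by rewrite gerDl oppr_le0 mulr_ge0 ?expR_ge0.
  rewrite mulrAC mulrC ler_wpM2r//.
  exact: growth_le.
have D0 : 0 < D 0 by apply: lt_le_trans (Dlow 0); rewrite !mulr_gt0.
exists gp, gm, k; split => //.
- exact: rate_expR Sw.
- apply: (@rate_inverse _ gp gm _ (D 0 / (2 * expR lam)) (D 0 / (k - k^-1))) => //.
  + exact: rate_expR Sw.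
  + by rewrite divr_gt0.
  + by rewrite divr_gt0.
  + move=> x; rewrite ler_pdivrMr// ler_pdivlMr// -(Dc x).
    by rewrite mulrC Dup mulrC Dlow.
- move=> x; rewrite gpS [gm x]gmS mulrC; split.
    by rewrite ler_pM2l.
  by rewrite [leLHS]mulrC ler_pM2l.
- move=> K K1 hK x; rewrite gpS [gm x]gmS; have [h1 _] := upper K K1 hK (iterz T Tinv x w).
  have [_ h2] := upper K K1 hK (iterz T Tinv (x + 1) w).
  split; first by rewrite mulrC ler_pM2r.
  by rewrite mulrC ler_pM2r.
Qed.

(** With [t = expR (lam - beta) >= 1] the growth ratio is at least [2 t - 1 >= t]. The bound makes
    the exponents unbounded and, above [beta], positive. *)
Lemma lyapunov_ge lam : beta < lam -> lam - beta <= lyapunov lam.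
Proof.
move=> bl; rewrite -(Ex_cst P (lam - beta)); apply: Ex_le.
- exact: bounded_meas_cst.
- exact: bounded_ln_growth.
- move=> w; rewrite -[leLHS]expRK ler_ln ?posrE ?expR_gt0//; last first.
    by rewrite (lt_le_trans ltr01)// growth_ge1.
  have : 2 * expR (lam - beta) - 1 <= growth lam w.
    by apply: cflim_lower; [exact: coeff_ge2|exact: coeff_ge].
  have : 1 <= expR (lam - beta) by rewrite -expR0 ler_expR; lra.
  by lra.
Qed.

Lemma ln_dist (p q : R) : 1 <= p -> 1 <= q -> `|ln p - ln q| <= `|p - q|.
Proof.
wlog pq : p q / q <= p => [hw p1 q1|p1 q1].
  have [/hw|/ltW /hw h] := leP q p; first exact.
  by rewrite distrC [leRHS]distrC; exact: h.
have q0 : 0 < q by lra. have p0 : 0 < p by lra.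
rewrite ger0_norm ?subr_ge0 ?ler_ln ?posrE// ger0_norm ?subr_ge0//.
rewrite -ln_div ?posrE//.
have -> : p / q = 1 + (p - q) / q by field; rewrite gt_eqF.
apply: le_trans (le_ln1Dx _) _.
  by rewrite (lt_le_trans (ltrN10 R))// divr_ge0 ?subr_ge0// ltW.
by rewrite ler_pdivrMr// ler_peMr// subr_ge0.
Qed.

Lemma lyapunov_dist l0 lam lam' : beta < l0 -> l0 <= lam -> l0 <= lam' ->
  `|lyapunov lam - lyapunov lam'| <=
  2 * `|expR lam - expR lam'| / (1 - (2 * expR (l0 - beta) - 1)^-1).
Proof.
move=> bl h1 h2; have bl1 := lt_le_trans bl h1; have bl2 := lt_le_trans bl h2.
have bf := bounded_ln_growth bl1; have bf' := bounded_ln_growth bl2.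
set B := (X in _ <= X).
have ptw w : `|ln (growth lam w) - ln (growth lam' w)| <= B.
  apply: le_trans (ln_dist (growth_ge1 w bl1) (growth_ge1 w bl2)) _.
  apply: cflim_dist; first exact: low_gt2.
  - by move=> w'; apply: le_trans (coeff_ge _ _); rewrite ler_pM2l// ler_expR; lra.
  - by move=> w'; apply: le_trans (coeff_ge _ _); rewrite ler_pM2l// ler_expR; lra.
  - move=> w'; rewrite /coeff -mulrBr normrM ger0_norm// ler_pM2l//.
    rewrite !expRD -mulrBl normrM ler_piMr// ger0_norm ?expR_ge0//.
    by rewrite expR_le1 oppr_le0; have /andP[] := bV w'.
rewrite /lyapunov -ExB// ler_norml.
have bb := bounded_measD bf (bounded_measN bf').
apply/andP; split.
  rewrite -(Ex_cst P (- B)); apply: Ex_le => //; first exact: bounded_meas_cst.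
  by move=> w; have := ptw w; rewrite ler_norml => /andP[].
rewrite -(Ex_cst P B); apply: Ex_le => //; first exact: bounded_meas_cst.
by move=> w; have := ptw w; rewrite ler_norml => /andP[].
Qed.

Lemma lyapunov_onto l0 (s : R) : beta < l0 -> lyapunov l0 < s ->
  exists2 lam, beta < lam & lyapunov lam = s.
Proof.
move=> bl ls.
have lb : l0 <= s + beta by have := lyapunov_ge bl; lra.
(* At [s + beta] the linear lower bound already gives an exponent at least [s]. *)
have mid : Num.min (lyapunov l0) (lyapunov (s + beta)) <= s <=
    Num.max (lyapunov l0) (lyapunov (s + beta)).
  have vs : lyapunov (s + beta) >= s.
    have bs : beta < s + beta by exact: lt_le_trans lb.
    by have := lyapunov_ge bs; rewrite addrK.
  move: ls vs; move: (lyapunov l0) (lyapunov (s + beta)) => a b ls vs.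
  by rewrite ge_min (ltW ls) /= le_max vs orbT.
(* Above a level strictly between [beta] and [l0] the contraction constant is uniform, which yields
   continuity at the left end [l0] too. *)
pose l1 := (beta + l0) / 2.
have bl1 : beta < l1 by rewrite /l1; lra.
have l10 : l1 < l0 by rewrite /l1; lra.
have cont : {within `[l0, s + beta], continuous lyapunov}.
  apply: continuous_in_subspaceT => x; rewrite inE /= in_itv /= => /andP[x0 _].
  have xl : l1 < x by exact: lt_le_trans x0.
  set c := (1 - (2 * expR (l1 - beta) - 1)^-1).
  have c0 : 0 < c.
    by have h := low_gt2 bl1; rewrite subr_gt0 invf_lt1//; lra.
  apply/cvgrPdist_le => e e0.
  have ec : 0 < e * c / 2 by rewrite divr_gt0// mulr_gt0.
  have := @continuous_expR R x; move/cvgrPdist_le => /(_ _ ec) near1.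
  near=> y.
  apply: le_trans (@lyapunov_dist l1 x y bl1 (ltW xl) _) _.
    by apply/ltW; near: y; exact: lt_nbhsr.
  rewrite -/c ler_pdivrMr// mulrC -ler_pdivlMr//.
  by near: y.
have [c] := IVT lb cont mid.
rewrite in_itv /= => /andP[c1 _] cs; exists c => //; exact: lt_le_trans c1.
Unshelve. all: by end_near. Qed.

End lyapunov_exponent.

(** * Case analysis for a typical environment *)

Section case_analysis.
Context {R : realType}.
Implicit Types (delta beta c H theta lam m s L : R) (V : int -> R).

Definition UBLB delta V theta H := UB delta V theta H /\ LB delta V theta H.

(** A pathwise form of [L = Lambda s]. In the flat alternative only correctors for [lam] decreasing
    to [beta] are provided, all with exponent at least [|s|]. *)
Definition linear_exponent beta V s L :=
  (L = beta /\ forall k : nat, exists2 m, corr V (beta + k.+1%:R^-1) m & `|s| <= m) \/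
  (beta < L /\ corr V L `|s|).

Lemma UBLB_refl delta V theta H :
  UBLB delta (refl V) (- theta) H -> UBLB delta V theta H.
Proof. by move=> [u l]; split; [exact: UB_refl|exact: LB_refl]. Qed.

Lemma linear_exponent_refl beta V s L :
  linear_exponent beta V s L -> linear_exponent beta (refl V) s L.
Proof.
move=> [[-> h]|[bL h]]; [left|right]; split => //.
  by move=> k; have [m hm sm] := h k; exists m => //; exact: corr_refl.
exact: corr_refl.
Qed.

Lemma linear_UB beta V s L : linear_exponent beta V s L -> UB 0 V s L.
Proof.
move=> [[-> h]|[_ h]]; last exact: (UB_corr h).
apply: UB_limit => e e0; have [m hm sm] := h (Num.truncn e^-1).
apply: UB_le (UB_corr hm sm).
rewrite lerD2l -[leRHS]invrK lef_pV2 ?posrE ?invr_gt0//.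
by rewrite ltW// truncnS_gt.
Qed.

Lemma linear_UBLB beta V s L : (forall x, 0 <= V x) -> high V beta ->
  linear_exponent beta V s L -> UBLB 0 V s L.
Proof.
move=> V0 hi h; split; first exact: linear_UB h.
have stay : LB 0 V s beta.
  by have := LB_stay s (lexx 0) (lexx 0) control0 V0 hi; rewrite cosh0 ln1 subr0.
case: h => [[-> //]|[_ h]].
have grow W : corr W L `|s| -> LB 0 W `|s| L.
  move=> hW; have := LB_grow (lexx 0) (lexx 0) control0 hW.
  by rewrite cosh0 ln1 subr0 add0r.
have [s0|s0] := lerP 0 s; first by have := grow V h; rewrite ger0_norm.
apply: LB_refl; rewrite -(ltr0_norm s0); apply: grow; exact: corr_refl.
Qed.

Definition good_env beta V :=
  [/\ forall x, 0 <= V x <= beta, high V beta & low V].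

Lemma good_refl beta V : good_env beta V -> good_env beta (refl V).
Proof.
by move=> [Vb hi lo]; split; [move=> x; exact: Vb|exact: high_refl|exact: low_refl].
Qed.

Lemma weak_pos delta beta c V theta L 
    (d0 : 0 < delta) (c0 : 0 < c) (dc : control delta c) : good_env beta V -> 0 <= theta ->
  linear_exponent beta V (theta - c) L -> ln (cosh c) <= beta ->
  UBLB delta V theta (if theta < c then beta - ln (cosh c) else L - ln (cosh c)).
Proof.
have d1 : 0 <= delta <= 1 by rewrite (ltW d0) ltW// (control_le1 dc).
move=> [Vb hi lo] t0 lin lcb; have d0' := ltW d0; have c0' := ltW c0.
have V0 x : 0 <= V x by have /andP[] := Vb x.
have stay : LB delta V theta (beta - ln (cosh c)) by exact: LB_stay.
case: ltP => tc; split => //.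
- have := @UB_trap R delta beta c V theta d1 c0 dc _ lo.
  rewrite max_l//; apply; first by move=> x; have /andP[] := Vb x.
  by rewrite ger0_norm// ltW.
- exact: UB_tilt d1 dc (linear_UB lin).
- case: lin => [[-> //]|[_ h]].
  have := LB_grow d0' c0' dc h.
  by rewrite ger0_norm ?subr_ge0// addrC subrK.
Qed.

(** [m0] is the exponent at [log cosh c], so the flat piece ends at [c - m0]. Between this edge and
    [c] the subsolution comes from the decaying solution, beyond [c] from the growing one. *)
Lemma strong_pos delta beta c V theta L m0 
    (d0 : 0 < delta) (c0 : 0 < c) (dc : control delta c) : good_env beta V -> 0 <= theta ->
  linear_exponent beta V (theta - c) L -> beta < ln (cosh c) ->
  corr V (ln (cosh c)) m0 -> 0 <= m0 ->
  UBLB delta V theta (if theta < c - m0 then 0 else L - ln (cosh c)).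
Proof.
have d1 : 0 <= delta <= 1 by rewrite (ltW d0) ltW// (control_le1 dc).
move=> [Vb hi lo] t0 lin lcb h0 m00; have d0' := ltW d0; have c0' := ltW c0.
have V0 x : 0 <= V x by have /andP[] := Vb x.
have elc : expR (ln (cosh c)) = cosh c by rewrite lnK// posrE cosh_gt0.
have stay : LB delta V theta (beta - ln (cosh c)) by exact: LB_stay.
case: ltP => tc; split.
- have := @UB_trap R delta beta c V theta d1 c0 dc _ lo.
  rewrite max_r ?(ltW lcb)// subrr; apply; first by move=> x; have /andP[] := Vb x.
  by rewrite ger0_norm//; lra.
- apply: (LB_peak d0' c0' dc _ elc h0); last by rewrite ger0_norm// ltW.
  by move=> x; have /andP[v0 v1] := Vb x; rewrite v0 (le_trans v1)// ltW.
- exact: UB_tilt d1 dc (linear_UB lin).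
- have [_ lbl] := linear_UBLB V0 hi lin.
  case: lin => [[-> //]|[_ h]].
  have [ct|ct] := leP c theta.
    have := LB_grow d0' c0' dc h.
    by rewrite ger0_norm ?subr_ge0// addrC subrK.
  have := LB_decay d0' c0' dc _ h.
  rewrite ltr0_norm ?subr_lt0// opprB opprB addrC subrK; apply.
  rewrite -elc ler_expR.
  (* For the free walk at slope [theta - c], [L] is a lower bound and [log cosh c] an upper bound,
     as [|theta - c| <= m0]; so [L <= log cosh c], which is what makes the tilted decaying solution
     increase. *)
  apply: (UB_LB_le lbl); apply: (UB_corr h0).
  by rewrite ltr0_norm ?subr_lt0//; lra.
Qed.

Lemma UBLB_norm delta V theta H :
  (0 <= theta -> UBLB delta V `|theta| H) ->
  (theta < 0 -> UBLB delta (refl V) `|theta| H) -> UBLB delta V theta H.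
Proof.
move=> h1 h2; have [t0|t0] := lerP 0 theta.
  by have := h1 t0; rewrite ger0_norm.
by apply: UBLB_refl; rewrite -ltr0_norm//; exact: h2.
Qed.

Definition full_exponent s theta : R :=
  if `|theta| < s then 0 else s - `|theta|.

Lemma cumulative_refl beta V S s : cumulative beta V S s ->
  cumulative beta (refl V) (fun x => - S (- x + 1)) s.
Proof.
move=> h; have Vb := cumul_V h; have SV := cumul_S h; split.
- by move=> x; exact: Vb.
- move=> x; have -> : - (x + 1) + 1 = - x by lia.
  by rewrite SV /refl; ring.
- apply: (@slope_refl _ _ _ beta (cumul_slope h)) => x.
  by rewrite SV addrAC subrr add0r ger0_norm; have /andP[] := Vb x.
Qed.

Lemma full_UBLB beta V S s theta : cumulative beta V S s -> low V -> 0 <= s ->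
  UBLB 1 V theta (full_exponent s theta).
Proof.
have pos W Z t : cumulative beta W Z s -> low W -> 0 <= t ->
    UBLB 1 W t (if t < s then 0 else s - t).
  move=> h lo t0; case: ltP => ts.
    by split; [apply: (UB_full h lo)|apply: (LB_full h)]; rewrite ger0_norm// ltW.
  by split; [exact: (UB_ballistic h)|exact: (LB_ballistic h)].
move=> h lo s0; apply: UBLB_norm => _; apply: pos => //.
- exact: h.
- exact: cumulative_refl h.
- exact: low_refl.
Qed.

End case_analysis.

(** * Rescaling to a locally uniform limit *)

Section uniform_limit.
Context {R : realType}.

Lemma uniform_limit (U : nat -> int -> R) (H theta : R) (K : set (R * R)) :
  (forall eps, 0 < eps -> exists C, forall n x,
     `|U n x - (n%:R * H + theta * x%:~R)| <= err eps C n x) ->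
  compact K -> K `<=` [set tx | 0 <= tx.1] ->
  {uniform K, (fun (eps : R) (tx : R * R) =>
       eps * U (Num.truncn (eps^-1 * tx.1)) (Num.floor (eps^-1 * tx.2))) eps
     @[eps --> 0^'+] --> (fun tx : R * R => tx.1 * H + theta * tx.2)}.
Proof.
move=> hU cK K0; have [M0 [_ hM0]] := compact_bounded cK.
pose M := `|M0| + 1.
have M0' : 0 < M by rewrite ltr_wpDl.
have hM tx : K tx -> `|tx.1| <= M /\ `|tx.2| <= M.
  move=> Ktx; have : `|tx| <= M by apply: hM0 => //; rewrite /M ltr_pwDr// ler_norm.
  by rewrite prod_normE ge_max => /andP.
move=> A /uniform_nbhs[E [entE EA]].
move: entE; rewrite -entourage_ballE => -[eta /= eta0 hE].
have M4 : 0 < 4 * (M + 1) by rewrite mulr_gt0// addr_gt0.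
(* On the compact set [e * (n + |y|)] is at most [2 * (M + 1)], so this choice costs [eta / 2]. *)
have ee0 : 0 < eta / (4 * (M + 1)) by rewrite divr_gt0.
have [C hC] := hU _ ee0.
(* Collects what is multiplied by the scale itself: the constant [C] and the rounding errors in time
   and space. *)
pose B := `|H| + `|theta| + `|C| + 1.
have B0 : 0 < B by rewrite ltr_wpDl// !addr_ge0.
have near_e : \forall e \near 0^'+, 0 < e /\ (e < 1 /\ e < eta / (4 * B)).
  near=> e; split; [by near: e; exact: nbhs_right_gt|split].
    by near: e; exact: nbhs_right_lt.
  by near: e; apply: nbhs_right_lt; rewrite divr_gt0// mulr_gt0.
apply: filterS near_e => e [e0 [e1 eB]].
apply: EA => -[t x] Ktx; apply: hE => /=.
have [tM xM] := hM _ Ktx; have t0 := K0 _ Ktx; rewrite /= in tM xM t0.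
set n := Num.truncn _; set y := Num.floor _.
rewrite -ball_normE /= distrC.
have ei0 : 0 < e^-1 by rewrite invr_gt0.
have n1 : e * n%:R <= t.
  by rewrite -ler_pdivlMl// truncn_le// mulr_ge0// ltW.
have n2 : t <= e * n%:R + e.
  rewrite -{2}[e]mulr1 -mulrDr -ler_pdivrMl// natr1 ltW//; exact: truncnS_gt.
have y1 : e * y%:~R <= x by rewrite -ler_pdivlMl// floor_le.
have y2 : x <= e * y%:~R + e.
  rewrite -{2}[e]mulr1 -mulrDr -ler_pdivrMl// ltW//.
  by have := floorD1_gt (e^-1 * x); rewrite intrD.
have h := hC n y.
have en : e * (n%:R + `|y%:~R|) <= 2 * (M + 1).
  have : `|e * y%:~R| <= M + 1.
    move: xM; rewrite !ler_norml => /andP[x1 x2]; apply/andP; split; lra.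
  rewrite normrM (gtr0_norm e0) => ey.
  have tM' := le_trans (ler_norm t) tM.
  by rewrite mulrDr; lra.
have step1 : `|e * U n y - e * (n%:R * H + theta * y%:~R)| <= eta / 2 + e * `|C|.
  rewrite -mulrBr normrM (gtr0_norm e0).
  apply: le_trans (ler_wpM2l (ltW e0) h) _; rewrite /err mulrDr; apply: lerD.
    rewrite mulrCA; apply: le_trans (ler_wpM2l (ltW ee0) en) _.
    rewrite le_eqVlt; apply/orP; left; apply/eqP; field.
    by rewrite gt_eqF// addr_gt0.
  by rewrite ler_pM2l// ler_norm.
have step2 : `|e * (n%:R * H + theta * y%:~R) - (t * H + theta * x)| <= e * (`|H| + `|theta|).
  have -> : e * (n%:R * H + theta * y%:~R) - (t * H + theta * x) =
    (e * n%:R - t) * H + theta * (e * y%:~R - x) by ring.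
  apply: le_trans (ler_normD _ _) _; rewrite !normrM mulrDr; apply: lerD.
    by apply: ler_wpM2r => //; rewrite ler_norml; apply/andP; split; lra.
  rewrite [leRHS]mulrC; apply: ler_wpM2l => //.
  by rewrite ler_norml; apply/andP; split; lra.
have -> : e * U n y - (t * H + theta * x) =
  (e * U n y - e * (n%:R * H + theta * y%:~R)) +
  (e * (n%:R * H + theta * y%:~R) - (t * H + theta * x)) by ring.
apply: le_lt_trans (ler_normD _ _) _; apply: le_lt_trans (lerD step1 step2) _.
have : e * B <= eta / 4.
  move: eB; rewrite ltr_pdivlMr ?mulr_gt0//; lra.
rewrite /B; lra.
Unshelve. all: by end_near. Qed.

Lemma UBLB_dist (delta : R) V theta H : 0 <= delta <= 1 -> UBLB delta V theta H ->
  forall eps, 0 < eps -> exists C, forall n x,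
    `|ln (value delta V theta n x) - (n%:R * H + theta * x%:~R)| <= err eps C n x.
Proof.
move=> d [ub lb] eps eps0; have [C1 h1] := ub _ eps0; have [C2 h2] := lb _ eps0.
exists (`|C1| + `|C2|) => n x.
have := h1 n x; have := h2 n x; have v0 := value_gt0 V theta n x d.
rewrite -[X in X <= expR _](lnK (v0 : _ \is Num.pos)) -[X in _ <= X -> _](lnK (v0 : _ \is Num.pos)) !ler_expR.
have := ler_norm C1; have := ler_norm C2.
have := normr_ge0 C1; have := normr_ge0 C2; rewrite /err => ? ? ? ? ? ?.
by rewrite ler_norml; apply/andP; split; lra.
Qed.

End uniform_limit.

(** * Almost sure conclusions *)

Opaque lyapunov.

Lemma near_everywhere_shift {R : realType} (B B' : int -> Prop) (l : nat) :
  (forall x, B x -> B' (x + l%:Z)) -> @near_everywhere R B -> @near_everywhere R B'.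
Proof.
move=> BB near eps /near[C C0 hC]; exists (C + l%:R) => [|x]; first by rewrite addr_ge0.
have [x0 Bx0 hx0] := hC x; exists (x0 + l%:Z); first exact: BB.
rewrite intrD addrAC; apply: le_trans (ler_normD _ _) _.
by rewrite addrA lerD// normr_nat.
Qed.

Lemma near_everywhereS {R : realType} (B B' : int -> Prop) :
  (forall x, B x -> B' x) -> @near_everywhere R B -> @near_everywhere R B'.
Proof.
move=> BB near eps /near[C C0 hC]; exists C => // x.
by have [x0 /BB Bx0 hx0] := hC x; exists x0.
Qed.

(** The assumptions speak of windows that start at the origin, the constructions of centred ones; a
    shift by [l] relates them. The length [l.*2.+1] is positive even for [l = 0], as the assumptions
    require. *)
Lemma int_window (l : nat) (k : int) : `|k| <= l%:Z ->
  exists2 n : nat, l%:Z + k = n%:Z & (n <= l.*2.+1)%N.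
Proof. by move=> kl; exists (absz (l%:Z + k)); lia. Qed.

Lemma measurable_ge_half_line {R : realType} (a : R) : measurable [set x | a <= x].
Proof.
rewrite (_ : [set x | _] = [set` `[a, +oo[]); first exact: measurable_itv.
by apply/seteqP; split => x /=; rewrite in_itv /= andbT.
Qed.

Section almost_sure.
Context {R : realType} {d : measure_display} {Omega : measurableType d}.
Context (P : probability Omega R) (T Tinv : Omega -> Omega) (V : Omega -> R) (beta : R).
Context (hT : ergodic_automorphism P T Tinv) (mV : measurable_fun setT V).
Context (V01 : forall w, 0 <= V w <= 1) (beta_gt0 : 0 < beta).

Notation env := (environment T Tinv V beta).
Notation lyap := (lyapunov P Tinv V beta).
Notation Lam := (Lambda P T Tinv V beta).

Lemma ae_exists (Q : Omega -> Prop) : {ae P, forall w, Q w} -> exists w, Q w.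
Proof.
move=> [A [mA PA QA]]; apply: contrapT => /forallNP noQ.
have AT : A = setT by apply/seteqP; split => // w _; apply: QA; exact: noQ.
have := probability_setT P; rewrite -AT PA => /eqP.
by rewrite eq_sym onee_eq0.
Qed.

Lemma measurable_window (Q : set R) (l : nat) : measurable Q ->
  measurable [set w | forall y : nat, (y <= l)%N -> Q (V (iterz T Tinv y%:Z w))].
Proof.
move=> mQ; rewrite (_ : [set w | _] = \bigcap_(y in [set y | (y <= l)%N])
    [set w | Q (V (iterz T Tinv y%:Z w))]); last by [].
apply: bigcap_measurable => [|y _]; first by exists 0%N.
have miter : measurable_fun setT (iter y T).
  elim: y => [|y IH]; first exact: measurable_id.
  rewrite (_ : iter y.+1 T = T \o iter y T)//.
  exact: measurableT_comp (ea_measurable hT) IH.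
have mVi : measurable_fun setT (V \o iter y T) by exact: measurableT_comp.
by rewrite -[X in measurable X]setTI; exact: mVi.
Qed.

Lemma ae_near_window (Q : set R) : measurable Q ->
  (forall l : nat, (0 < P [set w | forall y : nat, (y <= l.*2.+1)%N ->
     Q (V (iterz T Tinv y%:Z w))])%E) ->
  {ae P, forall w, forall l : nat, @near_everywhere R (fun x0 => forall k : int,
     `|k| <= l%:Z -> Q (V (iterz T Tinv (x0 + k) w)))}.
Proof.
move=> mQ PQ; apply: ae_foralln => l.
pose A := [set w | forall y : nat, (y <= l.*2.+1)%N -> Q (V (iterz T Tinv y%:Z w))].
have mA : measurable A by exact: measurable_window.
apply: filterS (near_visits hT mA (PQ l)) => w; apply: (near_everywhere_shift (l := l)) => x Ax k kl.
have [n nk n2] := int_window kl.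
rewrite -addrA nk iterz_add; last exact: ea_TinvK hT.
exact: Ax n n2.
Qed.

Lemma ae_low :
  (forall (h : R) (l : nat), 0 < h < 1 -> (0 < l)%N ->
     (0 < P [set w | forall y : nat, (y <= l)%N -> V (iterz T Tinv y%:Z w) <= h]%R)%E) ->
  {ae P, forall w, low (env w)}.
Proof.
move=> hlow.
have key i : {ae P, forall w, forall l : nat, @near_everywhere R (fun x0 => forall k : int,
     `|k| <= l%:Z -> V (iterz T Tinv (x0 + k) w) <= i.+2%:R^-1)}.
  have h01 : 0 < (i.+2%:R : R)^-1 < 1 by rewrite invr_gt0 ltr0n invf_lt1// ltr1n.
  apply: (@ae_near_window [set x | x <= i.+2%:R^-1]).
    rewrite (_ : [set x | _] = [set` `]-oo, i.+2%:R^-1]]); first exact: measurable_itv.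
    by apply/seteqP; split => x /=; rewrite in_itv.
  by move=> l; exact: hlow.
apply: filterS (ae_foralln key) => w hw h l h0.
pose i := Num.truncn (beta / h).
apply: near_everywhereS (hw i l) => x hx k kl.
have hb : beta / h < i.+1%:R by rewrite truncnS_gt.
rewrite /environment; apply: le_trans (ler_wpM2l (ltW beta_gt0) (hx k kl)) _.
rewrite ler_pdivrMr// -ler_pdivrMl// mulrC; apply: le_trans (ltW hb) _.
by rewrite ler_nat.
Qed.

Lemma ae_high :
  (forall (h : R) (l : nat), 0 < h < 1 -> (0 < l)%N ->
     (0 < P [set w | forall y : nat, (y <= l)%N -> h <= V (iterz T Tinv y%:Z w)]%R)%E) ->
  {ae P, forall w, high (env w) beta}.
Proof.
move=> hhigh.
have key i : {ae P, forall w, forall l : nat, @near_everywhere R (fun x0 => forall k : int,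
     `|k| <= l%:Z -> 1 - i.+2%:R^-1 <= V (iterz T Tinv (x0 + k) w))}.
  have h01 : 0 < 1 - (i.+2%:R : R)^-1 < 1.
    by rewrite subr_gt0 invf_lt1 ?ltr1n//= gtrBl invr_gt0 ltr0n.
  apply: (@ae_near_window [set x | 1 - i.+2%:R^-1 <= x]).
    exact: measurable_ge_half_line.
  by move=> l; exact: hhigh.
apply: filterS (ae_foralln key) => w hw h l hb.
have h0 : 0 < beta - h by rewrite subr_gt0.
pose i := Num.truncn (beta / (beta - h)).
apply: near_everywhereS (hw i l) => x hx k kl.
have hi : beta / (beta - h) < i.+1%:R by rewrite truncnS_gt.
rewrite /environment; apply: le_trans (ler_wpM2l (ltW beta_gt0) (hx k kl)).
rewrite mulrBr mulr1 lerBrDl -lerBrDr ler_pdivrMr// -ler_pdivrMl// mulrC.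
by apply: le_trans (ltW hi) _; rewrite ler_nat.
Qed.

Lemma ae_cumulative :
  {ae P, forall w, exists S, cumulative beta (env w) S (beta * fine 'E_P[V])}.
Proof.
have bV1 : bounded_meas V.
  split=> //; exists 1 => w; have /andP[v0 v1] := V01 w; by rewrite ger0_norm.
have bbV : bounded_meas (fun w => beta * V w) by exact: bounded_measZ.
have EV : Ex P (fun w => beta * V w) = beta * fine 'E_P[V].
  by rewrite ExZ// unlock.
apply: filterS (slope_cumul hT bbV) => w Sw.
exists (cumul T Tinv (fun w => beta * V w) w); split.
- by move=> x; exact: (bV V01).
- by move=> x; rewrite cumul_step.
- by rewrite -EV.
Qed.

(** Two almost sure limits have a common sample point, so the constant selected by [Lambda] can only
    be [L]. *)
Lemma Lambda_eq theta L : {ae P, forall w, UBLB 0 (env w) theta L} -> Lam theta = L.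
Proof.
move=> h.
have cvgL : {ae P, forall w, (fun n : nat => n%:R^-1 * ln (path_expectation (@srw R n) 0
    (tilt T Tinv V beta theta w 0))) @ \oo --> L}.
  apply: filterS h => w ubl.
  have d0 : 0 <= (0 : R) <= 1 by rewrite lexx ler01.
  have E n : path_expectation (@srw R n) 0 (tilt T Tinv V beta theta w 0) =
      value 0 (env w) theta n 0.
    rewrite -srw_path_expectation; congr path_expectation.
    by apply: boolp.funext => z; rewrite tilt_path_weight.
  under eq_fun => n do rewrite E.
  apply/cvgrPdist_le => e e0.
  have e2 : 0 < e / 2 by rewrite divr_gt0.
  have [C hC] := UBLB_dist d0 ubl e2.
  near=> n.
  have n0 : 0 < n%:R :> R by rewrite ltr0n; near: n; exact: nbhs_infty_gt.
  rewrite distrC.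
  have -> : n%:R^-1 * ln (value 0 (env w) theta n 0) - L =
     n%:R^-1 * (ln (value 0 (env w) theta n 0) - n%:R * L).
    by rewrite mulrBr mulKf// gt_eqF.
  rewrite normrM gtr0_norm ?invr_gt0// ler_pdivrMl//.
  have := hC n 0; rewrite mulr0 addr0 /err normr0 addr0 => /le_trans; apply.
  have : 2 * `|C| / e <= n%:R.
    by near: n; exact: nbhs_infty_ger.
  rewrite ler_pdivrMr// => hn; have := ler_norm C; lra.
rewrite /Lambda; apply: xget_unique => // L' hL'.
have [w [h1 h2]] : exists w, (((fun n : nat => n%:R^-1 * ln (path_expectation (@srw R n) 0
    (tilt T Tinv V beta theta w 0))) @ \oo --> L) /\
  ((fun n : nat => n%:R^-1 * ln (path_expectation (@srw R n) 0
    (tilt T Tinv V beta theta w 0))) @ \oo --> L')).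
  by apply: ae_exists; apply: filterS2 cvgL hL'.
exact: (cvg_unique _ h2 h1).
Unshelve. all: by end_near. Qed.

Context (hhigh : {ae P, forall w, high (env w) beta}).

Lemma env_ge0 w x : 0 <= env w x.
Proof. by have /andP[] := bV V01 beta_gt0 (iterz T Tinv x w). Qed.

Lemma Lambda_linear theta L : {ae P, forall w, linear_exponent beta (env w) theta L} ->
  Lam theta = L.
Proof.
move=> h; apply: Lambda_eq; apply: filterS2 h hhigh => w lin hi.
apply: linear_UBLB hi lin; exact: env_ge0.
Qed.

(** Either every exponent above [beta] is at least [|theta|], or, by continuity and unboundedness,
    [|theta|] is itself an exponent. The second conjunct, free of [w], later gives the uniqueness of
    [theta_bar]. *)
Lemma ae_linear theta :
  {ae P, forall w, linear_exponent beta (env w) theta (Lam theta)} /\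
  (Lam theta = beta \/ beta < Lam theta /\ lyap (Lam theta) = `|theta|).
Proof.
have [flat|] := pselect (forall lam, beta < lam -> `|theta| <= lyap lam).
  have h : {ae P, forall w, linear_exponent beta (env w) theta beta}.
    have key (k : nat) : {ae P, forall w,
        exists2 m, corr (env w) (beta + k.+1%:R^-1) m & `|theta| <= m}.
      have bk : beta < beta + k.+1%:R^-1 by rewrite ltrDl invr_gt0.
      apply: filterS (ae_corr hT mV V01 beta_gt0 bk) => w hw.
      by exists (lyap (beta + k.+1%:R^-1)) => //; exact: flat.
    by apply: filterS (ae_foralln key) => w hw; left.
  by rewrite (Lambda_linear h); split => //; left.
move=> /existsNP[l0 /not_implyP[bl0 /negP]]; rewrite -ltNge => l0t.
have [lam bl ml] := lyapunov_onto hT mV V01 beta_gt0 bl0 l0t.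
have h : {ae P, forall w, linear_exponent beta (env w) theta lam}.
  by apply: filterS (ae_corr hT mV V01 beta_gt0 bl) => w hw; right; rewrite -ml.
by rewrite (Lambda_linear h); split => //; right.
Qed.

(** The growth ratio never exceeds [expR c] and falls short of it by a definite factor where
    [V >= 1/2]. The strict inequality is what makes [theta_bar] positive. *)
Lemma lyapunov_lt lam c : beta < lam -> 0 <= c -> expR lam = cosh c ->
  (0 < P [set w | 2^-1 <= V w]%R)%E -> lyap lam < c.
Proof.
Transparent lyapunov.
move=> bl c0 lc PA; set A := [set w | _] in PA.
have mA : measurable A.
  by rewrite -[X in measurable X]setTI; exact: mV (measurable_ge_half_line _).
have b2 := coeff_ge2 V01 beta_gt0 bl.
have ec : 1 <= expR c by rewrite -expR0 ler_expR.
(* One step of the continued fraction at a site with [V >= 1/2] bounds the ratio by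
   [2 cosh c exp (- beta / 2) - exp (- c)], which equals [exp c (1 - eta)]. *)
pose eta := 2 * cosh c * (1 - expR (- (beta / 2))) * expR (- c).
have eta0 : 0 < eta.
  have b1 : 0 < 1 - expR (- (beta / 2)) by rewrite subr_gt0 expR_lt1 oppr_lt0 divr_gt0.
  have K0 := cosh_gt0 c.
  by rewrite mulr_gt0 ?expR_gt0// mulr_gt0// mulr_gt0.
have coeffK w : coeff V beta lam w <= expR c + (expR c)^-1.
  apply: le_trans (coeff_le V01 beta_gt0 _ _) _; rewrite lc -expRN /cosh; lra.
have gle w : growth Tinv V beta lam w <= expR c by apply: cflim_upper.
have g1 w : 1 <= growth Tinv V beta lam w by exact: growth_ge1.
have lnle w : ln (growth Tinv V beta lam w) <= c - eta * \1_A w.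
  have lin : ln (growth Tinv V beta lam w) <= c + (growth Tinv V beta lam w * expR (- c) - 1).
    have -> : ln (growth Tinv V beta lam w) = c + ln (growth Tinv V beta lam w * expR (- c)).
      rewrite lnM ?posrE ?expR_gt0 ?(lt_le_trans ltr01)// expRK; ring.
    rewrite lerD2l -[X in ln X](subrK 1) addrC; apply: le_ln1Dx.
    by rewrite ltrBrDl subrr mulr_gt0 ?expR_gt0// (lt_le_trans ltr01).
  apply: le_trans lin _; rewrite lerD2l.
  have e1 : expR c * expR (- c) = 1 by rewrite -expRD subrr expR0.
  have e0 := expR_gt0 (- c).
  rewrite indicE; case: (boolP (w \in A)) => [|_].
    rewrite inE /A /= => vw; rewrite mulr1.
    have gw : growth Tinv V beta lam w <= 2 * cosh c * expR (- (beta / 2)) - expR (- c).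
      rewrite /growth cflim_rec//; apply: lerB.
        rewrite /coeff -mulrA ler_pM2l// -lc -expRD ler_expR lerD2l lerN2.
        by rewrite ler_pM2l.
      have inv : (expR c)^-1 <= (growth Tinv V beta lam (Tinv w))^-1.
        by rewrite lef_pV2 ?posrE ?expR_gt0// (lt_le_trans ltr01).
      by rewrite expRN; exact: inv.
    have := ler_wpM2r (ltW e0) gw; rewrite /eta /cosh; nra.
  by rewrite mulr0 oppr0 subr_le0 -e1 ler_pM2r.
have bI : bounded_meas (fun w => c - eta * \1_A w : R).
  apply: bounded_measD; first exact: bounded_meas_cst.
  apply: bounded_measN; apply: bounded_measZ; exact: bounded_meas_indic.
apply: le_lt_trans (Ex_le P (bounded_ln_growth hT mV V01 beta_gt0 bl) bI lnle) _.
have bA : bounded_meas (\1_A : Omega -> R) by exact: bounded_meas_indic.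
rewrite ExB ?Ex_cst ?ExZ ?Ex_indic//; [|exact: bounded_meas_cst|exact: bounded_measZ].
rewrite ltrBlDr ltrDl mulr_gt0// fine_gt0// PA /=.
by apply: le_lt_trans (probability_le1 P mA) _; exact: ltry.
Qed.

Opaque lyapunov.

(** For uniqueness, [Lambda (y - c) = log cosh c] exceeds [beta], which rules out the flat
    alternative; the exponent at [log cosh c] is then [|y - c| = c - y]. *)
Lemma theta_barE c : 0 < c -> beta < ln (cosh c) ->
  (0 < P [set w | 2^-1 <= V w]%R)%E ->
  theta_bar P T Tinv V beta c = c - lyap (ln (cosh c)).
Proof.
move=> c0 bl PA; have elc : expR (ln (cosh c)) = cosh c by rewrite lnK// posrE cosh_gt0.
have mlt := lyapunov_lt bl (ltW c0) elc PA.
have mge := lyapunov_ge hT mV V01 beta_gt0 bl.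
have m0 : 0 < lyap (ln (cosh c)) by apply: lt_le_trans mge; rewrite subr_gt0.
rewrite /theta_bar; apply: xget_unique => [|y [/andP[y0 yc] Ly]].
  split; first by rewrite subr_gt0 mlt /= gtrBl.
  apply: Lambda_linear; apply: filterS (ae_corr hT mV V01 beta_gt0 bl) => w hw.
  by right; split => //; rewrite addrAC subrr add0r normrN ger0_norm// ltW.
have [_] := ae_linear (y - c); rewrite Ly => -[lb|[_ ml]].
  by move: bl; rewrite lb ltxx.
by rewrite ml ltr0_norm ?subr_lt0// opprB; ring.
Qed.

End almost_sure.

(** [control_c delta] is the inverse hyperbolic tangent of [delta]. *)
Lemma control_ccontrol {R : realType} (delta : R) : 0 < delta < 1 ->
  0 < control_c delta /\ control delta (control_c delta).
Proof.
move=> /andP[d0 d1]; rewrite /control_c.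
have p0 : 0 < 1 + delta by lra. have q0 : 0 < 1 - delta by lra.
have r1 : 1 < (1 + delta) / (1 - delta) by rewrite ltr_pdivlMr//; lra.
split; first by rewrite mulr_gt0 ?invr_gt0// ln_gt0.
set c := _ * _; have cc : c + c = ln ((1 + delta) / (1 - delta)).
  by rewrite /c; field.
have e2 : expR c * expR c = (1 + delta) / (1 - delta).
  by rewrite -expRD cc lnK// posrE divr_gt0.
have ec := expR_gt0 c.
have h : (1 - delta) * (expR c * expR c) = 1 + delta.
  by rewrite e2 mulrC divfK// gt_eqF.
rewrite /control /cosh expRN; split.
  apply: (mulIf (lt0r_neq0 ec)); rewrite -!mulrA.
  have -> : (expR c + (expR c)^-1) * (2^-1 * expR c) = (expR c * expR c + 1) / 2.
    by field; rewrite gt_eqF.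
  have -> : expR c * expR c = (1 + delta) / (1 - delta) by [].
  by field; rewrite gt_eqF.
apply: (mulIf (lt0r_neq0 ec)); rewrite -!mulrA.
have -> : (expR c + (expR c)^-1) * (2^-1 * expR c) = (expR c * expR c + 1) / 2.
  by field; rewrite gt_eqF.
by rewrite e2 mulVf ?gt_eqF//; field; rewrite gt_eqF.
Qed.

Theorem theorem2p4 (R : realType) (d : measure_display)
    (Omega : measurableType d) (P : probability Omega R)
    (T Tinv : Omega -> Omega) (hT : ergodic_automorphism P T Tinv)
    (V : Omega -> R) (mV : measurable_fun setT V)
    (V01 : forall w, 0 <= V w <= 1)
    (V_nonconstant : exists w1 w2, V w1 <> V w2)
    (V_inf : ess_inf P (EFin \o V) = 0%E)
    (V_sup : ess_sup P (EFin \o V) = 1%E)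
    (V_low : forall (h : R) (l : nat), 0 < h < 1 -> (0 < l)%N ->
       (0 < P [set w | forall y : nat, (y <= l)%N ->
                       V (iterz T Tinv y%:Z w) <= h]%R)%E)
    (V_high : forall (h : R) (l : nat), 0 < h < 1 -> (0 < l)%N ->
       (0 < P [set w | forall y : nat, (y <= l)%N ->
                       h <= V (iterz T Tinv y%:Z w)]%R)%E)
    (delta beta theta : R) (delta01 : 0 <= delta <= 1) (beta_gt0 : 0 < beta) :
  {ae P, forall w, forall K : set (R * R),
     compact K -> K `<=` [set tx | 0 <= tx.1] ->
     {uniform K, u_eps T Tinv V delta beta theta w eps @[eps --> 0^'+] -->
        (fun tx : R * R => tx.1 * Hbar P T Tinv V delta beta theta
                           + theta * tx.2)}}.
Proof.
have hi := ae_high hT mV beta_gt0 V_high.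
have lo := ae_low hT mV beta_gt0 V_low.
have Vb w x : 0 <= environment T Tinv V beta w x <= beta by exact: (bV V01).
suff key : {ae P, forall w, UBLB delta (environment T Tinv V beta w) theta
    (Hbar P T Tinv V delta beta theta)}.
  apply: filterS key => w hw K cK K0.
  have dist eps : 0 < eps -> exists C, forall n x,
     `|u T Tinv V delta beta theta n x w - (n%:R * Hbar P T Tinv V delta beta theta
       + theta * x%:~R)| <= err eps C n x.
    move=> eps0; have [C hC] := UBLB_dist delta01 hw eps0; exists C => n x.
    by rewrite u_value.
  exact: uniform_limit dist cK K0.
rewrite /Hbar; case: eqP => [->|/eqP d0].
  have [lin _] := ae_linear hT mV V01 beta_gt0 hi theta.
  by apply: filterS2 lin hi => w lw hw; apply: linear_UBLB hw lw => x; have /andP[] := Vb w x.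
case: eqP => [->|/eqP d1].
  apply: filterS2 (ae_cumulative hT mV V01 beta_gt0) lo => w [S hS] low.
  apply: (full_UBLB theta hS low).
  rewrite mulr_ge0 ?(ltW beta_gt0)// unlock fine_ge0// integral_ge0// => x _.
  by rewrite lee_fin; have /andP[] := V01 x.
have d01 : 0 < delta < 1.
  by move: delta01; rewrite !le_eqVlt eq_sym (negbTE d0) (negbTE d1) /=.
have [c0 dc] := control_ccontrol d01; have /andP[dpos _] := d01.
move: (control_c delta) c0 dc => c c0 dc.
(* For either sign of [theta] the free walk is needed at slope [|theta| - c]: a negative [theta] is
   reflected together with the environment, and linear exponents are invariant under reflection. *)
have [lin _] := ae_linear hT mV V01 beta_gt0 hi (`|theta| - c).
have good : {ae P, forall w, good_env beta (environment T Tinv V beta w)}.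
  by apply: filterS2 hi lo => w h1 h2; split.
have th0 := normr_ge0 theta.
case: ifPn => lcb.
  apply: filterS2 good lin => w hg hl.
  apply: UBLB_norm => _; first exact: (weak_pos dpos c0 dc hg th0 hl lcb).
  exact: (weak_pos dpos c0 dc (good_refl hg) th0 (linear_exponent_refl hl) lcb).
rewrite -ltNge in lcb.
have PA : (0 < P [set w | 2^-1 <= V w]%R)%E.
  have h01 : 0 < (2^-1 : R) < 1 by rewrite invr_gt0 ltr0n invf_lt1// ltr1n.
  have := V_high 2^-1 1%N h01 isT; move/lt_le_trans; apply.
  apply: le_measure; rewrite ?inE//.
  - exact: (measurable_window hT mV 1 (measurable_ge_half_line 2^-1)).
  - by rewrite -[X in measurable X]setTI; exact: mV (measurable_ge_half_line _).
  - by move=> w /(_ 0%N isT).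
have mge := lyapunov_ge hT mV V01 beta_gt0 lcb.
have elc : expR (ln (cosh c)) = cosh c by rewrite lnK// posrE cosh_gt0.
have mlt := lyapunov_lt hT mV V01 beta_gt0 lcb (ltW c0) elc PA.
rewrite (theta_barE hT mV V01 beta_gt0 hi c0 lcb PA).
have m0 : 0 <= lyapunov P Tinv V beta (ln (cosh c)).
  by apply: le_trans mge; rewrite subr_ge0 ltW.
rewrite (ger0_norm (x := c - _)) ?subr_ge0 ?(ltW mlt)//.
have corlc := ae_corr hT mV V01 beta_gt0 lcb.
apply: filterS3 good lin corlc => w hg hl hc.
apply: UBLB_norm => _; first exact: (strong_pos dpos c0 dc hg th0 hl lcb hc m0).
exact: (strong_pos dpos c0 dc (good_refl hg) th0 (linear_exponent_refl hl) lcb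
  (corr_refl hc) m0).
Qed.
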